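(* If a knot projection $P$ satisfies $r(P)=2$, then the chord diagram of $P$ contains a sub-chord diagram consisting of three chords, two of which do not intersect each other and both of which intersect the third. Equivalently, there are three distinct double points $a,b,x$ of $P$ that are met in the cyclic order $x,a,b,x,b,a$ along $P$ (ignoring the passages through all other double points).
   Context: A knot projection is the image of a generic immersion of an unoriented circle into the sphere $S^2$ (the only singularities are transverse double points); every knot projection is assumed to have at least one double point. The chord diagram of a knot projection $P$ is a circle (the source of the immersion) in which, for each double point, the two preimages are joined by a chord. A sub-chord diagram is obtained by deleting some chords. A double point $c$ of $P$ is nugatory if there is a simple closed curve in $S^2$ meeting $P$ only at $c$ and transverse there to both branches of $P$. A knot projection is reducible if it has a nugatory double point. A splice at a double point removes a small neighbourhood of the double point and reconnects the four ends in one of the two planar ways without a crossing. Orient $P$ arbitrarily: the splice compatible with the orientation is the Seifert splice; the other is the non-Seifert splice (applied alone it produces one closed curve). This does not depend on the orientation chosen. Shimizu's reductivity $r(P)$ is the minimum number of non-Seifert splices, applied recursively (each splice is applied to a double point of the knot projection resulting from the previous splices, non-Seifert with respect to that knot projection), needed to obtain a reducible knot projection from $P$; $r(P)=0$ if $P$ is reducible. *)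

(* Defs.v *)
From HB Require Import structures.
From mathcomp Require Import all_boot all_order all_algebra.
From mathcomp Require Import all_classical all_reals all_analysis.

Set Implicit Arguments.
Unset Strict Implicit.
Unset Printing Implicit Defensive.

Import Order.TTheory GRing.Theory Num.Theory.
Import numFieldNormedType.Exports.

Local Open Scope ring_scope.
Local Open Scope classical_set_scope.

(* The source circle is R / Z: a closed curve is a 1-periodic map on R, and two
   parameters s, t give the same point of the circle iff s - t is an integer.
   A knot projection P is handled through a parametrization g, so P = range g;
   parametrizing also orients P, which is harmless since every notion below is
   insensitive to the choice of parametrization. *)

Section KnotProjections.
Variable R : realType.

Definition dot (u v : 'rV[R]_3) : R := (u *m v^T) 0 0.

Definition sphere : set 'rV[R]_3 := [set p | dot p p = 1].

Definition same_source (s t : R) : bool := s - t \is a Num.int.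

Definition closed_curve (g : R -> 'rV[R]_3) : Prop :=
  [/\ continuous g, forall t, g (t + 1) = g t & forall t, sphere (g t)].

Definition simple_closed_curve (g : R -> 'rV[R]_3) : Prop :=
  closed_curve g /\ forall s t, g s = g t -> same_source s t.

(* Immersions are taken of class C^1. *)
Definition immersion (g : R -> 'rV[R]_3) : Prop :=
  [/\ closed_curve g,
      forall t, derivable g t 1,
      continuous (derive1 g) &
      forall t, derive1 g t != 0].

(* Two distinct points of the source circle with the same image. *)
Definition double_pair (g : R -> 'rV[R]_3) (s t : R) : Prop :=
  ~~ same_source s t /\ g s = g t.

Definition double_point (g : R -> 'rV[R]_3) (c : 'rV[R]_3) : Prop :=
  exists s t, double_pair g s t /\ g s = c.

(* Velocities lie in the 2-dimensional tangent plane of the sphere, so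
   transversality of two branches is linear independence. *)
Definition transverse (u v : 'rV[R]_3) : bool := row_free (col_mx u v).

Definition generic_immersion (g : R -> 'rV[R]_3) : Prop :=
  [/\ immersion g,
      forall s t, double_pair g s t -> transverse (derive1 g s) (derive1 g t) &
      forall s t u, double_pair g s t -> double_pair g s u -> same_source t u].

Definition knot_projection (g : R -> 'rV[R]_3) : Prop :=
  generic_immersion g /\ exists c, double_point g c.

(* The auxiliary curve is an arbitrary (continuous) simple closed curve; it is
   only required to have a velocity at c, where transversality is asked. *)
Definition nugatory (g : R -> 'rV[R]_3) (c : 'rV[R]_3) : Prop :=
  double_point g c /\
  exists d : R -> 'rV[R]_3,
    [/\ simple_closed_curve d,
        range d `&` range g = [set c],
        d 0 = c,
        derivable d 0 1 &
        forall s, g s = c -> transverse (derive1 d 0) (derive1 g s)].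

Definition reducible (g : R -> 'rV[R]_3) : Prop := exists c, nugatory g c.

Definition cap (c : 'rV[R]_3) (h : R) : set 'rV[R]_3 :=
  [set p | sphere p /\ h <= dot c p].

Definition simple_arc (k : R -> 'rV[R]_3) (D : set 'rV[R]_3)
    (p q : 'rV[R]_3) : Prop :=
  [/\ {within `[0, 1], continuous k},
      {in `[0, 1] &, injective k},
      forall u, u \in `[0, 1] -> D (k u) &
      k 0 = p /\ k 1 = q].

(* The cap is the small neighbourhood of c: it meets the curve exactly in the
   two arcs g [s1, s2] and g [t1, t2], which pass through c at times s and t
   and have no other double point.  Following the orientation, g s1 and g t1
   are the ends running into c, g s2 and g t2 those running out of it.  The
   Seifert splice joins in-ends to out-ends; the splice below joins the two
   in-ends by k1 and the two out-ends by k2. *)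
Definition nonSeifert_splice_at (g : R -> 'rV[R]_3) (c : 'rV[R]_3)
    (g' : R -> 'rV[R]_3) : Prop :=
  exists (h s1 s s2 t1 t t2 : R) (k1 k2 : R -> 'rV[R]_3),
    [/\ [/\ s1 < s < s2, s2 < t1, t1 < t < t2 & t2 < s1 + 1],
        g s = c /\ g t = c,
        (forall u, u \in `[s1, s1 + 1[ ->
           (cap c h (g u) <-> (u \in `[s1, s2]) || (u \in `[t1, t2]))) /\
        (forall p, double_point g p -> cap c h p -> p = c),
        [/\ simple_arc k1 (cap c h) (g s1) (g t1),
            simple_arc k2 (cap c h) (g s2) (g t2) &
            k1 @` `[0, 1] `&` k2 @` `[0, 1] = set0] &
        range g' = (range g `\` cap c h)
                   `|` (k1 @` `[0, 1] `|` k2 @` `[0, 1])].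

Definition nonSeifert_splice (g g' : R -> 'rV[R]_3) : Prop :=
  knot_projection g' /\
  exists c, double_point g c /\ nonSeifert_splice_at g c g'.

Fixpoint reducible_after (n : nat) (g : R -> 'rV[R]_3) : Prop :=
  if n is m.+1 then
    exists g', nonSeifert_splice g g' /\ reducible_after m g'
  else reducible g.

(* r(P) = n. *)
Definition has_reductivity (g : R -> 'rV[R]_3) (n : nat) : Prop :=
  reducible_after n g /\ forall m, (m < n)%N -> ~ reducible_after m g.

(* The chord of a double point is given by its two preimages, represented in
   [0, 1[ and listed in increasing order. *)
Definition chord_diagram (g : R -> 'rV[R]_3) : set (R * R) :=
  [set e | [/\ 0 <= e.1, e.1 < e.2, e.2 < 1 & g e.1 = g e.2]].

Definition chords_intersect (e f : R * R) : bool :=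
  (e.1 < f.1 < e.2) && (e.2 < f.2) || (f.1 < e.1 < f.2) && (f.2 < e.2).

End KnotProjections.

(* Main.v *)
Require Import Defs.
From HB Require Import structures.
From mathcomp Require Import all_boot all_order all_algebra.
From mathcomp Require Import all_classical all_reals all_analysis.
From mathcomp Require Import ring lra.
Set Implicit Arguments.
Unset Strict Implicit.
Unset Printing Implicit Defensive.
Import Order.TTheory GRing.Theory Num.Theory.
Import numFieldNormedType.Exports.
Local Open Scope ring_scope.
Local Open Scope classical_set_scope.

(** Suppose that [g] is irreducible and stays irreducible after any single
    non-Seifert splice.  Take any chord [c = (s, t)].  A chord crossed by no other
    chord is nugatory, so some chord [(p, q)] crosses [c].  The splice at [c]
    reverses the arc from [t] to [s + 1], hence moves the chord [(p, q)] to
    [(p, s + t + 1 - q)]; in the spliced curve, which is irreducible too, this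
    chord is again crossed by some chord [(x, y)].  Undoing the reversal, [(x, y)]
    crosses exactly one of the chords [c] and [(p, q)] in [g]; as these two cross
    each other, that one meets the two others, which are disjoint.  This is
    [irreducible_pattern].

    The proof rests on two geometric facts.

    An uncrossed chord is nugatory ([isolated_nugatory]).  Near the double point
    the curve cuts the sphere into four quadrants, and it suffices to join two
    opposite quadrants by an arc in the complement of the curve.  Instead of the
    Jordan curve theorem, a parity argument is used.  Let [chi] be the indicator
    function of a union of components of the complement, and call jump of a
    branch at a parameter the difference of [chi] between its two sides.  The jump
    is constant between double points, and at a double point it changes by the
    sum of [chi] over the four quadrants, whichever of the two branches is
    followed.  Since the chord is uncrossed, the loop from [s] to [t] passes twice
    through each of its double points, so that the jumps at its two ends agree
    ([opposite_quadrants]); this says that opposite quadrants at [g s] have the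
    same value.  Applied to the set of points that can be reached by a simple arc
    leaving the double point along a fixed geodesic, this gives the closed curve.

    The splice exists ([splice_exists]).  Near the double point the corners are
    rounded by [corner]: the displacements along both branches are added, after a
    change of parameter by a smoothing [phi] of the positive part, and the sum is
    projected to the sphere.
    Away from the rounding one of the displacements vanishes and the corner runs
    along the curve itself, so no gluing of derivatives is needed.

    Most local estimates are sign conditions on determinants [det3] of three
    vectors, which are insensitive to the radial projection [normalize].
    Statements about all small scales are written with a radius [r] near [0^'+],
    so that they combine as filters. *)

(** * Vectors of the space *)
Section Vectors.
Variable R : realType.
Local Notation V := 'rV[R]_3.
Implicit Types a b c p q u v w : V.

Definition i0 : 'I_3 := Ordinal (isT : (0 < 3)%N).
Definition i1 : 'I_3 := Ordinal (isT : (1 < 3)%N).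
Definition i2 : 'I_3 := Ordinal (isT : (2 < 3)%N).

Lemma I3P (P : 'I_3 -> Prop) : P i0 -> P i1 -> P i2 -> forall i, P i.
Proof.
move=> P0 P1 P2 [[|[|[|//]]] H].
- by rewrite (_ : Ordinal H = i0) //; apply: val_inj.
- by rewrite (_ : Ordinal H = i1) //; apply: val_inj.
- by rewrite (_ : Ordinal H = i2) //; apply: val_inj.
Qed.

Lemma rv3P p q :
  p 0 i0 = q 0 i0 -> p 0 i1 = q 0 i1 -> p 0 i2 = q 0 i2 -> p = q.
Proof. by move=> h0 h1 h2; apply/rowP; apply: I3P. Qed.

Lemma sumI3 (F : 'I_3 -> R) : \sum_i F i = F i0 + F i1 + F i2.
Proof.
rewrite !big_ord_recl big_ord0 addr0 addrA.
by congr (_ + _ + _); congr F; apply: val_inj.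
Qed.

Lemma dotE p q :
  dot p q = p 0 i0 * q 0 i0 + p 0 i1 * q 0 i1 + p 0 i2 * q 0 i2.
Proof. by rewrite /dot mxE sumI3 !mxE. Qed.

Definition cross p q : V := \row_i
  nth 0 [:: p 0 i1 * q 0 i2 - p 0 i2 * q 0 i1; p 0 i2 * q 0 i0 - p 0 i0 * q 0 i2;
            p 0 i0 * q 0 i1 - p 0 i1 * q 0 i0] i.

Definition det3 a b c := dot a (cross b c).

Definition coordE := (dotE, mxE).

Lemma det3E a b c : det3 a b c =
  a 0 i0 * (b 0 i1 * c 0 i2 - b 0 i2 * c 0 i1) +
  a 0 i1 * (b 0 i2 * c 0 i0 - b 0 i0 * c 0 i2) +
  a 0 i2 * (b 0 i0 * c 0 i1 - b 0 i1 * c 0 i0).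
Proof. by rewrite /det3 dotE !mxE. Qed.

Lemma dotC p q : dot p q = dot q p.
Proof. by rewrite !dotE; ring. Qed.

Lemma dotDl p q w : dot (p + q) w = dot p w + dot q w.
Proof. by rewrite !dotE !mxE; ring. Qed.

Lemma dotZl k p w : dot (k *: p) w = k * dot p w.
Proof. by rewrite !dotE !mxE; ring. Qed.

Lemma dotBl p q w : dot (p - q) w = dot p w - dot q w.
Proof. by rewrite !dotE !mxE; ring. Qed.

Lemma dotDr p q w : dot w (p + q) = dot w p + dot w q.
Proof. by rewrite !dotE !mxE; ring. Qed.

Lemma dotBr p q w : dot w (p - q) = dot w p - dot w q.
Proof. by rewrite !dotE !mxE; ring. Qed.

Lemma dotZr k p w : dot w (k *: p) = k * dot w p.
Proof. by rewrite !dotE !mxE; ring. Qed.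

Lemma dot_ge0 p : 0 <= dot p p.
Proof. by rewrite dotE -!expr2 !addr_ge0 ?sqr_ge0. Qed.

Lemma dot_eq0 p : dot p p = 0 -> p = 0.
Proof.
rewrite dotE -!expr2 => /eqP; rewrite !paddr_eq0 ?addr_ge0 ?sqr_ge0 // !sqrf_eq0.
by move=> /andP[/andP[/eqP h0 /eqP h1] /eqP h2]; apply: rv3P; rewrite mxE.
Qed.

Lemma dot_gt0 p : p != 0 -> 0 < dot p p.
Proof.
move=> p0; rewrite lt_neqAle dot_ge0 andbT eq_sym.
by apply: contra_neq p0; exact: dot_eq0.
Qed.

Lemma det3_addl a b w : det3 a b (b + w) = det3 a b w.
Proof. by rewrite !det3E !mxE; ring. Qed.

Lemma det3_addr a b w : det3 a w (b + w) = - det3 a b w.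
Proof. by rewrite !det3E !mxE; ring. Qed.

(** The cross product of two vectors orthogonal to the unit vector [c] is a
    multiple of [c], so it vanishes as soon as its component along [c] does. *)
Lemma transverse_det3 c u v : sphere c -> dot c u = 0 -> dot c v = 0 ->
  transverse u v = (det3 c u v != 0).
Proof.
move=> c1 cu cv; apply/idP/idP => [tr|].
  apply/eqP => det0.
  have cross0 : cross u v = 0.
    apply: dot_eq0.
    have -> : dot (cross u v) (cross u v) = dot c c * dot (cross u v) (cross u v).
      by rewrite (c1 : dot c c = 1) mul1r.
    transitivity (det3 c u v ^+ 2 + dot (dot c v *: u - dot c u *: v)
                                        (dot c v *: u - dot c u *: v)).
      by rewrite det3E !coordE /=; ring.
    by rewrite det0 cu cv !scale0r subr0 !coordE; ring.
  have dep : dot u u *: v = dot u v *: u.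
    apply/eqP; rewrite -subr_eq0; apply/eqP.
    transitivity (- cross u (cross u v)).
      by apply: rv3P; rewrite !coordE /=; ring.
    by rewrite cross0; apply: rv3P; rewrite !mxE /= ?mxE; ring.
  have u0 : dot u u = 0.
    apply/eqP/negPn/negP => nz.
    have: (row_mx ((- dot u v)%:M : 'M[R]_1) ((dot u u)%:M : 'M[R]_1) *m col_mx u v) == 0.
      by rewrite mul_row_col !mul_scalar_mx scaleNr dep addNr.
    rewrite mulmx_free_eq0 // => /eqP/matrixP/(_ 0 (rshift 1 0)).
    by rewrite row_mxEr !mxE eqxx mulr1n => /eqP; rewrite (negbTE nz).
  have: (row_mx (1%:M : 'M[R]_1) (0 : 'M[R]_1) *m col_mx u v) == 0.
    by rewrite mul_row_col mul0mx addr0 mul1mx (dot_eq0 u0).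
  rewrite mulmx_free_eq0 // => /eqP/matrixP/(_ 0 (lshift 1 0)).
  by rewrite row_mxEl !mxE /= => /eqP; rewrite oner_eq0.
move=> det0; rewrite /transverse -kermx_eq0; apply/rowV0P => x /sub_kermxP.
rewrite -[x]hsubmxK (mx11_scalar (lsubmx x)) (mx11_scalar (rsubmx x)).
move: (lsubmx x 0 0) (rsubmx x 0 0) => k l.
rewrite mul_row_col !mul_scalar_mx => E.
have k0 : k = 0.
  apply: (mulIf det0); rewrite mul0r.
  have -> : k * det3 c u v = det3 c (k *: u + l *: v) v.
    by rewrite !det3E !coordE /=; ring.
  by rewrite E det3E !coordE /=; ring.
have l0 : l = 0.
  apply: (mulIf det0); rewrite mul0r.
  have -> : l * det3 c u v = det3 c u (k *: u + l *: v).
    by rewrite !det3E !coordE /=; ring.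
  by rewrite E det3E !coordE /=; ring.
by rewrite k0 l0 raddf0 row_mx0.
Qed.

End Vectors.

(** * Limits and derivatives of space curves *)
Section Calculus.
Variable R : realType.
Local Notation V := 'rV[R]_3.
Implicit Types a b c p q u v w : V.

Lemma small_ex (P : R -> Prop) : (\forall r \near 0^'+, P r) -> exists2 r, 0 < r & P r.
Proof.
move=> HP; near (0 : R)^'+ => r; exists r; near: r => //; exact: nbhs_right_gt.
Unshelve. all: by end_near. Qed.

Lemma small_intro (r0 : R) (P : R -> Prop) :
  0 < r0 -> (forall r, 0 < r -> r < r0 -> P r) -> \forall r \near 0^'+, P r.
Proof.
move=> r00 HP; apply: filterS2 (nbhs_right_gt (0:R)) (nbhs_right_lt r00) => r; exact: HP.
Qed.

Lemma near_small (W : normedModType R) (x0 : W) (P : W -> Prop) :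
  (\forall x \near x0, P x) -> \forall d \near 0^'+, forall x, `|x - x0| < d -> P x.
Proof.
move=> /nbhs_normP[e /= e0 He]; apply: (small_intro e0) => r r0 re x xr.
by apply: He; rewrite /ball_ /= distrC (lt_trans xr).
Qed.

Lemma cont_small (W W' : normedModType R) (f : W -> W') (x0 : W) (e : R) :
  {for x0, continuous f} -> 0 < e ->
  \forall d \near 0^'+, forall x, `|x - x0| < d -> `|f x - f x0| < e.
Proof.
by move=> fc e0; apply: near_small; move/cvgrPdist_lt : fc => /(_ _ e0);
   apply: filterS => x; rewrite distrC.
Qed.

Lemma cvg_rv (T : Type) (F : set_system T) {FF : Filter F} (f : T -> V) (l : V) :
  (forall i, f x 0 i @[x --> F] --> l 0 i) -> f @ F --> l.
Proof.
move=> H; apply/cvgrPdist_lt => e e0.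
have: \forall x \near F, forall i, `|l 0 i - f x 0 i| < e.
  by apply: filter_forall => i; move/cvgrPdist_lt: (H i); exact.
apply: filterS => x Hx; rewrite [ltLHS]/Num.Def.normr /= mx_normrE.
by apply/bigmax_ltP; split=> // -[i j] _ /=; rewrite !mxE ord1.
Qed.

Lemma rv_cvg (T : Type) (F : set_system T) {FF : Filter F} (f : T -> V) (l : V) i :
  f @ F --> l -> f x 0 i @[x --> F] --> l 0 i.
Proof.
move=> H; exact: (@cvg_comp _ _ _ f (fun p : V => p 0 i) F _ _ H (@coord_continuous _ _ _ 0 i l)).
Qed.

Arguments rv_cvg {T F FF f l} i.

Lemma cvg_dot (T : Type) (F : set_system T) {FF : Filter F} (f g : T -> V) p q :
  f @ F --> p -> g @ F --> q -> dot (f x) (g x) @[x --> F] --> dot p q.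
Proof.
move=> fp gq; under eq_cvg do rewrite dotE.
rewrite dotE; exact: (cvgD (cvgD (cvgM (rv_cvg i0 fp) (rv_cvg i0 gq))
  (cvgM (rv_cvg i1 fp) (rv_cvg i1 gq))) (cvgM (rv_cvg i2 fp) (rv_cvg i2 gq))).
Qed.

Lemma cvg_cross (T : Type) (F : set_system T) {FF : Filter F} (f g : T -> V) p q :
  f @ F --> p -> g @ F --> q -> cross (f x) (g x) @[x --> F] --> cross p q.
Proof.
move=> fp gq; apply: cvg_rv; apply: I3P => /=;
  by under eq_cvg do rewrite mxE; rewrite mxE /=;
     exact: (cvgB (cvgM (rv_cvg _ fp) (rv_cvg _ gq)) (cvgM (rv_cvg _ fp) (rv_cvg _ gq))).
Qed.

Lemma cvg_det3 (T : Type) (F : set_system T) {FF : Filter F} (f g h : T -> V) a b c :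
  f @ F --> a -> g @ F --> b -> h @ F --> c ->
  det3 (f x) (g x) (h x) @[x --> F] --> det3 a b c.
Proof. by move=> fa gb hc; apply: cvg_dot => //; apply: cvg_cross. Qed.

Lemma det3_small a0 b0 c0 : det3 a0 b0 c0 != 0 -> \forall r \near 0^'+,
  forall a b c, `|a - a0| < r -> `|b - b0| < r -> `|c - c0| < r ->
    0 < det3 a b c * det3 a0 b0 c0.
Proof.
move=> D0.
have C : det3 z.1.1 z.1.2 z.2 @[z --> ((a0, b0), c0)] --> det3 a0 b0 c0.
  apply: cvg_det3; [|..].
  - by apply: (cvg_comp _ _ cvg_fst); exact: cvg_fst.
  - by apply: (cvg_comp _ _ cvg_fst); exact: cvg_snd.
  - exact: cvg_snd.
have: \forall z \near ((a0, b0), c0), 0 < det3 z.1.1 z.1.2 z.2 * det3 a0 b0 c0.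
  apply: (cvgr_gt _ (cvgM C (cvg_cst (det3 a0 b0 c0)))).
  by rewrite -expr2 exprn_even_gt0.
move=> /near_small; apply: filterS => r H a b c ha hb hc.
apply: (H ((a, b), c)); rewrite !prod_normE /=.
by rewrite !gt_max ha hb.
Qed.

Definition normalize p : V := (Num.sqrt (dot p p))^-1 *: p.

Lemma sqrt_dot_gt0 p : p != 0 -> 0 < Num.sqrt (dot p p).
Proof. by move=> p0; rewrite sqrtr_gt0 dot_gt0. Qed.

Lemma sphere_neq0 p : sphere p -> p != 0.
Proof.
move=> p1; apply/eqP => p0; move: p1; rewrite /sphere /= p0 !coordE !mul0r !addr0.
by move/eqP; rewrite eq_sym oner_eq0.
Qed.

Lemma normalize_sphere p : p != 0 -> sphere (normalize p).
Proof.
move=> p0; rewrite /sphere /= dotZl dotZr mulrA -expr2 exprVn sqr_sqrtr ?dot_ge0 //.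
by rewrite mulVf // gt_eqF // dot_gt0.
Qed.

Lemma normalize_id p : sphere p -> normalize p = p.
Proof. by move=> p1; rewrite /normalize (p1 : dot p p = 1) sqrtr1 invr1 scale1r. Qed.

Lemma normalize_eq p : p != 0 -> p = Num.sqrt (dot p p) *: normalize p.
Proof. by move=> p0; rewrite /normalize scalerA divff ?scale1r // gt_eqF // sqrt_dot_gt0. Qed.

Lemma normalize0 : normalize 0 = 0.
Proof. by rewrite /normalize scaler0. Qed.

Lemma cvg_normalize (T : Type) (F : set_system T) {FF : Filter F} (f : T -> V) p : p != 0 ->
  f @ F --> p -> normalize (f x) @[x --> F] --> normalize p.
Proof.
move=> p0 fp; apply: cvgZ => //; apply: cvgV; first by rewrite gt_eqF // sqrt_dot_gt0.
by apply: (cvg_comp _ _ (cvg_dot fp fp)); exact: sqrt_continuous.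
Qed.

Lemma is_derive_rv (f : R -> V) (x : R) (d : V) :
  (forall i, is_derive x 1 (fun y => f y 0 i) (d 0 i)) -> is_derive x 1 f d.
Proof.
move=> H; have df : derivable f x 1.
  by apply/derivable_mxP => i j; rewrite ord1; case: (H j).
split=> //; rewrite derive_mx //; apply/rowP => i; rewrite mxE.
by case: (H i).
Qed.

Lemma rv_is_derive (f : R -> V) (x : R) (d : V) i :
  is_derive x 1 f d -> is_derive x 1 (fun y => f y 0 i) (d 0 i).
Proof.
move=> [df <-]; split; first by move/derivable_mxP : df; exact.
by rewrite derive_mx // mxE.
Qed.

Lemma is_derive_ext (W : normedModType R) (f : R -> W) (x : R) (d d' : W) :
  is_derive x 1 f d -> d = d' -> is_derive x 1 f d'.
Proof. by move=> h <-. Qed.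

Lemma is_derive_dot (f g : R -> V) (x : R) d e :
  is_derive x 1 f d -> is_derive x 1 g e ->
  is_derive x 1 (fun y => dot (f y) (g y)) (dot d (g x) + dot (f x) e).
Proof.
move=> fd ge.
have := (rv_is_derive i0 fd, rv_is_derive i1 fd, rv_is_derive i2 fd,
         rv_is_derive i0 ge, rv_is_derive i1 ge, rv_is_derive i2 ge).
move=> [[[[[h1 h2] h3] h4] h5] h6].
rewrite (_ : (fun y => dot (f y) (g y)) =
   (fun y => f y 0 i0) * (fun y => g y 0 i0) + (fun y => f y 0 i1) * (fun y => g y 0 i1) +
   (fun y => f y 0 i2) * (fun y => g y 0 i2)); last by apply/funext => y; rewrite dotE.
apply: (is_derive_ext (is_deriveD (is_deriveD (is_deriveM h1 h4) (is_deriveM h2 h5))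
  (is_deriveM h3 h6))).
by rewrite !dotE /GRing.scale /=; ring.
Qed.

Lemma is_derive_scale (k : R -> R) (f : R -> V) (x l : R) d :
  is_derive x 1 k l -> is_derive x 1 f d ->
  is_derive x 1 (fun y => k y *: f y) (l *: f x + k x *: d).
Proof.
move=> kl fd; apply: is_derive_rv => i; have fdi := rv_is_derive i fd.
rewrite (_ : (fun y => _) = k * (fun y => f y 0 i)); last first.
  by apply/funext => y; rewrite mxE.
by apply: is_derive_ext; rewrite !mxE /GRing.scale /=; ring.
Qed.

Lemma is_derive_det3 (f : R -> V) (x : R) d a b :
  is_derive x 1 f d -> is_derive x 1 (fun y => det3 a (f y) b) (det3 a d b).
Proof.
move=> fd; have h := is_derive_dot fd (is_derive_cst (cross b a) x 1).
rewrite (_ : (fun y => _) = (fun y => dot (f y) (cst (cross b a) y))); last first.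
  by apply/funext => y; rewrite /det3 !coordE /= ?mxE; ring.
by apply: is_derive_ext; rewrite /det3 !coordE /= ?mxE; ring.
Qed.

(** The differential of [normalize] at [p], applied to [d]. *)
Definition dnormalize p d : V :=
  (Num.sqrt (dot p p))^-1 *: d - ((Num.sqrt (dot p p))^-1 ^+ 3 * dot p d) *: p.

Lemma is_derive_normalize (f : R -> V) (x : R) d :
  f x != 0 -> is_derive x 1 f d -> is_derive x 1 (fun y => normalize (f y)) (dnormalize (f x) d).
Proof.
move=> f0 fd; have s0 := sqrt_dot_gt0 f0.
have h1 := is_derive_dot fd fd.
have h2 : is_derive x 1 (fun y => Num.sqrt (dot (f y) (f y)))
            ((2 * Num.sqrt (dot (f x) (f x)))^-1 * (dot d (f x) + dot (f x) d)).
  apply: is_derive_ext; first exact: (@is_derive1_comp _ Num.sqrt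
     (fun y => dot (f y) (f y)) x _ _ (is_derive1_sqrt (dot_gt0 f0)) h1).
  by [].
have h3 := @is_deriveV _ (fun y => Num.sqrt (dot (f y) (f y))) _ _ _ (lt0r_neq0 s0) h2.
apply: is_derive_ext; first exact: (is_derive_scale h3 fd).
rewrite /dnormalize addrC; congr (_ + _); rewrite -scaleNr; congr (_ *: _).
rewrite /GRing.scale /= (dotC d).
by field; rewrite gt_eqF.
Qed.

Lemma cvg_dnormalize (T : Type) (F : set_system T) {FF : Filter F} (f g : T -> V) p d : p != 0 ->
  f @ F --> p -> g @ F --> d -> dnormalize (f x) (g x) @[x --> F] --> dnormalize p d.
Proof.
move=> p0 fp gd.
have h : (Num.sqrt (dot (f x) (f x)))^-1 @[x --> F] --> (Num.sqrt (dot p p))^-1.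
  apply: cvgV; first by rewrite gt_eqF // sqrt_dot_gt0.
  by apply: (cvg_comp _ _ (cvg_dot fp fp)); exact: sqrt_continuous.
apply: cvgB; first exact: cvgZ.
apply: cvgZ => //; apply: cvgM; last exact: cvg_dot.
by rewrite !exprS expr0 mulr1; under eq_cvg do rewrite !exprS expr0 mulr1; do ![apply: cvgM => //].
Qed.

Lemma is_derive_cvg (W : normedModType R) (f : R -> W) (x : R) (d : W) :
  is_derive x 1 f d -> {for x, continuous f}.
Proof.
by case=> df _; apply: differentiable_continuous; apply/derivable1_diffP.
Qed.

Lemma is_derive_comp_rv (h : R -> R) (f : R -> V) (x l : R) d :
  is_derive x 1 h l -> is_derive (h x) 1 f d ->
  is_derive x 1 (fun y => f (h y)) (l *: d).
Proof.
move=> hl fd; apply: is_derive_rv => i.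
apply: is_derive_ext; first exact: (is_derive1_comp (rv_is_derive i fd) hl).
by rewrite mxE mulrC.
Qed.

Lemma is_derive_near (f g : R -> V) (x : R) d :
  (\forall y \near x, f y = g y) -> is_derive x 1 f d -> is_derive x 1 g d.
Proof. exact: near_eq_is_derive. Qed.

Lemma is_derive_affine (x k l : R) : is_derive x 1 (fun y => k * y + l) k.
Proof.
rewrite (_ : (fun y => _) = k *: (@id R) + cst l); last exact/funext.
by apply: is_derive_ext; rewrite addr0 /GRing.scale /= mulr1.
Qed.

(** The difference quotients serve as transverse directions: a displacement along
    a branch is a multiple of a vector close to the velocity. *)
Lemma is_derive_quot (f : R -> V) (x : R) d : is_derive x 1 f d -> forall e, 0 < e ->
  \forall r \near 0^'+, forall y, y != 0 -> `|y| < r ->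
   `|y^-1 *: (f (x + y) - f x) - d| < e.
Proof.
move=> [df dv] e e0.
have : h^-1 *: (f (h + x) - f x) @[h --> 0^'] --> d.
  rewrite -dv; under eq_cvg do rewrite -[X in f (X + _)]mulr1; exact: df.
move/cvgrPdist_lt => /(_ _ e0); move=> /nbhs_normP[/= r r0 Hr].
apply: (small_intro r0) => s s0 sr y y0 ys.
rewrite distrC (addrC x); apply: (Hr y) => //=.
by rewrite sub0r normrN (lt_trans ys).
Qed.

End Calculus.

(** * Branches of class C1 *)
Section C1Curves.
Variables (R : realType) (f f' : R -> 'rV[R]_3).
Hypothesis fder : forall x : R, is_derive x 1 f (f' x).
Hypothesis f'cont : continuous f'.
Local Notation V := 'rV[R]_3.

Lemma det3_MVT (a b : V) (x y : R) : y < x -> exists z, [/\ y < z < x &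
  det3 a (f x - f y) b = (x - y) * det3 a (f' z) b].
Proof.
move=> yx.
have h (z : R) : is_derive z 1 (fun t => det3 a (f t) b) (det3 a (f' z) b).
  exact: is_derive_det3.
have ct : {within `[y, x], continuous (fun t => det3 a (f t) b)}.
  by apply: derivable_within_continuous => z _; case: (h z).
have [z /[!in_itv]/= zyx E] := MVT yx (fun z _ => h z) ct.
by exists z; split=> //; rewrite mulrC -E !det3E !mxE; ring.
Qed.

(** Short chords of a C1 curve are nearly tangent, so a determinant that does not
    vanish on the velocity keeps its sign on them. *)
Lemma chord_det (t0 : R) (a0 b0 : V) : det3 a0 (f' t0) b0 != 0 ->
  \forall r \near 0^'+, forall a b x y, `|a - a0| < r -> `|b - b0| < r ->
   `|x - t0| < r -> `|y - t0| < r -> y < x ->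
   0 < det3 a (f x - f y) b * det3 a0 (f' t0) b0.
Proof.
move=> D0; have [e e0 He] := small_ex (det3_small D0).
apply: filterS2 (cont_small (@f'cont t0) e0) (small_intro e0 (fun r _ (h : r < e) => h)).
move=> r Hr re a b x y ha hb hx hy yx.
have [z [/andP[yz zx] ->]] := det3_MVT a b yx.
rewrite -mulrA mulr_gt0 ?subr_gt0 //; apply: He; [exact: lt_trans re| |exact: lt_trans re].
apply: Hr; move: hx hy; rewrite !ltr_distl => /andP[? ?] /andP[? ?].
by rewrite (lt_trans _ yz) ?(lt_trans zx).
Qed.

Lemma chord_det_neq0 (t0 : R) (a0 b0 : V) : det3 a0 (f' t0) b0 != 0 ->
  \forall r \near 0^'+, forall a b x y, `|a - a0| < r -> `|b - b0| < r ->
   `|x - t0| < r -> `|y - t0| < r -> det3 a (f x - f y) b = 0 -> x = y.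
Proof.
move=> D0; apply: filterS (chord_det D0) => r H a b x y ha hb hx hy E.
case: (ltgtP x y) => // xy.
  have := H a b y x ha hb hy hx xy.
  have -> : det3 a (f y - f x) b = - det3 a (f x - f y) b by rewrite !det3E !mxE; ring.
  by rewrite E oppr0 mul0r ltxx.
by have := H a b x y ha hb hx hy xy; rewrite E mul0r ltxx.
Qed.

(** If [f x + e *: w] were on the ray of [f z], the chord from [z] to [x] would have
    determinant zero with [w], against the sign of the determinants of short
    chords; and for [z = x] the vector [w] would be tangent. *)
Lemma branch_avoid (t0 : R) (w0 : V) : f t0 != 0 -> det3 (f t0) (f' t0) w0 != 0 ->
  \forall r \near 0^'+, forall w x z e, `|w - w0| < r ->
   `|x - t0| < r -> `|z - t0| < r -> `|e| < r -> e != 0 -> normalize (f x + e *: w) <> f z.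
Proof.
move=> f0 D0; have [r1 r10 H1] := small_ex (det3_small D0).
have [r2 r20 H2] := small_ex (chord_det_neq0 D0).
have fc : {for t0, continuous f} by apply: is_derive_cvg; exact: fder.
have n0 : 0 < `|f t0| by rewrite normr_gt0.
apply: filterS3 (cont_small fc n0) (filterI (cont_small fc r10) (cont_small fc r20))
  (filterI (cont_small (@f'cont t0) r10)
    (filterI (small_intro r10 (fun r _ h => h)) (small_intro r20 (fun r _ h => h)))).
move=> r C1 [C2 C3] [C4 [r1r r2r]] w x z e hw hx hz he e0 E.
have fz0 : f z != 0.
  by apply/eqP => fz; have := C1 z hz; rewrite fz sub0r normrN ltxx.
have q0 : f x + e *: w != 0 by apply: contra_neq fz0 => q0; rewrite -E q0 normalize0.
move: (Num.sqrt _) (normalize_eq q0) => l; rewrite E => Eq.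
have xz : x = z.
  apply: (H2 (f x) w) => //.
  - exact: C3.
  - exact: lt_trans r2r.
  - exact: lt_trans r2r.
  - exact: lt_trans r2r.
  transitivity (- (det3 (f x + e *: w) (f z) w)); first by rewrite !det3E !mxE; ring.
  by rewrite Eq !det3E !mxE; ring.
have := H1 (f x) (f' x) w (C2 x hx) (C4 x hx) (lt_trans hw r1r).
rewrite (_ : det3 (f x) (f' x) w = 0) ?mul0r ?ltxx //.
apply: (mulfI e0); rewrite mulr0.
transitivity (det3 (f x) (f' x) (f x + e *: w)); first by rewrite !det3E !mxE; ring.
by rewrite Eq -xz !det3E !mxE; ring.
Qed.

End C1Curves.

(** * Local structure of a generic immersion *)
Section GenericImmersions.
Variable R : realType.
Local Notation V := 'rV[R]_3.

Lemma same_sourceP (s t : R) : reflect (exists k : int, s = t + k%:~R) (same_source s t).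
Proof.
apply: (iffP intrP) => -[k E]; exists k; last by rewrite E addrC addKr.
by rewrite -E; ring.
Qed.

Lemma same_source_refl (s : R) : same_source s s.
Proof. by rewrite /same_source subrr rpred0. Qed.

Lemma same_source_sym (s t : R) : same_source s t = same_source t s.
Proof. by rewrite /same_source -rpredN opprB. Qed.

Lemma same_source_trans (t s u : R) : same_source s t -> same_source t u -> same_source s u.
Proof. by move=> h1 h2; have := rpredD h1 h2; rewrite addrA subrK. Qed.

Lemma not_same_source (s t : R) : s < t -> t < s + 1 -> ~~ same_source s t.
Proof.
move=> st ts; apply/negP => /same_sourceP[k E].
have : -1 < k%:~R :> R by lra.
have : k%:~R < 0 :> R by lra.
by rewrite -(intrN R 1) !ltr_int ltrz0; case: k {E} => [//|[|n]].
Qed.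

Lemma int_small (k : int) : -1 < k%:~R :> R -> k%:~R < 1 :> R -> k = 0.
Proof.
rewrite -(intrN R 1) ltr_int ltrz1 => h1 h2; apply/eqP; rewrite eq_le.
by move: h1; rewrite -lezD1 addNr => ->; rewrite andbT -ltzD1 add0r.
Qed.

Lemma shift_into (m x : R) : exists k : int, m <= x + k%:~R < m + 1.
Proof.
exists (- Num.floor (x - m)); rewrite rmorphN /=.
have /andP[h1] := floor_itv (x - m); rewrite rmorphD /= => h2.
by apply/andP; split; lra.
Qed.

Variable g : R -> V.
Hypothesis gg : generic_immersion g.
Local Notation dg := (derive1 g).

Lemma g_per t (k : int) : g (t + k%:~R) = g t.
Proof.
have [[[_ per _] _ _ _] _ _] := gg.
have H (n : nat) s : g (s + n%:R) = g s.
  elim: n s => [|n IH] s; first by rewrite addr0.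
  by rewrite -natr1 addrA per IH.
case: k => n; first exact: H.
by rewrite NegzE rmorphN /= -[in RHS](subrK n.+1%:R t) H.
Qed.

Lemma g_der (t : R) : is_derive t 1 g (dg t).
Proof.
by have [[_ gd _ _] _ _] := gg; rewrite derive1E; exact/derivableP.
Qed.

Lemma dg_cont : continuous dg.
Proof. by have [[]] := gg. Qed.

Lemma g_cont : continuous g.
Proof. by have [[[]]] := gg. Qed.

Lemma dg_neq0 t : dg t != 0.
Proof. by have [[_ _ _ h] _ _] := gg. Qed.

Lemma g_sphere t : sphere (g t).
Proof. by have [[[_ _ h] _ _ _] _ _] := gg; exact: h. Qed.

Lemma g_neq0 t : g t != 0.
Proof. exact/sphere_neq0/g_sphere. Qed.

Lemma dg_per t (k : int) : dg (t + k%:~R) = dg t.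
Proof.
have h : is_derive t 1 g (dg (t + k%:~R)).
  have e : \forall x \near t, g (1 * x + k%:~R) = g x.
    by near=> x; rewrite mul1r g_per.
  apply: (is_derive_near e).
  rewrite -[dg _]scale1r; apply: is_derive_comp_rv; first exact: is_derive_affine.
  by rewrite mul1r; exact: g_der.
by case: h => _ <-; case: (g_der t).
Unshelve. all: by end_near. Qed.

Lemma dg_same s t : same_source s t -> dg s = dg t.
Proof. by move=> /same_sourceP[k ->]; rewrite dg_per. Qed.

Lemma dot_g_dg t : dot (g t) (dg t) = 0.
Proof.
have h := is_derive_dot (g_der t) (g_der t).
have h2 : is_derive t 1 (fun y => dot (g y) (g y)) 0.
  rewrite (_ : (fun y => _) = cst 1); first exact: is_derive_cst.
  by apply/funext => y; exact: g_sphere.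
have : dot (dg t) (g t) + dot (g t) (dg t) = 0 by case: h => _ <-; case: h2.
by rewrite dotC => /eqP; rewrite -mulr2n mulrn_eq0 /= => /eqP.
Qed.

Lemma dot_g_dg_at c t : g t = c -> dot c (dg t) = 0.
Proof. by move=> <-; exact: dot_g_dg. Qed.

Lemma double_det3 s t : double_pair g s t -> det3 (g s) (dg s) (dg t) != 0.
Proof.
move=> dp; have [_ tr _] := gg; have := tr _ _ dp.
rewrite (@transverse_det3 _ (g s)) //; [exact: g_sphere|exact: dot_g_dg|].
by apply: dot_g_dg_at; case: dp.
Qed.

Lemma double_unique s t u : double_pair g s t -> g u = g s ->
  same_source u s \/ same_source u t.
Proof.
move=> dp gu; have [us|nus] := boolP (same_source u s); [by left|right].
have [_ _ un] := gg; rewrite same_source_sym; apply: un dp _.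
by split; rewrite // same_source_sym.
Qed.

Definition normal t := cross (g t) (dg t).

Lemma normal_det3 t : 0 < det3 (g t) (dg t) (normal t).
Proof.
have -> : det3 (g t) (dg t) (normal t) = dot (normal t) (normal t).
  by rewrite det3E !coordE /=; ring.
apply: dot_gt0; apply/eqP => n0.
have : dot (normal t) (normal t) = 0 by rewrite n0 !coordE !mul0r !addr0.
have -> : dot (normal t) (normal t) = dot (g t) (g t) * dot (dg t) (dg t) - dot (g t) (dg t) ^+ 2.
  by rewrite !coordE /=; ring.
rewrite dot_g_dg (g_sphere t : dot _ _ = 1) mul1r expr0n subr0 => /dot_eq0/eqP.
by rewrite (negbTE (dg_neq0 t)).
Qed.

Lemma normal_cont : continuous normal.
Proof. by move=> t; apply: cvg_cross; [exact: g_cont|exact: dg_cont]. Qed.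

(** By compactness of the circle: away from the parameters of [p0], the curve stays
    at a positive distance from [p0]. *)
Lemma close_parameter (p0 : V) (t0 t1 r : R) : 0 < r ->
  (forall x, g x = p0 -> same_source x t0 \/ same_source x t1) ->
  \forall d \near 0^'+, forall x, `|g x - p0| < d ->
    exists k : int, `|x + k%:~R - t0| < r \/ `|x + k%:~R - t1| < r.
Proof.
move=> r0 Hp.
have /compact_near_coveringP cI : compact `[0 : R, 1]%classic by exact: segment_compact.
have := cI R 0^'+ (fun d x => `|g x - p0| < d ->
    exists k : int, `|x + k%:~R - t0| < r \/ `|x + k%:~R - t1| < r) _.
case=> [x0 _|/= e e0 He]; last first.
  exists e => //= d de d0 x xd; have [k /andP[k0 k1]] := shift_into 0 x.
  have [||k' H] := He d de d0 (x + k%:~R) _; rewrite ?g_per //.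
    by rewrite /= in_itv /= k0; move: k1; rewrite add0r => /ltW.
  by exists (k + k'); rewrite rmorphD /= addrA.
have [E|ne] := eqVneq (g x0) p0.
  have near_x0 : \forall x \near x0, `|x - x0| < r.
    by apply/nbhs_normP; exists r => // x /=; rewrite distrC.
  near=> x d => _.
  have xr : `|x - x0| < r by near: x.
  case: (Hp _ E) => /same_sourceP[k Ek]; exists (- k); rewrite rmorphN /=; [left|right].
    by rewrite (_ : x - k%:~R - t0 = x - x0) // Ek; ring.
  by rewrite (_ : x - k%:~R - t1 = x - x0) // Ek; ring.
have n0 : 0 < `|g x0 - p0| / 2 by rewrite divr_gt0 // normr_gt0 subr_eq0.
have gx0 : \forall x \near x0, `|g x0 - g x| < `|g x0 - p0| / 2.
  by have /cvgrPdist_lt := @g_cont x0; apply.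
near=> x d => gxd; exfalso.
have h1 : `|g x0 - g x| < `|g x0 - p0| / 2 by near: x.
have h2 : d < `|g x0 - p0| / 2 by near: d; exact: nbhs_right_lt.
have h3 : `|g x0 - p0| <= `|g x0 - g x| + `|g x - p0| := ler_distD _ _ _.
have h4 := le_lt_trans h3 (ltrD h1 (lt_trans gxd h2)).
by rewrite -splitr ltxx in h4.
Unshelve. all: by end_near. Qed.

Lemma locally_injective t0 : \forall r \near 0^'+, forall x y,
  `|x - t0| < r -> `|y - t0| < r -> g x = g y -> x = y.
Proof.
have := chord_det_neq0 g_der dg_cont (lt0r_neq0 (normal_det3 t0 : 0 < det3 _ (dg t0) _)).
apply: filterS2 (nbhs_right_gt (0 : R)) => r r0 H x y hx hy E.
apply: (H (g t0) (normal t0)) => //; rewrite ?subrr ?normr0 //.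
by rewrite E subrr det3E !mxE; ring.
Qed.

(** The point [g y] of the second branch is displaced from the double point in a
    direction close to [dg t1], which is transverse to the first branch. *)
Lemma branches_meet_once t0 t1 : double_pair g t0 t1 -> \forall r \near 0^'+,
  forall x y, `|x - t0| < r -> `|y - t1| < r -> g x = g y -> x = t0 /\ y = t1.
Proof.
move=> dp; have D := double_det3 dp; have [_ E01] := dp.
have [r1 r10 H1] := small_ex (chord_det_neq0 g_der dg_cont D).
apply: filterS3 (is_derive_quot (g_der t1) r10) (small_intro r10 (fun r _ h => h))
  (locally_injective t1) => r Q rr1 inj x y hx hy E.
have r0 : 0 < r by apply: le_lt_trans hx.
have r'0 : 0 < r1 by [].
have [yt|yt] := eqVneq y t1.
  split=> //; apply: (H1 (g t0) (dg t1)); rewrite ?subrr ?normr0 //.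
    exact: lt_trans rr1.
  by rewrite E yt E01 subrr det3E !mxE; ring.
have yt0 : y - t1 != 0 by rewrite subr_eq0.
exfalso; move/eqP: (yt); apply.
have xt : x = t0.
  apply: (H1 (g t0) ((y - t1)^-1 *: (g (t1 + (y - t1)) - g t1))); rewrite ?subrr ?normr0 //.
  - by apply: Q.
  - exact: lt_trans rr1.
  by rewrite (addrC t1) subrK E E01 !det3E !mxE; ring.
by apply: inj; rewrite ?subrr ?normr0 // -E xt.
Qed.

Definition crossing t := exists s, double_pair g t s.

Lemma crossing_or t : crossing t \/ (forall x, g x = g t -> same_source x t).
Proof.
have [|nc] := pselect (crossing t); [by left|right=> x E].
by apply/negPn/negP => ns; apply: nc; exists x; split; rewrite // same_source_sym.
Qed.

Lemma noncrossing_near t0 : ~ crossing t0 ->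
  \forall r \near 0^'+, forall x, `|x - t0| < r -> ~ crossing x.
Proof.
move=> nc; have [r1 r10 inj] := small_ex (locally_injective t0).
have Hp x : g x = g t0 -> same_source x t0 \/ same_source x t0.
  by case: (crossing_or t0) => // h /h; left.
have [d d0 Hd] := small_ex (close_parameter r10 Hp).
apply: filterS2 (cont_small (@g_cont t0) d0) (small_intro r10 (fun r _ h => h)).
move=> r C rr1 x hx [z [xz E]].
have [k H] : exists k : int, `|z + k%:~R - t0| < r1.
  have [|k []] := Hd z; [by rewrite -E; exact: C|by exists k|by exists k].
have Ex : x = z + k%:~R by apply: inj => //; [exact: lt_trans rr1|rewrite g_per].
by move/negP: xz; apply; apply/same_sourceP; exists k.
Qed.

Lemma crossing_isolated t0 t1 : double_pair g t0 t1 ->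
  \forall r \near 0^'+, forall x, `|x - t0| < r -> crossing x -> x = t0.
Proof.
move=> dp; have [r1 r10 [inj once]] :=
  small_ex (filterI (locally_injective t0) (branches_meet_once dp)).
have [d d0 Hd] := small_ex (close_parameter r10 (fun x => @double_unique t0 t1 x dp)).
apply: filterS2 (cont_small (@g_cont t0) d0) (small_intro r10 (fun r _ h => h)).
move=> r C rr1 x hx [z [xz E]].
have [|k [H|H]] := Hd z; first by rewrite -E; exact: C.
  have Ex : x = z + k%:~R by apply: inj => //; [exact: lt_trans rr1|rewrite g_per].
  by exfalso; move/negP: xz; apply; apply/same_sourceP; exists k.
have Ez : g x = g (z + k%:~R) by rewrite g_per.
by have [] := once x (z + k%:~R) (lt_trans hx rr1) H Ez.
Qed.

End GenericImmersions.

(** * Two combinatorial tools *)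
Section Intervals.
Variable R : realType.

(** A form of compactness of segments: the supremum of the parameters related to
    [a] can be crossed, so it is [b]. *)
Lemma interval_chain (P : R -> R -> Prop) (a b : R) : a <= b ->
  (forall x, a <= x <= b -> exists2 r, 0 < r & forall y z, x - r < y -> y <= x ->
     x <= z -> z < x + r -> a <= y -> z <= b -> P y z) ->
  (forall x y z, P x y -> P y z -> P x z) -> P a b.
Proof.
move=> ab loc tr.
pose S := [set x | a <= x <= b /\ P a x].
have Sa : S a.
  split; first by rewrite lexx.
  have [|r r0 H] := loc a; first by rewrite lexx.
  by apply: H => //; lra.
have hS : has_sup S.
  by split; [exists a|exists b => x [/andP[]]].
have s_ab : a <= sup S <= b.
  by apply/andP; split; [exact: sup_upper_bound|apply: ge_sup => [|x [/andP[]]]; first by exists a].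
have [r r0 H] := loc _ s_ab.
have [x [/andP[ax xb] Pax] sx] := sup_adherent r0 hS.
have xs : x <= sup S by apply: sup_upper_bound => //; split=> //; rewrite ax.
have /andP[as_ sb] := s_ab.
have Pz z : sup S <= z -> z < sup S + r -> z <= b -> P a z.
  by move=> h1 h2 h3; apply: tr Pax (H _ _ _ _ _ _ _ _).
have [h|h] := ltP b (sup S + r); first exact: Pz.
have : S (sup S + r / 2).
  split; first by lra.
  by apply: Pz; lra.
by move=> /(sup_upper_bound hS); lra.
Qed.

Lemma locally_constant (T : Type) (h : R -> T) (a b : R) : a <= b ->
  (forall x, a <= x <= b -> exists2 r, 0 < r & forall y, a <= y <= b -> `|y - x| < r ->
     h y = h x) -> h a = h b.
Proof.
move=> ab loc; apply: (@interval_chain (fun y z => h y = h z)) => // [x xab|x y z -> //].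
have [r r0 H] := loc x xab; exists r => // y z h1 h2 h3 h4 h5 h6.
by move/andP: xab => [? ?]; rewrite (H y) ?(H z) //; rewrite ?ltr_distl; lra.
Qed.

(** Each pair formed by [x] and [i x] contributes twice the same term. *)
Lemma xor_involution (F : seq R) (i : R -> R) (h : R -> bool) : uniq F ->
  (forall x, x \in F -> [/\ i x \in F, i (i x) = x, i x != x & h (i x) = h x]) ->
  \big[addb/false]_(x <- F) h x = false.
Proof.
move=> uF Hi.
suff E : \big[addb/false]_(x <- F | ~~ (x < i x)) h x = \big[addb/false]_(x <- F | x < i x) h x.
  by rewrite (bigID (fun x => x < i x)) /= E addbb.
rewrite -big_filter (perm_big [seq i x | x <- [seq x <- F | x < i x]]) /=; last first.
  apply: uniq_perm; first exact: filter_uniq.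
    rewrite map_inj_in_uniq ?filter_uniq // => x y.
    rewrite !mem_filter => /andP[_ /Hi[_ ix _ _]] /andP[_ /Hi[_ iy _ _]] E.
    by rewrite -ix E.
  move=> x; apply/idP/mapP => [|[y]].
    rewrite mem_filter => /andP[nlt xF]; have [iF ii ne _] := Hi x xF.
    exists (i x); last by rewrite ii.
    by rewrite mem_filter iF ii andbT lt_neqAle ne leNgt.
  rewrite !mem_filter => /andP[lt yF] ->; have [iF ii ne _] := Hi y yF.
  by rewrite iF ii andbT -leNgt ltW.
rewrite big_map big_filter big_seq_cond [RHS]big_seq_cond.
by apply: eq_bigr => x /andP[/Hi[]].
Qed.

End Intervals.

(** * The complement near the curve *)
Section Sides.
Variables (R : realType) (g : R -> 'rV[R]_3).
Hypothesis gg : generic_immersion g.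
Local Notation V := 'rV[R]_3.
Local Notation dg := (derive1 g).

(** The complement of the curve is handled through rays rather than points of the
    sphere, so that displacements need not stay on the sphere. *)
Definition off (p : V) := p != 0 /\ forall x, normalize p <> g x.

Lemma off_near t0 t1 (r : R) : 0 < r ->
  (forall x, g x = g t0 -> same_source x t0 \/ same_source x t1) ->
  \forall d \near 0^'+, forall p : V, `|p - g t0| < d ->
   (forall z, `|z - t0| < r -> normalize p <> g z) ->
   (forall z, `|z - t1| < r -> normalize p <> g z) -> off p.
Proof.
move=> r0 Hp; have [d d0 Hd] := small_ex (close_parameter gg r0 Hp).
have Nc : {for g t0, continuous (@normalize R)}.
  by apply: (@cvg_normalize R V (nbhs (g t0)) _ id (g t0)); [exact: (g_neq0 gg)|exact: cvg_id].
have n0 : 0 < `|g t0| by rewrite normr_gt0 (g_neq0 gg).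
apply: filterS2 (cont_small Nc d0) (small_intro n0 (fun r _ h => h)) => e C en p pe H0 H1.
split=> [|x E].
  apply/eqP => p0; move: pe; rewrite p0 sub0r normrN => h.
  by have := lt_trans h en; rewrite ltxx.
have [|k H] := Hd x; first by rewrite -E -[X in _ - X](normalize_id (g_sphere gg t0)); exact: C.
by case: H => H; [apply: (H0 _ H)|apply: (H1 _ H)]; rewrite (g_per gg).
Qed.

Lemma displacement_small (w0 : V) (d : R) (h : R -> V) (t0 : R) : 0 < d ->
  {for t0, continuous h} -> \forall r \near 0^'+, forall x e w, `|x - t0| < r -> `|e| < r ->
   `|w - w0| < r -> `|h x + e *: w - h t0| < d.
Proof.
move=> d0 hc; have d2 : 0 < d / 2 by rewrite divr_gt0.
have W0 : 0 < 1 + `|w0| by rewrite ltr_pwDl.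
have d3 : 0 < d / 2 / (1 + `|w0|) by rewrite divr_gt0.
apply: filterS3 (cont_small hc d2) (small_intro d3 (fun r _ h => h))
  (small_intro ltr01 (fun r _ h => h)).
move=> r C rd r1 x e w hx he hw.
have -> : h x + e *: w - h t0 = (h x - h t0) + e *: w by rewrite addrAC.
rewrite [ltRHS]splitr; apply: (le_lt_trans (ler_normD _ _)); apply: ltrD; first exact: C.
rewrite normrZ; have hw' : `|w| < 1 + `|w0|.
  rewrite -[w](subrK w0); apply: (le_lt_trans (ler_normD _ _)); rewrite ltrD2r.
  exact: lt_trans r1.
have [->|w_n] := eqVneq `|w| 0; first by rewrite mulr0.
rewrite -ltr_pdivlMr; last by rewrite lt_neqAle eq_sym w_n normr_ge0.
apply: (lt_trans he); apply: (lt_trans rd).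
by rewrite ltr_pM2l // ltf_pV2 // posrE // lt_neqAle eq_sym w_n normr_ge0.
Qed.

Lemma off_side t0 w0 : ~ crossing g t0 -> det3 (g t0) (dg t0) w0 != 0 ->
  \forall r \near 0^'+, forall x w e, `|x - t0| < r -> `|w - w0| < r ->
   e != 0 -> `|e| < r -> off (g x + e *: w).
Proof.
move=> nc D; have [r1 r10 av] := small_ex (branch_avoid (g_der gg) (dg_cont gg) (g_neq0 gg t0) D).
have Hp x : g x = g t0 -> same_source x t0 \/ same_source x t0.
  by case: (crossing_or g t0) => // h /h; left.
have [d d0 Hd] := small_ex (off_near r10 Hp).
apply: filterS2 (small_intro r10 (fun r _ h => h))
  (displacement_small w0 d0 (@g_cont _ _ gg t0)) => r rr1 C x w e hx hw e0 he.
have H z : `|z - t0| < r1 -> normalize (g x + e *: w) <> g z.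
  by move=> hz; apply: av => //; exact: lt_trans rr1.
by apply: Hd => //; exact: C.
Qed.

Lemma double_det3_both t0 t1 : double_pair g t0 t1 -> det3 (g t0) (dg t0) (dg t1) != 0 /\
  det3 (g t1) (dg t1) (dg t0) != 0.
Proof.
move=> dp; split; first exact: double_det3.
by apply: double_det3 => //; case: dp => ns E; split; rewrite // same_source_sym.
Qed.

(** At a double point, the signs of [x] and [y] tell in which of the four local
    sectors this point is; for [y = 0] it runs along the branch of [t0], for [x = 0]
    along that of [t1]. *)
Definition quadrant t0 t1 x y := g (t0 + x) + g (t1 + y) - g t0.

Lemma quadrantC t0 t1 x y : g t0 = g t1 -> quadrant t0 t1 x y = quadrant t1 t0 y x.
Proof. by move=> E; rewrite /quadrant E (addrC (g (t0 + x))). Qed.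

Lemma double_pair_sym t0 t1 : double_pair g t0 t1 -> double_pair g t1 t0.
Proof. by case=> ns E; split; rewrite // same_source_sym. Qed.

Lemma quadrantE t0 t1 x y : double_pair g t0 t1 -> y != 0 ->
  quadrant t0 t1 x y = g (t0 + x) + y *: (y^-1 *: (g (t1 + y) - g t1)).
Proof. by case=> _ E y0; rewrite scalerA divff // scale1r /quadrant E addrA. Qed.

(** Seen from either branch, the displacement along the other branch is transverse,
    so that both branches are avoided. *)
Lemma off_quadrant t0 t1 : double_pair g t0 t1 -> \forall r \near 0^'+,
  forall x y, x != 0 -> y != 0 -> `|x| < r -> `|y| < r -> off (quadrant t0 t1 x y).
Proof.
move=> dp; have dp' := double_pair_sym dp; have [D0 D1] := double_det3_both dp.
have [r1 r10 [av0 av1]] := small_ex (filterI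
  (branch_avoid (g_der gg) (dg_cont gg) (g_neq0 gg t0) D0)
  (branch_avoid (g_der gg) (dg_cont gg) (g_neq0 gg t1) D1)).
have [d d0 Hd] := small_ex (off_near r10 (fun x => @double_unique _ _ gg t0 t1 x dp)).
have d2 : 0 < d / 2 by rewrite divr_gt0.
apply: filterS3 (small_intro r10 (fun r _ h => h))
  (filterI (cont_small (@g_cont _ _ gg t0) d2) (cont_small (@g_cont _ _ gg t1) d2))
  (filterI (is_derive_quot (g_der gg t0) r10) (is_derive_quot (g_der gg t1) r10)).
move=> r rr1 [C0 C1] [Q0 Q1] x y x0 y0 hx hy.
have E : g t0 = g t1 by case: dp.
apply: Hd => [|z hz|z hz].
- have -> : quadrant t0 t1 x y - g t0 = (g (t0 + x) - g t0) + (g (t1 + y) - g t1).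
    by rewrite /quadrant -E -!addrA; congr (_ + _); rewrite addrCA addrA.
  rewrite [ltRHS]splitr; apply: (le_lt_trans (ler_normD _ _)); apply: ltrD.
    by apply: C0; rewrite addrC addKr.
  by apply: C1; rewrite addrC addKr.
- rewrite (quadrantE _ dp y0); apply: av0 => //; last exact: lt_trans rr1.
    exact: Q1.
  by rewrite addrC addKr (lt_trans hx).
- rewrite quadrantC // (quadrantE _ dp' x0); apply: av1 => //; last exact: lt_trans rr1.
    exact: Q0.
  by rewrite addrC addKr (lt_trans hy).
Qed.

Lemma off_diagonal t0 t1 : double_pair g t0 t1 -> \forall r \near 0^'+,
  forall e w, e != 0 -> `|e| < r -> `|w - (dg t0 + dg t1)| < r -> off (g t0 + e *: w).
Proof.
move=> dp; have [D0 D1] := double_det3_both dp; have E : g t0 = g t1 by case: dp.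
have D0' : det3 (g t0) (dg t0) (dg t0 + dg t1) != 0.
  by rewrite (det3_addl (g t0) (dg t0) (dg t1)).
have D1' : det3 (g t1) (dg t1) (dg t0 + dg t1) != 0.
  by rewrite addrC (det3_addl (g t1) (dg t1) (dg t0)).
have [r1 r10 [av0 av1]] := small_ex (filterI
  (branch_avoid (g_der gg) (dg_cont gg) (g_neq0 gg t0) D0')
  (branch_avoid (g_der gg) (dg_cont gg) (g_neq0 gg t1) D1')).
have [d d0 Hd] := small_ex (off_near r10 (fun x => @double_unique _ _ gg t0 t1 x dp)).
apply: filterS2 (small_intro r10 (fun r _ h => h))
  (displacement_small (dg t0 + dg t1) d0 (@g_cont _ _ gg t0)) => r rr1 C e w e0 he hw.
have r0 : 0 < r by apply: le_lt_trans he.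
apply: Hd => [|z hz|z hz].
- by apply: C => //; rewrite subrr normr0.
- by apply: av0; rewrite ?subrr ?normr0 //; exact: lt_trans rr1.
- by rewrite E; apply: av1; rewrite ?subrr ?normr0 //; exact: lt_trans rr1.
Qed.

End Sides.

(** * Parity of the crossings of a loop *)
Section Parity.
Variables (R : realType) (g : R -> 'rV[R]_3).
Hypothesis gg : generic_immersion g.
Local Notation V := 'rV[R]_3.
Local Notation dg := (derive1 g).

Variable chi : V -> bool.
Hypothesis chi_loc : forall p, off g p -> \forall q \near p, chi q = chi p.

(** [chi] stands for the indicator function of a union of components of the
    complement of the curve. *)
Lemma chi_path (p : R -> V) (a b : R) : a <= b ->
  (forall x, a <= x <= b -> {for x, continuous p}) ->
  (forall x, a <= x <= b -> off g (p x)) -> chi (p a) = chi (p b).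
Proof.
move=> ab pc po; apply: (@locally_constant _ _ (chi \o p)) => // x xab.
have : \forall y \near x, chi (p y) = chi (p x).
  exact: (pc x xab _ (chi_loc (po x xab))).
by move=> /nbhs_normP[r r0 H]; exists r => // y _ yx; apply: H; rewrite /ball_ /= distrC.
Qed.

Lemma segment_cont (u v : V) : continuous (fun x : R => u + x *: v).
Proof. by move=> x; apply: cvgD; [exact: cvg_cst|apply: cvgZr_tmp; exact: cvg_id]. Qed.

Definition side x w : bool := `[< \forall e \near 0^'+, chi (g x + e *: w) >].

Lemma side_eventually x w (b : bool) (r : R) : 0 < r ->
  (forall e, 0 < e -> e < r -> chi (g x + e *: w) = b) -> side x w = b.
Proof.
move=> r0 H; apply/asboolP/idP => [/filterI/(_ (nbhs_right_lt r0))|b1].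
  move=> /filterI/(_ (nbhs_right_gt 0)); rewrite near_simpl => h.
  by have [e _ [[he er] e0]] := small_ex h; rewrite -(H e).
by apply: (small_intro r0) => e e0 er; rewrite H.
Qed.

(** The points [g x + e *: w] with small positive [e] fill a connected set on one side
    of the curve. *)
Lemma side_const t0 w0 : ~ crossing g t0 -> det3 (g t0) (dg t0) w0 != 0 ->
  \forall r \near 0^'+, forall x w e, `|x - t0| < r -> `|w - w0| < r -> 0 < e -> e < r ->
    chi (g x + e *: w) = side t0 w0.
Proof.
move=> nc D; apply: filterS2 (nbhs_right_gt (0 : R)) (off_side gg nc D) => r r0 H.
have H' x w e : `|x - t0| < r -> `|w - w0| < r -> 0 < e -> e < r -> off g (g x + e *: w).
  by move=> hx hw e0 er; apply: H => //; rewrite ?gt_eqF ?gtr0_norm.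
have C x w e : `|x - t0| < r -> `|w - w0| < r -> 0 < e -> e < r ->
    chi (g x + e *: w) = chi (g t0 + (r / 2) *: w0).
  move=> hx hw e0 er.
  transitivity (chi (g t0 + e *: w)).
    have [xt|tx] := leP x t0.
      apply: (@chi_path (fun y => g y + e *: w) _ _ xt) => y /andP[y1 y2].
        by apply: cvgD; [exact: (@g_cont _ _ gg y)|exact: cvg_cst].
      apply: H' => //; move: hx; rewrite !ltr_distl => /andP[? ?]; lra.
    apply/esym/(@chi_path (fun y => g y + e *: w) _ _ (ltW tx)).
      by move=> y _; apply: cvgD; [exact: (@g_cont _ _ gg y)|exact: cvg_cst].
    by move=> y /andP[y1 y2]; apply: H' => //; move: hx; rewrite !ltr_distl => /andP[? ?]; lra.
  transitivity (chi (g t0 + e *: w0)).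
    transitivity (chi (g t0 + e *: w0 + 1 *: (e *: (w - w0)))).
      by congr chi; rewrite scale1r -addrA -scalerDr (addrC w0) subrK.
    transitivity (chi (g t0 + e *: w0 + 0 *: (e *: (w - w0)))); last first.
      by rewrite scale0r addr0.
    apply/esym/(@chi_path (fun y => g t0 + e *: w0 + y *: (e *: (w - w0))) _ _ ler01).
      by move=> y _; exact: segment_cont.
    move=> y /andP[y0 y1].
    rewrite scalerA mulrC -scalerA -addrA -scalerDr; apply: H' => //.
      by rewrite subrr normr0.
    rewrite addrAC subrr add0r normrZ ger0_norm //.
    by apply: le_lt_trans hw; rewrite ler_piMl.
  have E1 (a b : R) : 0 < a -> a <= b -> b < r -> chi (g t0 + a *: w0) = chi (g t0 + b *: w0).
    move=> a0 ab br; apply: (@chi_path (fun y => g t0 + y *: w0) _ _ ab).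
      by move=> y _; exact: segment_cont.
    by move=> y /andP[y0 y1]; apply: H'; rewrite ?subrr ?normr0 //; lra.
  have [h|h] := leP e (r / 2); first by apply: E1 => //; lra.
  by apply/esym/E1; lra.
move=> x w e hx hw e0 er; rewrite C //; apply/esym/(side_eventually r0).
by move=> e' e'0 e'r; apply: C; rewrite ?subrr ?normr0.
Qed.

Lemma side_near t0 w0 : ~ crossing g t0 -> det3 (g t0) (dg t0) w0 != 0 ->
  \forall r \near 0^'+, forall x w, `|x - t0| < r -> `|w - w0| < r ->
    side x w = side t0 w0.
Proof.
move=> nc D; apply: filterS2 (nbhs_right_gt (0 : R)) (side_const nc D) => r r0 H x w hx hw.
by apply: (side_eventually r0) => e e0 er; exact: H.
Qed.

(** The directions pointing to one side of the tangent form a convex set, along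
    which [side] is locally constant. *)
Lemma side_half_plane x w w' : ~ crossing g x ->
  0 < det3 (g x) (dg x) w * det3 (g x) (dg x) w' -> side x w = side x w'.
Proof.
move=> nc D; pose W (y : R) := w + y *: (w' - w).
have -> : w = W 0 by rewrite /W scale0r addr0.
have -> : w' = W 1 by rewrite /W scale1r (addrC w) subrK.
apply: (@locally_constant _ _ (fun y => side x (W y))) => // y /andP[y0 y1].
have Dy : det3 (g x) (dg x) (W y) != 0.
  have E : det3 (g x) (dg x) (W y) =
      (1 - y) * det3 (g x) (dg x) w + y * det3 (g x) (dg x) w'.
    by rewrite /W !det3E !mxE; ring.
  apply/eqP => E0; move: D E; rewrite E0.
  move: (det3 _ _ w) (det3 _ _ w') => a b ab E.
  have : 0 = (1 - y) * a ^+ 2 + y * (a * b).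
    by transitivity (a * ((1 - y) * a + y * b)); [rewrite -E mulr0|ring].
  have a2 : 0 < a ^+ 2 by rewrite exprn_even_gt0 //=; apply: contraTneq ab => ->; rewrite mul0r ltxx.
  have [->|yn] := eqVneq y 0; first by rewrite subr0 mul1r mul0r addr0 => E2; rewrite -E2 ltxx in a2.
  have yab : 0 < y * (a * b) by rewrite mulr_gt0 // lt_neqAle eq_sym yn.
  have : 0 <= (1 - y) * a ^+ 2 by apply: mulr_ge0; [lra|exact: ltW].
  lra.
have [r r0 H] := small_ex (side_near nc Dy).
have [d d0 Hd] := small_ex (cont_small (@segment_cont w (w' - w) y) r0).
by exists d => // z _ hz; apply: H; [rewrite subrr normr0|exact: Hd].
Qed.

(** The choice of [normal] is immaterial ([jump_side]); it makes [jump] a function of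
    the parameter alone. *)
Definition jump x := side x (normal g x) (+) side x (- normal g x).

Lemma det3Nr (a b c : V) : det3 a b (- c) = - det3 a b c.
Proof. by rewrite !det3E !mxE; ring. Qed.

Lemma jump_side x w : ~ crossing g x -> det3 (g x) (dg x) w != 0 ->
  jump x = side x w (+) side x (- w).
Proof.
move=> nc D; have n0 := normal_det3 gg x; rewrite /jump.
case: (ltgtP 0 (det3 (g x) (dg x) w)) => h; last by rewrite -h eqxx in D.
  rewrite (side_half_plane nc (mulr_gt0 n0 h)) (@side_half_plane _ (- normal g x) (- w)) //.
  by rewrite !det3Nr mulrNN mulr_gt0.
rewrite addbC (@side_half_plane _ (- normal g x) w) // ?(@side_half_plane _ (normal g x) (- w)) //.
  by rewrite !det3Nr mulr_gt0 // oppr_gt0.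
by rewrite det3Nr mulNr -mulrN mulr_gt0 // oppr_gt0.
Qed.

Lemma norm_oppB (a b : V) : `|- a - - b| = `|a - b|.
Proof. by rewrite opprK addrC distrC. Qed.

Lemma jump_near t0 : ~ crossing g t0 -> \forall r \near 0^'+,
  forall x, `|x - t0| < r -> jump x = jump t0.
Proof.
move=> nc; have n0 := normal_det3 gg t0.
have nN : det3 (g t0) (dg t0) (- normal g t0) != 0 by rewrite det3Nr oppr_eq0 lt0r_neq0.
have [r1 r10 [H1 H2]] := small_ex (filterI (side_near nc (lt0r_neq0 n0)) (side_near nc nN)).
apply: filterS2 (small_intro r10 (fun r _ h => h)) (cont_small (@normal_cont _ _ gg t0) r10).
move=> r rr1 C x hx; have xr := lt_trans hx rr1; rewrite /jump.
have E1 : side x (normal g x) = side t0 (normal g t0) by apply: H1 => //; exact: C.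
have E2 : side x (- normal g x) = side t0 (- normal g t0).
  by apply: (H2 x (- normal g x) xr); rewrite norm_oppB; exact: C.
by rewrite E1 E2.
Qed.

Lemma chi_quadrant t0 t1 : double_pair g t0 t1 -> \forall r \near 0^'+,
  forall x y x' y', `|x| < r -> `|y| < r -> `|x'| < r -> `|y'| < r ->
    0 < x * x' -> 0 < y * y' ->
    chi (quadrant g t0 t1 x y) = chi (quadrant g t0 t1 x' y').
Proof.
move=> dp; apply: filterS (off_quadrant gg dp) => r H.
have C t : {for t, continuous g} by exact: (g_cont gg).
have Ct t : continuous (fun x : R => g (t + x)).
  by move=> x; apply: continuous_comp; [apply: cvgD; [exact: cvg_cst|exact: cvg_id]|exact: C].
have Q1 x x' y : x <= x' -> `|x| < r -> `|y| < r -> `|x'| < r -> 0 < x * x' -> y != 0 ->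
    chi (quadrant g t0 t1 x y) = chi (quadrant g t0 t1 x' y).
  move=> xx xr yr xr' x0 y0; apply: (@chi_path (fun z => quadrant g t0 t1 z y) _ _ xx).
    by move=> z _; apply: cvgB; [apply: cvgD; [exact: Ct|exact: cvg_cst]|exact: cvg_cst].
  move=> z /andP[z1 z2]; apply: H => //.
    by apply: contraTneq x0 => z0; rewrite -leNgt; rewrite z0 in z1 z2; rewrite mulr_le0_ge0.
  by move: xr xr'; rewrite !ltr_norml => /andP[? ?] /andP[? ?]; lra.
have Q2 x y y' : y <= y' -> `|x| < r -> `|y| < r -> `|y'| < r -> 0 < y * y' -> x != 0 ->
    chi (quadrant g t0 t1 x y) = chi (quadrant g t0 t1 x y').
  move=> yy xr yr yr' y0 x0; apply: (@chi_path (fun z => quadrant g t0 t1 x z) _ _ yy).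
    by move=> z _; apply: cvgB; [apply: cvgD; [exact: cvg_cst|exact: Ct]|exact: cvg_cst].
  move=> z /andP[z1 z2]; apply: H => //.
    by apply: contraTneq y0 => z0; rewrite -leNgt; rewrite z0 in z1 z2; rewrite mulr_le0_ge0.
  by move: yr yr'; rewrite !ltr_norml => /andP[? ?] /andP[? ?]; lra.
move=> x y x' y' xr yr xr' yr' xx yy.
have y0 : y != 0 by apply: contraTneq yy => ->; rewrite mul0r ltxx.
have x'0 : x' != 0 by apply: contraTneq xx => ->; rewrite mulr0 ltxx.
transitivity (chi (quadrant g t0 t1 x' y)).
  have [h|h] := leP x x'; first exact: Q1.
  by apply/esym/Q1 => //; rewrite ?ltW // mulrC.
have [h|h] := leP y y'; first exact: Q2.
by apply/esym/Q2 => //; rewrite ?ltW // mulrC.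
Qed.

(** Next to a double point, one side of the branch through [t0] lies in one quadrant
    and the other side in the adjacent quadrant across that branch. *)
Lemma jump_quadrant t0 t1 : double_pair g t0 t1 -> \forall r \near 0^'+,
  forall x y, x != 0 -> `|x| < r -> 0 < y -> y < r ->
    jump (t0 + x) = chi (quadrant g t0 t1 x y) (+) chi (quadrant g t0 t1 x (- y)).
Proof.
move=> dp; have [D0 _] := double_det3_both gg dp.
have [r1 r10 [H1 iso]] := small_ex (filterI (chi_quadrant dp) (crossing_isolated gg dp)).
have [r2 r20 H2] := small_ex (det3_small D0).
apply: filterS3 (small_intro r10 (fun r _ h => h)) (cont_small (@g_cont _ _ gg t0) r20)
  (cont_small (@dg_cont _ _ gg t0) r20) => r rr1 C1 C2 x y x0 xr y0 yr.
have hx : `|t0 + x - t0| < r by rewrite addrC addKr.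
have nc : ~ crossing g (t0 + x).
  move=> /(iso _ (lt_trans hx rr1)) /eqP; rewrite -subr_eq0 addrAC subrr add0r.
  by rewrite (negbTE x0).
have D : det3 (g (t0 + x)) (dg (t0 + x)) (dg t1) != 0.
  have := H2 _ _ (dg t1) (C1 _ hx) (C2 _ hx); rewrite subrr normr0 => /(_ r20) h.
  by apply: contraTneq h => ->; rewrite mul0r ltxx.
have D' : det3 (g (t0 + x)) (dg (t0 + x)) (- dg t1) != 0 by rewrite det3Nr oppr_eq0.
rewrite (jump_side nc D).
have [r3 r30 [S1 S2]] := small_ex (filterI (side_const nc D) (side_const nc D')).
have [r4 r40 Q] := small_ex (is_derive_quot (g_der gg t1) r30).
pose e := Num.min (Num.min r1 r3) r4 / 2.
have m0 : 0 < Num.min (Num.min r1 r3) r4 by rewrite !lt_min r10 r30 r40.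
have e0 : 0 < e by rewrite divr_gt0.
have : e < Num.min (Num.min r1 r3) r4 by rewrite /e ltr_pdivrMr // ltr_pMr // ltr1n.
rewrite !lt_min => /andP[/andP[er1 er3] er4].
have en : e != 0 by rewrite gt_eqF.
have ne : `|e| = e by rewrite gtr0_norm.
have ny : `|y| = y by rewrite gtr0_norm.
have xr1 := lt_trans xr rr1; have yr1 := lt_trans yr rr1.
have xx : 0 < x * x by rewrite -expr2 exprn_even_gt0.
have near0 : `|t0 + x - (t0 + x)| < r3 by rewrite subrr normr0.
congr addb.
  have -> : chi (quadrant g t0 t1 x y) = chi (quadrant g t0 t1 x e).
    by apply: H1; rewrite ?ne ?ny // mulr_gt0.
  rewrite (quadrantE _ dp en).
  by apply/esym/S1; rewrite // Q ?ne.
have -> : chi (quadrant g t0 t1 x (- y)) = chi (quadrant g t0 t1 x (- e)).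
  by apply: H1; rewrite ?normrN ?ne ?ny ?mulrNN // mulr_gt0.
rewrite (quadrantE _ dp) ?oppr_eq0 // scaleNr -scalerN.
by apply/esym/S2; rewrite // norm_oppB Q ?oppr_eq0 ?normrN ?ne.
Qed.

Definition jump_left x := `[< \forall e \near 0^'+, jump (x - e) >].
Definition jump_right x := `[< \forall e \near 0^'+, jump (x + e) >].
Definition twist x := jump_left x (+) jump_right x.

Lemma asbool_eventually (P : R -> bool) (b : bool) (r : R) : 0 < r ->
  (forall e, 0 < e -> e < r -> P e = b) -> `[< \forall e \near 0^'+, P e >] = b.
Proof.
move=> r0 H; apply/asboolP/idP => [h|b1].
  have [e _ [[Pe er] e0]] := small_ex (filterI (filterI h (nbhs_right_lt r0)) (nbhs_right_gt (0 : R))).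
  by rewrite -(H e).
by apply: (small_intro r0) => e e0 er; rewrite H.
Qed.

Lemma jump_limits t0 t1 : double_pair g t0 t1 -> \forall r \near 0^'+,
  forall x y, 0 < x -> x < r -> 0 < y -> y < r ->
  jump_left t0 = chi (quadrant g t0 t1 (- x) y) (+) chi (quadrant g t0 t1 (- x) (- y)) /\
  jump_right t0 = chi (quadrant g t0 t1 x y) (+) chi (quadrant g t0 t1 x (- y)).
Proof.
move=> dp; apply: filterS2 (jump_quadrant dp) (chi_quadrant dp) => r J C x y x0 xr y0 yr.
have r0 : 0 < r by apply: lt_trans xr.
have [nx ny] : `|x| = x /\ `|y| = y by rewrite !gtr0_norm.
have yy : 0 < y * y by rewrite mulr_gt0.
split; apply: (asbool_eventually r0) => e e0 er; have ne : `|e| = e by rewrite gtr0_norm.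
  rewrite (J (- e) y) ?oppr_eq0 ?gt_eqF ?normrN ?ne //.
  by congr addb; apply: C; rewrite ?normrN ?ne ?nx ?ny ?mulrNN // mulr_gt0.
rewrite (J e y) ?gt_eqF ?ne //.
by congr addb; apply: C; rewrite ?normrN ?ne ?nx ?ny ?mulrNN // mulr_gt0.
Qed.

(** Both twists are the sum of [chi] over the same four quadrants. *)
Lemma twist_partner t0 t1 : double_pair g t0 t1 -> twist t0 = twist t1.
Proof.
move=> dp; have dp' := double_pair_sym dp; have E : g t0 = g t1 by case: dp.
have [r r0 [L1 L2]] := small_ex (filterI (jump_limits dp) (jump_limits dp')).
have [h0 hr] : 0 < r / 2 /\ r / 2 < r by split; lra.
rewrite /twist; have [-> ->] := L1 _ _ h0 hr h0 hr; have [-> ->] := L2 _ _ h0 hr h0 hr.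
rewrite -!(quadrantC _ _ E).
have xor4 (a b c d : bool) : a (+) b (+) (c (+) d) = d (+) b (+) (c (+) a).
  by case: a b c d => [] [] [] [].
exact: xor4.
Qed.

Lemma jump_left_near t0 : ~ crossing g t0 -> \forall r \near 0^'+,
  forall x, `|x - t0| < r -> jump_left x = jump t0.
Proof.
move=> /jump_near; apply: filterS => r H x hx; have r0 : 0 < r - `|x - t0| by rewrite subr_gt0.
apply: (asbool_eventually r0) => e e0 er; apply: H.
rewrite addrAC; apply: (le_lt_trans (ler_normB _ _)).
by rewrite (gtr0_norm e0) -ltrBrDl.
Qed.

(** The jump is locally constant away from the double points, and passing through
    one changes it by [twist]. *)
Lemma jump_chain a b : a <= b -> exists F : seq R, [/\ uniq F,
  forall x, x \in F <-> a <= x < b /\ crossing g x &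
  jump_left a (+) jump_left b = \big[addb/false]_(x <- F) twist x].
Proof.
move=> ab; apply: (@interval_chain _ (fun a b => a <= b /\ exists F : seq R, [/\ uniq F,
  forall x, x \in F <-> a <= x < b /\ crossing g x &
  jump_left a (+) jump_left b = \big[addb/false]_(x <- F) twist x]) a b ab _ _).2.
- move=> x _; have [[t dp]|nc] := pselect (crossing g x); last first.
    have [r r0 [J nn]] := small_ex (filterI (jump_left_near nc) (noncrossing_near gg nc)).
    exists r => // y z h1 h2 h3 h4 _ _; split; first lra.
    exists [::]; split=> // [u|].
      split=> // -[/andP[u1 u2]]; have /nn // : `|u - x| < r by rewrite ltr_distl; lra.
    by rewrite big_nil !J ?addbb // ltr_distl; lra.
  have [r r0 [[JQ JL] iso]] := small_ex (filterI (filterI (jump_quadrant dp) (jump_limits dp))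
    (crossing_isolated gg dp)).
    have [r' r'0 C] := small_ex (filterI (small_intro r0 (fun s _ h => h)) (chi_quadrant dp)).
  case: C => r'r C.
  have h'0 : 0 < r' / 2 by rewrite divr_gt0.
  have h'r' : r' / 2 < r' by rewrite ltr_pdivrMr // ltr_pMr // ltr1n.
  have h'r := lt_trans h'r' r'r.
  have [jlE jrE] := JL _ _ h'0 h'r h'0 h'r.
  have n2 : `|r' / 2| = r' / 2 by rewrite gtr0_norm.
  have hh : 0 < r' / 2 * (r' / 2) by rewrite mulr_gt0.
  have jumpP e : 0 < e -> e < r' -> jump (x + e) = jump_right x.
    move=> e0 er; have ne : `|e| = e by rewrite gtr0_norm.
    have eh : 0 < e * (r' / 2) by rewrite mulr_gt0.
    rewrite jrE (JQ e (r' / 2)) ?gt_eqF ?ne // ?(lt_trans er) //.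
    by congr addb; apply: C; rewrite ?normrN ?ne ?n2 ?mulrNN.
  have jumpN e : 0 < e -> e < r' -> jump (x - e) = jump_left x.
    move=> e0 er; have ne : `|e| = e by rewrite gtr0_norm.
    have eh : 0 < e * (r' / 2) by rewrite mulr_gt0.
    rewrite jlE (JQ (- e) (r' / 2)) ?oppr_eq0 ?gt_eqF ?normrN ?ne // ?(lt_trans er) //.
    by congr addb; apply: C; rewrite ?normrN ?ne ?n2 ?mulrNN.
  have left y : x - r' < y -> y <= x -> jump_left y = jump_left x.
    move=> h1 h2; have y0 : 0 < y - (x - r') by lra.
    apply: (asbool_eventually y0) => e e0 er.
    rewrite (_ : y - e = x - (x - y + e)); last by ring.
    by apply: jumpN; lra.
  have right z : x < z -> z < x + r' -> jump_left z = jump_right x.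
    move=> h1 h2; have z0 : 0 < z - x by lra.
    apply: (asbool_eventually z0) => e e0 er.
    rewrite (_ : z - e = x + (z - x - e)); last by ring.
    by apply: jumpP; lra.
  exists r' => // y z h1 h2 h3 h4 _ _; split; first lra.
  have cr u : y <= u < z -> crossing g u -> u = x.
    by move=> /andP[u1 u2]; apply: iso; rewrite ltr_distl; lra.
  case: (ltgtP x z) h3 => // xz _; last first.
    exists [::]; split; [by []|move=> u|].
      split=> // -[uyz] /(cr _ uyz) E; move: uyz; rewrite E => /andP[_].
      by rewrite -xz ltxx.
    by rewrite big_nil -xz (left y h1 h2) addbb.
  exists [:: x]; split; [by []|move=> u|by rewrite big_seq1 (left y h1 h2) (right z xz h4)].
  rewrite inE; split=> [/eqP ->|[uyz /(cr _ uyz) ->]]; last exact: eqxx.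
  by split; [apply/andP|exists t].
- move=> x y z [xy [F1 [u1 m1 e1]]] [yz [F2 [u2 m2 e2]]]; split; first exact: le_trans yz.
  exists (F1 ++ F2); split=> [|u|].
  + rewrite cat_uniq u1 u2 andbT /=; apply/hasPn => u /m2[/andP[yu _] _].
    by apply/negP => /m1[/andP[_ uy] _]; lra.
  + rewrite mem_cat; split=> [/orP[/m1|/m2] [/andP[h1 h2] h3]|[/andP[h1 h2] h3]].
    * by split=> //; lra.
    * by split=> //; lra.
    * have [h|h] := ltP u y; apply/orP; [left; apply/m1|right; apply/m2]; split=> //; lra.
  + have xor3 (b1 b2 b3 : bool) : b1 (+) b3 = (b1 (+) b2) (+) (b2 (+) b3) by case: b1 b2 b3 => [] [] [].
    rewrite (xor3 _ (jump_left y) _) big_cat.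
    exact: (congr2 addb e1 e2).
Qed.

(** The loop from [s] to [t] passes twice through each of its double points, and
    the two passages have the same twist; so the jumps at its two ends agree.  The
    first one compares the quadrants on both sides of the branch leaving along
    [dg s], the second one those on both sides of the branch arriving along [dg t];
    they have one quadrant in common. *)
Lemma opposite_quadrants s t : s < t -> t < s + 1 -> g s = g t ->
  (forall x y, s < x -> x < t -> t < y -> y < s + 1 -> g x <> g y) ->
  \forall r \near 0^'+, forall x y, 0 < x -> x < r -> 0 < y -> y < r ->
    chi (quadrant g s t x y) = chi (quadrant g s t (- x) (- y)).
Proof.
move=> st ts E isol; have dp : double_pair g s t by split=> //; exact: not_same_source.
have dp' := double_pair_sym dp.
have partner u : s < u -> u < t -> crossing g u ->
    exists v, [/\ s < v, v < t & double_pair g u v].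
  move=> su ut [v [uv Euv]]; have [k /andP[k0 k1]] := shift_into s v.
  have Ev : g u = g (v + k%:~R) by rewrite (g_per gg).
  have nv : ~~ same_source u (v + k%:~R).
    apply: contra uv => /same_source_trans; apply.
    by apply/same_sourceP; exists k.
  exists (v + k%:~R).
  have us : ~~ same_source u s by rewrite same_source_sym not_same_source //; lra.
  have ut' : ~~ same_source u t by rewrite not_same_source //; lra.
  have gu : g u <> g s.
    by move=> /(double_unique gg dp)[]; apply/negP.
  split=> //.
    rewrite lt_neqAle k0 andbT; apply/eqP => sv; apply: gu; by rewrite Ev -sv.
  case: (ltgtP (v + k%:~R) t) => // h; first by case: (isol u _ su ut h k1).
  by case: gu; rewrite Ev h E.
pose i u := xget 0 [set v | [/\ s < v, v < t & double_pair g u v]].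
have iP u : s < u -> u < t -> crossing g u ->  [/\ s < i u, i u < t & double_pair g u (i u)].
  move=> su ut cu; have [v Hv] := partner u su ut cu.
  exact: (xgetI (P := [set v | [/\ s < v, v < t & double_pair g u v]]) _ Hv).
have uniq_in u v : s < u -> u < t -> s < v -> v < t -> same_source u v -> u = v.
  move=> su ut sv vt uv; case: (ltgtP u v) => // h; exfalso.
    have h1 : v < u + 1 by lra.
    by move: (not_same_source h h1); rewrite uv.
  have h1 : u < v + 1 by lra.
  by move: (not_same_source h h1); rewrite same_source_sym uv.
have [r r0 [[[J J'] C] [iso iso']]] := small_ex (filterI (filterI
  (filterI (jump_quadrant dp) (jump_quadrant dp')) (chi_quadrant dp))
  (filterI (crossing_isolated gg dp) (crossing_isolated gg dp'))).
pose q := Num.min (r / 2) ((t - s) / 3).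
have st0 : 0 < (t - s) / 3 by lra.
have q0 : 0 < q by rewrite lt_min divr_gt0.
have qr : q < r.
  by apply: (@le_lt_trans _ _ (r / 2)); [rewrite ge_min lexx|rewrite ltr_pdivrMr // ltr_pMr // ltr1n].
have qst : q <= (t - s) / 3 by rewrite ge_min lexx orbT.
have nq : `|q| = q by rewrite gtr0_norm.
have nca : ~ crossing g (s + q).
  by move=> /iso; rewrite addrAC subrr add0r nq => /(_ qr); lra.
have ncb : ~ crossing g (t - q).
  by move=> /iso'; rewrite addrAC subrr add0r normrN nq => /(_ qr); lra.
have leftE u : ~ crossing g u -> jump_left u = jump u.
  move=> nc; have [d d0 H] := small_ex (jump_left_near nc).
  by apply: H; rewrite subrr normr0.
have ab : s + q <= t - q by lra.
have [F [uF mF]] := jump_chain ab.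
rewrite (xor_involution (i := i) uF) => [eF|u /mF[/andP[u1 u2] cu]]; last first.
  have su : s < u by lra.
  have ut : u < t by lra.
  have [sv vt dpv] := iP u su ut cu.
  have cv : crossing g (i u) by exists u; exact: double_pair_sym.
  have [sw wt dpw] := iP (i u) sv vt cv.
  have ii : i (i u) = u.
    apply: uniq_in => //; have [_ _ un] := gg.
    by apply: un dpw _; exact: double_pair_sym.
  split; [|exact: ii| |exact: (esym (twist_partner dpv))].
    apply/mF; split=> //; apply/andP; split; [rewrite leNgt|rewrite ltNge]; apply/negP => h.
      have hh : `|i u - s| < r by rewrite ltr_distl; lra.
      by have := iso _ hh cv; lra.
    have hh : `|i u - t| < r by rewrite ltr_distl; lra.
    by have := iso' _ hh cv; lra.
  by apply/eqP => E1; case: dpv; rewrite E1 same_source_refl.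
have {}eF : jump (s + q) = jump (t - q).
  move: eF; rewrite (leftE _ nca) (leftE _ ncb).
  by move: (jump (s + q)) (jump (t - q)) => [] [].
move: eF; rewrite (J q q) ?gt_eqF ?nq // (J' (- q) q) ?oppr_eq0 ?gt_eqF ?normrN ?nq //.
rewrite -!(quadrantC _ _ E) => eF.
have {}eF : chi (quadrant g s t q q) = chi (quadrant g s t (- q) (- q)).
  move: eF; move: (chi (quadrant g s t q q)) (chi (quadrant g s t q (- q)))
    (chi (quadrant g s t (- q) (- q))).
  by case=> [] [] [].
apply: (small_intro r0) => r' r'0 r'r x y x0 xr y0 yr.
have [nx ny] : `|x| = x /\ `|y| = y by rewrite !gtr0_norm.
have [xr' yr'] := (lt_trans xr r'r, lt_trans yr r'r).
rewrite (C x y q q) ?nx ?ny ?nq ?mulr_gt0 // eF.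
by apply: C; rewrite ?normrN ?nx ?ny ?nq // mulrNN mulr_gt0.
Qed.

End Parity.

(** * Great circle arcs and periodic extension *)
Section Arcs.
Variable R : realType.
Local Notation V := 'rV[R]_3.

Lemma first_hit (k : R -> V) (D : set V) (a b : R) : continuous k -> closed D ->
  a <= b -> D (k b) ->
  exists t, [/\ a <= t <= b, D (k t) & forall y, a <= y -> y < t -> ~ D (k y)].
Proof.
move=> kc Dc ab Db; pose S := [set y | a <= y <= b /\ D (k y)].
have Sb : S b by split=> //; rewrite ab lexx.
have lS : has_lbound S by exists a => y [/andP[]].
have hS : has_inf S by split; [exists b|].
have aS : a <= inf S by apply: lb_le_inf => [|y [/andP[]] //]; exists b.
have Sle : inf S <= b by exact: ge_inf.
exists (inf S); split; first by rewrite aS.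
  apply: contrapT => nD; have : \forall y \near inf S, ~ D (k y).
    apply: (kc (inf S) (~` D)); apply: open_nbhs_nbhs; split=> //.
    exact: closed_openC.
  move=> /nbhs_normP[r /= r0 H]; have [y [yab Dy] yr] := inf_adherent r0 hS.
  have Sy : inf S <= y := ge_inf lS (conj yab Dy).
  apply: (H y) Dy; rewrite /ball_ /= distrC ger0_norm; first by rewrite ltrBlDl.
  by rewrite subr_ge0.
move=> y ay yS Dy; move: (yS); rewrite ltNge => /negP; apply.
by apply: ge_inf => //; split=> //; rewrite ay (le_trans (ltW yS)).
Qed.

Lemma cross_eq0_sphere (p q : V) : sphere p -> sphere q -> cross p q = 0 ->
  p = q \/ p = - q.
Proof.
move=> p1 q1 pq; have : dot p q ^+ 2 = 1.
  have : dot (cross p q) (cross p q) = dot p p * dot q q - dot p q ^+ 2.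
    by rewrite !coordE /=; ring.
  rewrite pq (p1 : dot p p = 1) (q1 : dot q q = 1) mulr1.
  by rewrite !coordE !mul0r !addr0 => /eqP; rewrite eq_sym subr_eq0 eq_sym => /eqP.
move/eqP; rewrite sqrf_eq1 => /orP[] /eqP d; [left|right].
  apply/eqP; rewrite -subr_eq0; apply/eqP/dot_eq0.
  rewrite dotBl !dotBr (p1 : dot p p = 1) (q1 : dot q q = 1) (dotC q p) d; ring.
apply/eqP; rewrite -subr_eq0 opprK; apply/eqP/dot_eq0.
rewrite dotDl !dotDr (p1 : dot p p = 1) (q1 : dot q q = 1) (dotC q p) d; ring.
Qed.

Lemma normalize_eq_scale (p q : V) : p != 0 -> q != 0 -> normalize p = normalize q ->
  exists2 l : R, 0 < l & p = l *: q.
Proof.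
move=> p0 q0 E; exists (Num.sqrt (dot p p) / Num.sqrt (dot q q)).
  by rewrite divr_gt0 // sqrt_dot_gt0.
by rewrite {1}(normalize_eq p0) E /normalize scalerA.
Qed.

(** Its image under [normalize] is an arc of great circle. *)
Definition chord (p q : V) (a : R) : V := (1 - a) *: p + a *: q.

(** A cap smaller than a hemisphere is geodesically convex: the straight chord stays
    above the cutting plane, and normalizing only lengthens its points. *)
Lemma cap_chord (c p q : V) (h a : R) : 0 < h -> cap c h p -> cap c h q -> 0 <= a <= 1 ->
  chord p q a != 0 /\ cap c h (normalize (chord p q a)).
Proof.
move=> h0 [p1 hp] [q1 hq] /andP[a0 a1].
have hd : h <= dot c (chord p q a).
  rewrite dotDr !dotZr.
  have -> : h = (1 - a) * h + a * h by ring.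
  by apply: lerD; apply: ler_wpM2l => //; lra.
have n0 : chord p q a != 0.
  apply/eqP => E; move: hd; rewrite E !coordE !mulr0 !addr0; lra.
split=> //; split; first exact: normalize_sphere.
have s0 := sqrt_dot_gt0 n0.
have s1 : Num.sqrt (dot (chord p q a) (chord p q a)) <= 1.
  rewrite -sqrtr1 ler_wsqrtr //.
  have -> : dot (chord p q a) (chord p q a) =
     (1 - a) ^+ 2 * dot p p + a ^+ 2 * dot q q + 2 * a * (1 - a) * dot p q.
    by rewrite /chord !coordE; ring.
  rewrite (p1 : dot p p = 1) (q1 : dot q q = 1).
  have pq : dot p q <= 1.
    have := dot_ge0 (p - q); rewrite dotBl !dotBr (p1 : dot p p = 1) (q1 : dot q q = 1) (dotC q p); lra.
  have aa : 0 <= 2 * a * (1 - a) by rewrite !mulr_ge0 //; lra.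
  have := ler_wpM2l aa pq; rewrite mulr1 !expr2; nra.
rewrite dotZr; apply: (le_trans hd); rewrite ler_peMl //.
  exact: le_trans (ltW h0) hd.
by rewrite invf_ge1.
Qed.

Lemma chord_inj (c p q : V) (h a b : R) : 0 < h -> cap c h p -> cap c h q -> p != q ->
  0 <= a <= 1 -> 0 <= b <= 1 -> normalize (chord p q a) = normalize (chord p q b) -> a = b.
Proof.
move=> h0 hp hq pq a01 b01 E.
have [na _] := cap_chord h0 hp hq a01; have [nb _] := cap_chord h0 hp hq b01.
have [l l0 El] := normalize_eq_scale na nb E.
have c0 : (b - a) *: cross p q = 0.
  transitivity (cross (chord p q a) (chord p q b)).
    by apply: rv3P; rewrite /chord !mxE /= ?mxE; ring.
  by rewrite El; apply: rv3P; rewrite /chord !mxE /= ?mxE; ring.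
move/eqP: c0; rewrite scaler_eq0 subr_eq0 => /orP[/eqP //|/eqP cr].
have [p1 dp] := hp; have [q1 dq] := hq.
case: (cross_eq0_sphere p1 q1 cr) => [|Epq]; first by move/eqP; rewrite (negbTE pq).
move: dp; rewrite Epq => dp; exfalso.
have : dot c (- q) = - dot c q by rewrite !coordE; ring.
lra.
Qed.

Lemma chord_cont (p q : V) : continuous (chord p q).
Proof.
move=> x; apply: cvgD; apply: cvgZr_tmp; last exact: cvg_id.
by apply: cvgB; [exact: cvg_cst|exact: cvg_id].
Qed.

Lemma max_cont (m : R) : continuous (fun z : R => Num.max z m).
Proof.
rewrite (_ : (fun z => _) = fun z : R => (z + m + `|z - m|) / 2); last first.
  by apply/funext => z; rewrite maxr_absE.
move=> x; exact: (cvgM (cvgD (cvgD cvg_id (cvg_cst m))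
  (cvg_norm (cvgB cvg_id (cvg_cst m)))) (cvg_cst _)).
Qed.

Lemma min_cont (m : R) : continuous (fun z : R => Num.min z m).
Proof.
rewrite (_ : (fun z => _) = fun z : R => (z + m - `|z - m|) / 2); last first.
  by apply/funext => z; rewrite minr_absE.
move=> x; exact: (cvgM (cvgB (cvgD cvg_id (cvg_cst m))
  (cvg_norm (cvgB cvg_id (cvg_cst m)))) (cvg_cst _)).
Qed.

Definition per (m : R) (f : R -> V) (x : R) : V := f (x - (Num.floor (x - m))%:~R).

Lemma per_in m f x : m <= x -> x < m + 1 -> per m f x = f x.
Proof.
move=> h1 h2; rewrite /per (@floor_def _ _ 0) ?subr0 //.
by apply/andP; split; rewrite ?add0r; lra.
Qed.

Lemma per_shift m f x (k : int) : per m f (x + k%:~R) = per m f x.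
Proof.
rewrite /per (_ : x + k%:~R - m = x - m + k%:~R); last by ring.
by rewrite floorDrz ?intr_int // intrKfloor intrD; congr f; ring.
Qed.

(** At the junction, the periodic extension is the sum of the two one-sided pieces,
    each frozen at its end value beyond the junction. *)
Lemma per_cont (m : R) (f : R -> V) : continuous f -> f m = f (m + 1) -> continuous (per m f).
Proof.
move=> fc E x; have [k /andP[k0 k1]] := shift_into m x.
have shc : {for x, continuous (fun y : R => y + k%:~R)}.
  by apply: cvgD; [exact: cvg_id|exact: cvg_cst].
have main : {for x + k%:~R, continuous (per m f)}.
  move: (x + k%:~R) k0 k1 => y y0 y1 {x k shc}.
  have [ym|ym] := eqVneq y m; last first.
    have my : m < y by rewrite lt_neqAle eq_sym ym.
    rewrite /prop_for /continuous_at per_in //.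
    have e : \forall z \near y, f z = per m f z.
      near=> z; rewrite per_in //.
        by apply/ltW; near: z; exact: lt_nbhsr.
      by near: z; exact: lt_nbhsl.
    exact: cvg_trans (near_eq_cvg e) (fc y).
  rewrite ym /prop_for /continuous_at per_in ?lexx ?ltrDl //.
  have maxc := @max_cont m; have minc := @min_cont m.
  pose F (z : R) := f (Num.max z m) + f (Num.min z m + 1) - f m.
  have e : \forall z \near m, F z = per m f z.
    have m1 : m < m + 1 by rewrite ltrDl.
    have m2 : m - 1 < m by rewrite gtrDl oppr_lt0.
    near=> z; rewrite /F; have [zm|mz] := ltP z m.
      rewrite -[RHS](per_shift _ _ _ 1) per_in; last by rewrite ltrD2r.
        by rewrite addrAC subrr add0r.
      by rewrite -lerBlDr; apply/ltW; near: z; exact: lt_nbhsr.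
    rewrite per_in //; last by near: z; exact: lt_nbhsl.
    by rewrite -E addrK.
  have Fm : F m = f m by rewrite /F maxxx minxx -E addrK.
  rewrite -Fm; apply: cvg_trans (near_eq_cvg e) _.
  apply: cvgB; last exact: cvg_cst.
  apply: cvgD.
    exact: (@continuous_comp _ _ _ (fun z : R => Num.max z m) f m (maxc m) (fc _)).
  apply: (@continuous_comp _ _ _ (fun z : R => Num.min z m + 1) f m _ (fc _)).
  by apply: cvgD; [exact: minc|exact: cvg_cst].
have := @continuous_comp _ _ _ (fun y : R => y + k%:~R) (per m f) x shc main.
by rewrite (_ : _ \o _ = per m f) //; apply/funext => y /=; rewrite per_shift.
Unshelve. all: by end_near. Qed.

End Arcs.

(** * An uncrossed chord is nugatory *)
Section Nugatory.
Variables (R : realType) (g : R -> 'rV[R]_3) (s t : R).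
Hypothesis gg : generic_immersion g.
Hypotheses (st : s < t) (ts : t < s + 1) (Est : g s = g t).
Local Notation V := 'rV[R]_3.
Local Notation dg := (derive1 g).
Local Notation c := (g s).

Let w0 := dg s + dg t.

Lemma dot_cont (q : V) : continuous (dot q).
Proof.
move=> p; apply: (@cvg_dot R V (nbhs p) _ (fun _ => q) id q p); last exact: cvg_id.
exact: cvg_cst.
Qed.

Lemma dps : double_pair g s t.
Proof. by split=> //; exact: not_same_source. Qed.

Lemma det3_bisect_l (L : R) (a u v : V) : det3 a (L *: (u + v)) u = - L * det3 a u v.
Proof. by rewrite !det3E !mxE; ring. Qed.

Lemma det3_bisect_r (L : R) (a u v : V) : det3 a (L *: (u + v)) v = L * det3 a u v.
Proof. by rewrite !det3E !mxE; ring. Qed.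

Lemma dot_center_w0 : dot c w0 = 0.
Proof. by rewrite dotDr (dot_g_dg gg) {1}Est (dot_g_dg gg) addr0. Qed.

Lemma w0_neq0 : w0 != 0.
Proof.
apply/eqP => E; have := double_det3 gg dps.
rewrite -[det3 _ _ _]mul1r -(det3_bisect_r 1 c (dg s) (dg t)) -/w0 E scaler0 det3E !mxE.
by rewrite !mul0r !subr0 !mulr0 !addr0 eqxx.
Qed.

(** A geodesic through the double point: it bisects the quadrant between the two
    outgoing branches and the opposite one. *)
Definition diag (y : R) := normalize (c + y *: w0).

Lemma diag_neq0 y : c + y *: w0 != 0.
Proof.
apply/eqP => E; have : dot c (c + y *: w0) = 1.
  by rewrite dotDr dotZr dot_center_w0 mulr0 addr0; exact: (g_sphere gg).
by rewrite E !coordE !mulr0 !addr0 => /eqP; rewrite eq_sym oner_eq0.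
Qed.

Lemma diag0 : diag 0 = c.
Proof. by rewrite /diag scale0r addr0 normalize_id //; exact: (g_sphere gg). Qed.

Lemma diag_sphere y : sphere (diag y).
Proof. exact/normalize_sphere/diag_neq0. Qed.

Lemma diag_cont : continuous diag.
Proof.
move=> y; apply: cvg_normalize; first exact: diag_neq0.
exact: segment_cont.
Qed.

Lemma diag_inj y z : diag y = diag z -> y = z.
Proof.
move=> E; have [l l0 El] := normalize_eq_scale (diag_neq0 y) (diag_neq0 z) E.
have l1 : l = 1.
  have : dot c (c + y *: w0) = l * dot c (c + z *: w0) by rewrite El dotZr.
  by rewrite !dotDr !dotZr dot_center_w0 !mulr0 !addr0 (g_sphere gg s : dot _ _ = 1) mulr1.
move: El; rewrite l1 scale1r => /addrI/eqP.
by rewrite -subr_eq0 -scalerBl scaler_eq0 (negbTE w0_neq0) orbF subr_eq0 => /eqP.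
Qed.

(** Unlike a path component, this relation keeps the simple arc that closes up to
    the nugatory curve, with its germ along [diag] at the double point. *)
Definition reach_arc (k : R -> V) (T eta : R) (q : V) :=
  [/\ [/\ 0 < eta, eta <= T & continuous k],
      forall y z, 0 <= y -> y <= T -> 0 <= z -> z <= T -> k y = k z -> y = z,
      forall y, y <= eta -> k y = diag y,
      forall y, 0 < y -> y <= T -> sphere (k y) /\ forall x, k y <> g x &
      k T = q].

Definition reach (q : V) := exists k T eta, reach_arc k T eta q.

(** Stop the given arc at its first visit to the cap and go on along a geodesic of
    the cap, which the stopped arc has not met. *)
Lemma reach_cap (q0 q1 q2 : V) (h : R) : 0 < h ->
  (forall x, ~ cap q0 h (g x)) -> cap q0 h q1 -> cap q0 h q2 ->
  reach q1 -> reach q2.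
Proof.
move=> h0 offB B1 B2 [k [T [eta [[eta0 etaT kc] kinj kd koff kT]]]].
pose D := [set p : V | h <= dot q0 p].
have Dc : closed D.
  have fc : continuous (dot q0) by exact: dot_cont.
  have -> : D = dot q0 @^-1` [set x | h <= x] by [].
  by apply: preimage_closed => [x _|]; [exact: fc|exact: closed_ge].
have T0 : 0 < T by apply: lt_le_trans etaT.
have DT : D (k T) by rewrite kT; case: B1.
have [t0 [/andP[t00 t0T] Dt0 first]] := first_hit kc Dc (ltW T0) DT.
have k0 : k 0 = c by rewrite kd ?diag0 // ltW.
have t0_gt0 : 0 < t0.
  rewrite lt_neqAle t00 andbT; apply/eqP => E; apply: (offB s); split; first exact: (g_sphere gg).
  by rewrite -k0 E.
have Bt0 : cap q0 h (k t0) by split=> //; case: (koff t0 t0_gt0 t0T).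
have [E|ne] := eqVneq (k t0) q2.
  exists k, t0, (Num.min eta t0); split=> //.
  - by split=> //; [rewrite lt_min eta0|rewrite ge_min lexx orbT].
  - by move=> y z y0 yt z0 zt; apply: kinj => //; [exact: le_trans t0T|exact: le_trans t0T].
  - by move=> y; rewrite le_min => /andP[ye _]; exact: kd.
  - by move=> y y0 yt; apply: koff => //; exact: le_trans t0T.
(* The two pieces are added rather than glued: each is frozen beyond [t0]. *)
pose th (y : R) := Num.min (Num.max (y - t0) 0) 1.
have th01 y : 0 <= th y <= 1.
  by rewrite /th le_min ler01 ge_min lexx orbT le_max lexx orbT.
have thc : continuous th.
  move=> y; apply: (@continuous_comp _ _ _ (fun y : R => Num.max (y - t0) 0) (fun z => Num.min z 1)).
    apply: (@continuous_comp _ _ _ (fun y : R => y - t0) (fun z => Num.max z 0)).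
      by apply: cvgB; [exact: cvg_id|exact: cvg_cst].
    exact: max_cont.
  exact: min_cont.
have thl y : y <= t0 -> th y = 0.
  by move=> h1; rewrite /th max_r ?subr_le0 // min_l.
have thr y : t0 <= y -> y <= t0 + 1 -> th y = y - t0.
  by move=> h1 h2; rewrite /th max_l ?subr_ge0 // min_l // lerBlDl.
pose A (y : R) := normalize (chord (k t0) q2 (th y)).
pose k2 (y : R) := k (Num.min y t0) + (A y - k t0).
have kt0s : normalize (k t0) = k t0 by apply: normalize_id; case: Bt0.
have k2l y : y <= t0 -> k2 y = k y.
  by move=> h1; rewrite /k2 min_l // /A thl // /chord subr0 scale1r scale0r addr0 kt0s subrr addr0.
have k2r y : t0 <= y -> k2 y = A y.
  by move=> h1; rewrite /k2 min_r // addrC subrK.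
have AB y : cap q0 h (A y) by have [] := cap_chord h0 Bt0 B2 (th01 y).
have k2t y : t0 <= y -> k2 y = k t0 -> y <= t0 + 1 -> y = t0.
  move=> h1 h2 h3; have : th y = th t0.
    apply: (chord_inj h0 Bt0 B2 ne) => //.
    by rewrite -[LHS]/(A y) -k2r // h2 -[RHS]/(A t0) -k2r // k2l.
  by rewrite (thl t0) // thr // => /eqP; rewrite subr_eq0 => /eqP.
have mixed y z : 0 <= y -> y <= t0 -> t0 <= z -> z <= t0 + 1 -> k2 y = k2 z -> y = z.
  move=> y0 yt tz z1 E; have Dy : D (k y) by rewrite -k2l // E k2r //; case: (AB z).
  have yt0 : y = t0.
    by move: yt; rewrite le_eqVlt => /orP[/eqP //|lt]; case: (first y y0 lt Dy).
  by rewrite yt0; apply/esym/k2t; rewrite // -E yt0 k2l.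
exists k2, (t0 + 1), (Num.min eta t0); split.
- split; first by rewrite lt_min eta0.
    by rewrite ge_min; apply/orP; right; rewrite lerDl.
  move=> y; apply: cvgD.
    apply: (@continuous_comp _ _ _ (fun y : R => Num.min y t0) k); first exact: min_cont.
    exact: kc.
  apply: cvgB; last exact: cvg_cst.
  apply: cvg_normalize; first by have [] := cap_chord h0 Bt0 B2 (th01 y).
  exact: (@continuous_comp _ _ _ th (chord (k t0) q2) y (thc y) (@chord_cont _ _ _ _)).
- move=> y z y0 y1 z0 z1 E; have [yt|ty] := leP y t0; have [zt|tz] := leP z t0.
  + by apply: kinj => //; [exact: le_trans t0T|exact: le_trans t0T|rewrite -!k2l].
  + exact: (mixed y z y0 yt (ltW tz)).
  + by apply/esym; exact: (mixed z y z0 zt (ltW ty)).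
  + have : th y = th z.
      by apply: (chord_inj h0 Bt0 B2 ne) => //; move: E; rewrite !k2r // ltW.
    by rewrite (thr y (ltW ty) y1) (thr z (ltW tz) z1) => /addIr.
- by move=> y; rewrite le_min => /andP[ye yt]; rewrite k2l // kd.
- move=> y y0 y1; have [yt|ty] := leP y t0.
    by rewrite k2l //; apply: koff => //; exact: le_trans t0T.
  rewrite k2r ?ltW //; split; first by case: (AB y).
  by move=> x E; apply: (offB x); rewrite -E.
- rewrite k2r ?lerDl // /A thr ?lerDl // addrAC subrr add0r /chord subrr scale0r add0r scale1r.
  by apply: normalize_id; case: B2.
Qed.

Lemma off_cap (q0 : V) : sphere q0 -> (forall x, q0 <> g x) ->
  exists h, [/\ 0 < h, h < 1 & forall x, ~ cap q0 h (g x)].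
Proof.
move=> q01 qoff.
have fc : continuous (fun x => dot q0 (g x)).
  by move=> x; exact: (@continuous_comp _ _ _ g (dot q0) x (@g_cont _ _ gg x) (@dot_cont _ _)).
have [||x0 _ Hx0] := @EVT_max R (fun x => dot q0 (g x)) 0 1.
- exact: ler01.
- exact: continuous_subspaceT.
have M1 : dot q0 (g x0) < 1.
  rewrite ltNge; apply/negP => le1; apply: (qoff x0); apply/eqP; rewrite -subr_eq0.
  apply/eqP/dot_eq0/eqP; rewrite eq_le dot_ge0 andbT.
  rewrite dotBl !dotBr (q01 : dot _ _ = 1) (g_sphere gg x0 : dot _ _ = 1) (dotC (g x0)); lra.
have max x : dot q0 (g x) <= dot q0 (g x0).
  have [k /andP[k0 k1]] := shift_into 0 x.
  rewrite -(g_per gg x k); apply: Hx0; rewrite in_itv /= k0 ltW //.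
  by rewrite add0r in k1.
exists (Num.max (1 / 2) ((1 + dot q0 (g x0)) / 2)); split.
- by rewrite lt_max divr_gt0.
- by rewrite gt_max; apply/andP; split; lra.
- move=> x [_]; rewrite ge_max => /andP[_ h]; have := max x; lra.
Qed.

Definition chi (p : V) : bool := `[< reach (normalize p) >].

Lemma chi_loc p : off g p -> \forall q \near p, chi q = chi p.
Proof.
move=> [p0 poff]; have [h [h0 h1 Hh]] := off_cap (normalize_sphere p0) poff.
have dc : {for p, continuous (fun q => dot (normalize p) (normalize q))}.
  apply: (@continuous_comp _ _ _ (@normalize R) (dot (normalize p)) p _ (@dot_cont _ _)).
  by apply: (@cvg_normalize R V (nbhs p) _ id p p0); exact: cvg_id.
have n1 : \forall q \near p, h < dot (normalize p) (normalize q).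
  by apply: (cvgr_gt _ dc); rewrite (normalize_sphere p0 : dot _ _ = 1).
have n2 : \forall q \near p, q != 0.
  have := cont_small (fun A => id : nbhs p A -> nbhs p A) (_ : 0 < `|p|).
  rewrite normr_gt0 => /(_ p0) /small_ex[d d0 Hd].
  apply/nbhs_normP; exists d => // q; rewrite /ball_ /= distrC => /Hd.
  by apply: contraTneq => ->; rewrite sub0r normrN ltxx.
apply: filterS2 n1 n2 => q hq q0.
have Bp : cap (normalize p) h (normalize p).
  by split; [exact: normalize_sphere|rewrite (normalize_sphere p0 : dot _ _ = 1) ltW].
have Bq : cap (normalize p) h (normalize q) by split; [exact: normalize_sphere|exact: ltW].
by apply/asboolP/asboolP; apply: (reach_cap h0 Hh).
Qed.

Lemma off_diag : \forall e \near 0^'+, forall y, y != 0 -> `|y| <= e -> off g (c + y *: w0).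
Proof.
have [r r0 H] := small_ex (off_diagonal gg dps).
apply: (small_intro r0) => e e0 er y y0 ye.
by apply: H; rewrite ?subrr ?normr0 // (le_lt_trans ye).
Qed.

Lemma reach_diag : \forall e \near 0^'+, reach (diag e).
Proof.
apply: filterS2 off_diag (nbhs_right_gt (0 : R)) => e H e0.
exists diag, e, e; split=> //.
- by split=> //; exact: diag_cont.
- by move=> y z _ _ _ _; exact: diag_inj.
- move=> y y0 ye; split; first exact: diag_sphere.
  have ye' : `|y| <= e by rewrite gtr0_norm.
  by have [] := H y (lt0r_neq0 y0) ye'.
Qed.

Lemma chi_quadrant_diag : \forall e \near 0^'+,
  chi (quadrant g s t e e) = chi (c + e *: w0) /\
  chi (quadrant g s t (- e) (- e)) = chi (c - e *: w0).
Proof.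
have [r r0 H] := small_ex (off_diagonal gg dps).
have r2 : 0 < r / 2 by rewrite divr_gt0.
have main y w : y != 0 -> `|y| < r -> `|w - w0| < r -> chi (c + y *: w) = chi (c + y *: w0).
  move=> y0 yr wr.
  have -> : chi (c + y *: w) = chi (c + y *: w0 + 1 *: (y *: (w - w0))).
    by rewrite scale1r -addrA -scalerDr (addrC w0) subrK.
  have E0 : chi (c + y *: w0) = chi (c + y *: w0 + 0 *: (y *: (w - w0))).
    by rewrite scale0r addr0.
  rewrite E0; apply/esym.
  apply: (chi_path chi_loc (p := fun z => c + y *: w0 + z *: (y *: (w - w0))) ler01).
    by move=> z _; exact: segment_cont.
  move=> z /andP[z0 z1]; rewrite scalerA mulrC -scalerA -addrA -scalerDr; apply: H => //.
  rewrite -/w0 addrAC subrr add0r normrZ ger0_norm //.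
  by apply: le_lt_trans wr; rewrite ler_piMl.
have [r1 r10 [Q0 Q1]] := small_ex (filterI (is_derive_quot (g_der gg s) r2)
  (is_derive_quot (g_der gg t) r2)).
have quad y : y != 0 -> `|y| < r -> `|y| < r1 -> chi (quadrant g s t y y) = chi (c + y *: w0).
  move=> y0 yr yr1.
  have -> : quadrant g s t y y =
      c + y *: (y^-1 *: (g (s + y) - g s) + y^-1 *: (g (t + y) - g t)).
    rewrite scalerDr !scalerA divff // !scale1r /quadrant -Est addrA (addrC c) subrK.
    by rewrite addrA.
  apply: main => //.
  rewrite /w0 opprD addrACA [ltRHS]splitr; apply: (le_lt_trans (ler_normD _ _)).
  by apply: ltrD; [exact: Q0|exact: Q1].
apply: filterS3 (small_intro r0 (fun e _ h => h)) (small_intro r10 (fun e _ h => h))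
  (nbhs_right_gt (0 : R)) => e er er1 e0.
have [n0 ne] : e != 0 /\ `|e| = e by rewrite gt_eqF // gtr0_norm.
split; first by apply: quad; rewrite ?ne.
by rewrite quad ?oppr_eq0 ?normrN ?ne // scaleNr.
Qed.

Hypothesis isol : forall x y, s < x -> x < t -> t < y -> y < s + 1 -> g x <> g y.

(** The quadrants that the two halves of [diag] traverse are opposite. *)
Lemma reach_opposite : \forall e \near 0^'+, reach (diag (- e)).
Proof.
have [r r0 H] := small_ex (opposite_quadrants gg chi_loc st ts Est isol).
apply: filterS3 reach_diag chi_quadrant_diag (small_intro r0 (fun e e0 er => conj e0 er)).
move=> e re [q1 q2] [e0 er].
have : chi (c - e *: w0) by rewrite -q2 -(H e e) // q1; apply/asboolP.
by move=> /asboolP; rewrite /diag scaleNr.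
Qed.

(** Follow a simple arc that reaches the backward half of [diag] until it first meets
    it, and return to the double point along [diag]. *)
Lemma isolated_nugatory : nugatory g c.
Proof.
split; first by exists s, t; split=> //; exact: dps.
have [e e0 [[k [T [eta [[eta0 etaT kc] kinj kd koff kT]]]] offd]] :=
  small_ex (filterI reach_opposite off_diag).
pose D := [set diag (- y) | y in `[0, e]%classic].
have Dc : closed D.
  apply: compact_closed; first exact: norm_hausdorff.
  apply: continuous_compact; last exact: segment_compact.
  apply: continuous_subspaceT => y.
  apply: (@continuous_comp _ _ _ (fun y : R => - y) diag); last exact: diag_cont.
  by apply: cvgN; exact: cvg_id.
have DT : D (k T) by exists e => //=; rewrite in_itv /= ltW //= lexx.
have [T1 [/andP[T1e T1T] [z1 z1e Ez1] first]] := first_hit kc Dc etaT DT.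
move: z1e; rewrite /= in_itv /= => /andP[z10 z1e].
have T10 : 0 < T1 by exact: lt_le_trans T1e.
have z1_gt0 : 0 < z1.
  rewrite lt_neqAle z10 andbT; apply/eqP => z0.
  by have [_ /(_ s)] := koff T1 T10 T1T; apply; rewrite -Ez1 -z0 oppr0 diag0.
have offD y : 0 < y -> y < T1 -> ~ D (k y).
  move=> y0 yT1; have [ye|ey] := leP y eta; last by apply: first; rewrite ?ltW.
  move=> [z]; rewrite /= in_itv /= => /andP[z0 ze]; rewrite kd // => /diag_inj; lra.
have kneg y : y <= 0 -> k y = diag y by move=> h; apply: kd; exact: le_trans (ltW eta0).
have neg_pos y z : - z1 <= y -> y < 0 -> 0 <= z -> z < T1 -> k y = k z -> y = z.
  move=> y1 y0; rewrite le_eqVlt => /orP[/eqP <- _|z0 zT] E.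
    by move: E; rewrite (kneg y (ltW y0)) (kneg 0 (lexx 0)) => /diag_inj.
  case: (offD z z0 zT); rewrite -E kneg ?ltW //.
  by exists (- y); rewrite ?opprK //= in_itv /=; apply/andP; split; lra.
have k_inj y z : - z1 <= y -> y < T1 -> - z1 <= z -> z < T1 -> k y = k z -> y = z.
  move=> y1 y2 z2 z3 E; have [y0|y0] := leP 0 y; have [zz|zz] := leP 0 z.
  - by apply: kinj => //; exact: le_trans (ltW _) T1T.
  - by apply/esym/neg_pos.
  - by apply: neg_pos.
  - by move: E; rewrite !kneg ?ltW // => /diag_inj.
(* The period [L] makes the arc and the returning piece of [diag] fit together with
   the same speed on both sides of the double point. *)
pose L := T1 + z1; have L0 : 0 < L by rewrite addr_gt0.
pose m := - z1 / L.
have Lm : L * m = - z1 by rewrite /m mulrC divfK // gt_eqF.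
have Lm1 : L * (m + 1) = T1 by rewrite mulrDr mulr1 Lm /L; ring.
have m0 : m < 0 by rewrite /m mulNr oppr_lt0 divr_gt0.
have m1 : 0 < m + 1 by rewrite -(pmulr_rgt0 _ L0) Lm1.
pose f (x : R) := k (L * x).
have fc : continuous f.
  move=> x; apply: (@continuous_comp _ _ _ (fun x : R => L * x) k); last exact: kc.
  exact: (cvgM (cvg_cst L) cvg_id).
have fm : f m = f (m + 1) by rewrite /f Lm Lm1 -Ez1 kneg // oppr_le0 ltW.
have range_f x : m <= x -> x < m + 1 -> - z1 <= L * x /\ L * x < T1.
  by move=> h1 h2; rewrite -Lm -Lm1 ler_pM2l // ltr_pM2l.
have d0 : per m f 0 = c by rewrite per_in // ?ltW // /f mulr0 kneg // diag0.
have ks y : - z1 <= y -> y < T1 -> sphere (k y).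
  move=> h1 h2; have [y0|y0] := leP y 0; first by rewrite kneg //; exact: diag_sphere.
  by have [] := koff y y0 (le_trans (ltW h2) T1T).
have dder : is_derive (0 : R) 1 (per m f) (L *: w0).
  have e1 : \forall x \near (0 : R), diag (L * x + 0) = per m f x.
    near=> x; rewrite per_in; [|by apply/ltW; near: x; exact: lt_nbhsr|by near: x; exact: lt_nbhsl].
    rewrite addr0 /f kd // -ler_pdivlMl //.
    by apply/ltW; near: x; apply: lt_nbhsl; rewrite mulr_gt0 // invr_gt0.
  apply: (is_derive_near e1); apply: is_derive_comp_rv; first exact: is_derive_affine.
  rewrite mulr0 addr0.
  have h := @is_derive_affine R 0 1 0.
  have h1 : is_derive (0 : R) 1 (fun y : R => c + y *: w0) w0.
    apply: is_derive_rv => i.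
    rewrite (_ : (fun y => _) = fun y : R => w0 0 i * y + c 0 i); first exact: is_derive_affine.
    by apply/funext => y; rewrite !mxE; ring.
  apply: is_derive_ext; first exact: (is_derive_normalize (diag_neq0 0) h1).
  rewrite /dnormalize /= !scale0r !addr0 dot_center_w0 mulr0 scale0r subr0 (g_sphere gg s : dot _ _ = 1).
  by rewrite sqrtr1 invr1 scale1r.
exists (per m f); split.
- split; first split.
  + exact: per_cont.
  + by move=> x; exact: (per_shift m f x 1).
  + move=> x; have [n /andP[n0 n1]] := shift_into m x.
    by rewrite -(per_shift _ _ _ n) per_in //; have [] := range_f _ n0 n1; exact: ks.
  + move=> x y; have [n /andP[n0 n1]] := shift_into m x; have [p /andP[p0 p1]] := shift_into m y.
    rewrite -(per_shift _ _ x n) -(per_shift _ _ y p) !per_in // => E.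
    have [a1 a2] := range_f _ n0 n1; have [b1 b2] := range_f _ p0 p1.
    have := k_inj _ _ a1 a2 b1 b2 E => /(mulfI (lt0r_neq0 L0)) E2.
    by apply/same_sourceP; exists (p - n); rewrite intrB; lra.
- apply/seteqP; split=> p; last by move=> ->; split; [exists 0|exists s].
  move=> [[x _ <-] [y _ E]]; move: E; have [n /andP[n0 n1]] := shift_into m x.
  rewrite -(per_shift _ _ x n) per_in // /f => E.
  have [a1 a2] := range_f _ n0 n1; move: (L * _) a1 a2 E => z a1 a2 E.
  case: (ltgtP z 0) => z0.
  + have zn : `|z| <= e by rewrite ltr0_norm //; lra.
    have [_ /(_ y)] := offd z (ltr0_neq0 z0) zn.
    by rewrite -/(diag z) -kneg ?ltW // E.
  + by have [_ /(_ y)] := koff z z0 (le_trans (ltW a2) T1T); rewrite E.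
  + by rewrite z0 kneg // diag0.
- exact: d0.
- by case: dder.
- move=> x Ex.
  have -> : derive1 (per m f) 0 = L *: w0 by rewrite derive1E; case: dder.
  have Lw : dot c (L *: w0) = 0 by rewrite dotZr dot_center_w0 mulr0.
  rewrite (transverse_det3 (g_sphere gg s) Lw (dot_g_dg_at gg Ex)).
  have [D0 D1] := double_det3_both gg dps.
  case: (double_unique gg dps Ex) => /(dg_same gg) ->.
    have -> : det3 c (L *: w0) (dg s) = - L * det3 c (dg s) (dg t).
      exact: (det3_bisect_l L c (dg s) (dg t)).
    have nL : - L != 0 by rewrite oppr_eq0 gt_eqF.
    exact: (mulf_neq0 nL D0).
  have -> : det3 c (L *: w0) (dg t) = L * det3 c (dg s) (dg t).
    exact: (det3_bisect_r L c (dg s) (dg t)).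
  exact: (mulf_neq0 (lt0r_neq0 L0) D0).
Unshelve. all: by end_near. Qed.

End Nugatory.

(** * Smoothing the positive part *)
Section Smoothing.
Variables (R : realType) (d : R).
Hypothesis d0 : 0 < d.

Let pos (x : R) := Num.max x 0.

Lemma pos_ge x : 0 <= x -> pos x = x.
Proof. by move=> h; rewrite /pos max_l. Qed.

Lemma pos_le x : x <= 0 -> pos x = 0.
Proof. by move=> h; rewrite /pos max_r. Qed.

Lemma posB x : pos x - pos (- x) = x.
Proof.
have [h|h] := leP 0 x; first by rewrite pos_ge // pos_le ?subr0 // oppr_le0.
by rewrite pos_le ?ltW // pos_ge ?sub0r ?opprK // oppr_ge0 ltW.
Qed.

Lemma pos_sqr_derive (x : R) : is_derive x 1 (fun y => pos y ^+ 2) (2 * pos x).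
Proof.
case: (ltgtP x 0) => h.
- have e : \forall y \near x, cst 0 y = pos y ^+ 2.
    near=> y; rewrite pos_le ?expr0n //.
    by apply/ltW; near: y; exact: lt_nbhsl.
  apply: (near_eq_is_derive e); rewrite pos_le ?ltW // mulr0; exact: is_derive_cst.
- have e : \forall y \near x, (id ^+ 2) y = pos y ^+ 2.
    near=> y; rewrite pos_ge //.
    by apply/ltW; near: y; exact: lt_nbhsr.
  apply: (near_eq_is_derive e); rewrite pos_ge ?ltW //.
  by apply: is_derive_ext; rewrite /GRing.scale /= expr1 mulr1 mulr_natl.
- rewrite h pos_ge // mulr0.
  have C : h^-1 *: (pos (h *: 1 + 0) ^+ 2 - pos 0 ^+ 2) @[h --> (0 : R)^'] --> (0 : R).
    have e : \forall h \near (0 : R)^', pos h = h^-1 *: (pos (h *: 1 + 0) ^+ 2 - pos 0 ^+ 2).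
      near=> y; have y0 : y != 0 by near: y; exact: nbhs_dnbhs_neq.
      rewrite addr0 (pos_ge (lexx 0)) expr0n subr0 /GRing.scale /= mulr1.
      have [h0|h0] := leP 0 y; first by rewrite pos_ge // expr2 mulrA mulVf // mul1r.
      by rewrite pos_le ?ltW // expr0n mulr0.
    apply: cvg_trans (near_eq_cvg e) _.
    apply: cvg_within_filter.
    by have := @max_cont R 0 0; rewrite /continuous_at maxxx.
  by split; [apply/cvg_ex; exists 0|exact: cvg_lim].
Unshelve. all: by end_near. Qed.

(** A continuously differentiable smoothing of the positive part, which coincides
    with it outside [-d, d]. *)
Definition phi (x : R) := (pos (x + d) ^+ 2 - pos (x - d) ^+ 2) / (4 * d).
Definition dphi (x : R) := (pos (x + d) - pos (x - d)) / (2 * d).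

Lemma phi_derive (x : R) : is_derive x 1 phi (dphi x).
Proof.
have h k : is_derive x 1 (fun y => pos (1 * y + k) ^+ 2) (2 * pos (1 * x + k) * 1).
  exact: (@is_derive1_comp _ (fun y => pos y ^+ 2) _ _ _ _ (pos_sqr_derive _) (is_derive_affine x 1 k)).
have h2 := is_deriveZ (4 * d)^-1 (is_deriveB (h d) (h (- d))).
rewrite (_ : phi = (4 * d)^-1 *: ((fun y => pos (1 * y + d) ^+ 2) - (fun y => pos (1 * y - d) ^+ 2))).
  apply: (is_derive_ext h2); rewrite /dphi /GRing.scale /= !mul1r !mulr1.
  by field; rewrite gt_eqF.
by apply/funext => y; rewrite !fctE /phi !mul1r mulrC.
Qed.

Lemma pos_cont : continuous pos. Proof. exact: max_cont. Qed.

Lemma phi_cont : continuous phi.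
Proof. by move=> x; apply: differentiable_continuous; apply/derivable1_diffP; case: (phi_derive x). Qed.

Lemma dphi_cont : continuous dphi.
Proof.
have h k : continuous (fun x : R => pos (x + k)).
  move=> x; apply: (@continuous_comp _ _ _ (fun x : R => x + k) pos); last exact: pos_cont.
  by apply: cvgD; [exact: cvg_id|exact: cvg_cst].
move=> x; exact: (cvgM (cvgB (h d x) (h (- d) x)) (cvg_cst _)).
Qed.

Lemma phi_right x : d <= x -> phi x = x.
Proof.
have dp := d0; move=> h; have h1 : 0 <= x + d by lra. have h2 : 0 <= x - d by lra.
by rewrite /phi (pos_ge h1) (pos_ge h2); field; rewrite gt_eqF.
Qed.

Lemma phi_left x : x <= - d -> phi x = 0.
Proof.
have dp := d0; move=> h; have h1 : x + d <= 0 by lra. have h2 : x - d <= 0 by lra.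
by rewrite /phi (pos_le h1) (pos_le h2) expr0n subr0 mul0r.
Qed.

Lemma phi_mid x : - d <= x -> x <= d -> phi x = (x + d) ^+ 2 / (4 * d).
Proof.
have dp := d0; move=> h1 h2; have h3 : 0 <= x + d by lra. have h4 : x - d <= 0 by lra.
by rewrite /phi (pos_ge h3) (pos_le h4) expr0n subr0.
Qed.

Lemma phi_ge0 x : 0 <= phi x.
Proof.
have dp := d0; have [h|h] := leP x (- d); first by rewrite phi_left.
have [h2|h2] := leP x d; last by rewrite phi_right ?ltW //; lra.
by rewrite (phi_mid (ltW h) h2) divr_ge0 ?sqr_ge0 // mulr_ge0 // ltW.
Qed.

Lemma phi_gt0 x : - d < x -> 0 < phi x.
Proof.
have dp := d0; move=> h; have [h2|h2] := leP x d; last by rewrite phi_right ?ltW //; lra.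
rewrite (phi_mid (ltW h) h2); apply: divr_gt0; last by rewrite mulr_gt0.
by apply: exprn_gt0; lra.
Qed.

Lemma phi_small x r : d < r -> x < r -> phi x < r.
Proof.
have dp := d0; move=> dr xr; have [h|h] := leP x (- d); first by rewrite phi_left //; lra.
have [h2|h2] := leP x d; last by rewrite phi_right ?ltW.
rewrite (phi_mid (ltW h) h2) ltr_pdivrMr ?mulr_gt0 //.
have : (x + d) ^+ 2 <= (2 * d) ^+ 2 by rewrite !expr2; nra.
have : d * (4 * d) < r * (4 * d) by rewrite ltr_pM2r // mulr_gt0.
by rewrite !expr2; lra.
Qed.

Lemma phi_pair x : 0 < phi x + phi (- x).
Proof.
have dp := d0; have [h|h] := ltP (- d) x; first by rewrite ltr_pwDl ?phi_gt0 ?phi_ge0.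
by rewrite ltr_wpDl ?phi_ge0 ?phi_gt0 //; lra.
Qed.

Lemma dphi_ge0 x : 0 <= dphi x.
Proof.
have dp := d0; apply: divr_ge0; last by rewrite mulr_ge0 // ltW.
rewrite subr_ge0; have [h|h] := leP 0 (x - d).
  have h2 : 0 <= x + d by lra.
  by rewrite (pos_ge h) (pos_ge h2); lra.
by rewrite (pos_le (ltW h)) /pos le_max lexx orbT.
Qed.

(** In a rounded corner the speed passes from one branch to the other with total
    weight one, so that it never vanishes. *)
Lemma dphi_pair x : dphi x + dphi (- x) = 1.
Proof.
have h1 := posB (x + d); have h2 := posB (x - d).
rewrite /dphi -mulrDl.
have -> : pos (x + d) - pos (x - d) + (pos (- x + d) - pos (- x - d)) = 2 * d.
  rewrite (_ : - x + d = - (x - d)); last by ring.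
  by rewrite (_ : - x - d = - (x + d)); [lra|ring].
by rewrite divff // mulf_neq0 // gt_eqF.
Qed.

End Smoothing.

(** * Rounded corners *)
Section Corners.
Variables (R : realType) (g : R -> 'rV[R]_3) (s t : R).
Hypothesis gg : generic_immersion g.
Hypothesis dp : double_pair g s t.
Local Notation V := 'rV[R]_3.
Local Notation dg := (derive1 g).
Local Notation c := (g s).
Local Notation u := (dg s).
Local Notation v := (dg t).
Local Notation D := (det3 c u v).

(** Both displacements are taken in the direction [e = 1 \/ e = -1] from the double
    point: the corner comes in along the branch of [t] and leaves along that of [s].
    For [|x| >= d] one of the displacements is zero. *)
Definition precorner (d e : R) (x : R) : V :=
  g (s + e * phi d x) + g (t + e * phi d (- x)) - c.

Definition dprecorner (d e : R) (x : R) : V :=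
  (e * dphi d x) *: dg (s + e * phi d x) - (e * dphi d (- x)) *: dg (t + e * phi d (- x)).

Definition corner d e x := normalize (precorner d e x).

Lemma double_pair_eq : g t = c. Proof. by case: dp. Qed.

Lemma precorner_right (d e x : R) : 0 < d -> d <= x -> precorner d e x = g (s + e * x).
Proof.
move=> d0 dx; rewrite /precorner phi_right // (phi_left d0) ?lerN2 //.
by rewrite mulr0 addr0 double_pair_eq addrK.
Qed.

Lemma precorner_left (d e x : R) : 0 < d -> x <= - d -> precorner d e x = g (t - e * x).
Proof.
move=> d0 dx; rewrite /precorner (phi_left d0) // (@phi_right _ _ d0 (- x)); last by rewrite lerNr.
by rewrite mulr0 addr0 mulrN addrC addKr.
Qed.

Lemma corner_right (d e x : R) : 0 < d -> d <= x -> corner d e x = g (s + e * x).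
Proof. by move=> d0 dx; rewrite /corner precorner_right // normalize_id //; exact: g_sphere. Qed.

Lemma corner_left (d e x : R) : 0 < d -> x <= - d -> corner d e x = g (t - e * x).
Proof. by move=> d0 dx; rewrite /corner precorner_left // normalize_id //; exact: g_sphere. Qed.

Lemma precorner_derive (d e x : R) : 0 < d -> is_derive x 1 (precorner d e) (dprecorner d e x).
Proof.
move=> d0.
have h1 : is_derive x 1 (fun y : R => s + e * phi d y) (e * dphi d x).
  have := is_deriveD (is_derive_cst s x 1) (is_deriveZ e (phi_derive d0 x)).
  by move=> h; apply: (is_derive_ext h); rewrite add0r.
have h2 : is_derive x 1 (fun y : R => t + e * phi d (- y)) (- (e * dphi d (- x))).
  have hn : is_derive x 1 (fun y : R => phi d (-1 * y + 0)) (dphi d (-1 * x + 0) * -1).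
    exact: (@is_derive1_comp _ (phi d) _ _ _ _ (phi_derive d0 _) (is_derive_affine x (-1) 0)).
  rewrite (_ : (fun y => _) = cst t + e *: (fun y : R => phi d (-1 * y + 0))); last first.
    by apply/funext => y; rewrite !fctE addr0 mulN1r.
  apply: (is_derive_ext (is_deriveD (is_derive_cst t x 1) (is_deriveZ e hn))).
  by rewrite add0r /GRing.scale /= addr0 mulN1r mulrN1 mulrN.
have h3 := is_deriveB (is_deriveD (is_derive_comp_rv h1 (g_der gg _))
  (is_derive_comp_rv h2 (g_der gg _))) (is_derive_cst c x 1).
by apply: (is_derive_ext h3); rewrite subr0 scaleNr.
Qed.

Lemma precorner_cont (d e : R) : 0 < d -> continuous (precorner d e).
Proof. by move=> d0 x; exact: (is_derive_cvg (precorner_derive e x d0)). Qed.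

Lemma dprecorner_cont (d e : R) : 0 < d -> continuous (dprecorner d e).
Proof.
move=> d0 x.
have Nc : continuous (fun y : R => - y) by move=> y; apply: cvgN; exact: cvg_id.
have ph : {for x, continuous (phi d)} := @phi_cont _ _ d0 x.
have phN : {for x, continuous (fun y : R => phi d (- y))}.
  exact: (@continuous_comp _ _ _ (fun y : R => - y) (phi d) x (Nc x) (@phi_cont _ _ d0 _)).
have dph : {for x, continuous (dphi d)} := @dphi_cont _ d x.
have dphN : {for x, continuous (fun y : R => dphi d (- y))}.
  exact: (@continuous_comp _ _ _ (fun y : R => - y) (dphi d) x (Nc x) (@dphi_cont _ d _)).
have aff (f : R -> R) k : {for x, continuous f} -> {for x, continuous (fun y => k + e * f y)}.
  by move=> fc; exact: (cvgD (cvg_cst k) (cvgM (cvg_cst e) fc)).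
apply: cvgB; apply: cvgZ.
- exact: (cvgM (cvg_cst e) dph).
- exact: (@continuous_comp _ _ _ (fun y : R => s + e * phi d y) dg x (aff _ _ ph) (@dg_cont _ _ gg _)).
- exact: (cvgM (cvg_cst e) dphN).
- exact: (@continuous_comp _ _ _ (fun y : R => t + e * phi d (- y)) dg x (aff _ _ phN) (@dg_cont _ _ gg _)).
Qed.

End Corners.

(** * Rounded corners at small scale *)
Section CornersSmall.
Variables (R : realType) (g : R -> 'rV[R]_3) (s t : R).
Hypothesis gg : generic_immersion g.
Hypothesis dp : double_pair g s t.
Local Notation V := 'rV[R]_3.
Local Notation dg := (derive1 g).
Local Notation c := (g s).
Local Notation u := (dg s).
Local Notation v := (dg t).
Local Notation D := (det3 c u v).

Lemma det3_subl (a b w : V) : det3 a b (b - w) = - det3 a b w.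
Proof. by rewrite !det3E !mxE; ring. Qed.
Lemma det3_subr (a b w : V) : det3 a w (b - w) = - det3 a b w.
Proof. by rewrite !det3E !mxE; ring. Qed.
Lemma det3_lin (a p q w : V) (k l : R) :
  det3 a (k *: p - l *: q) w = k * det3 a p w - l * det3 a q w.
Proof. by rewrite !det3E !mxE; ring. Qed.
Lemma det3_self (a w : V) (l : R) : det3 (l *: a) (l *: a - a) w = 0.
Proof. by rewrite !det3E !mxE; ring. Qed.
Lemma det3_three (a p q w : V) : det3 a (p + q - a) w = det3 a (p - a) w + det3 a (q - a) w.
Proof. by rewrite !det3E !mxE; ring. Qed.
Lemma det3_midscal (a p w : V) (l : R) : det3 a (l *: p) w = l * det3 a p w.
Proof. by rewrite !det3E !mxE; ring. Qed.

Lemma det3_mid0 (a w : V) : det3 a 0 w = 0.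
Proof. by rewrite !det3E !mxE; ring. Qed.
Lemma det3_mid_swap (a p q w : V) : det3 a (p - q) w = - det3 a (q - p) w.
Proof. by rewrite !det3E !mxE; ring. Qed.

Definition sign (e : R) := e = 1 \/ e = -1.

Lemma sign_norm (e x : R) : sign e -> `|e * x| = `|x|.
Proof. by case=> ->; rewrite ?mul1r ?mulN1r ?normrN. Qed.

Lemma sign_sqr (e : R) : sign e -> e * e = 1.
Proof. by case=> ->; rewrite ?mul1r ?mulN1r ?opprK. Qed.

Lemma phi_norm (d x r : R) : 0 < d -> d < r -> `|x| < r -> `|phi d x| < r.
Proof.
move=> d0 dr xr; rewrite ger0_norm ?phi_ge0 //; apply: phi_small => //.
by apply: le_lt_trans xr; exact: ler_norm.
Qed.

Lemma precorner_close (b : R) : 0 < b -> \forall r \near 0^'+, forall d e x : R,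
  0 < d -> d < r -> sign e -> `|x| < r -> `|precorner g s t d e x - c| < b.
Proof.
move=> b0; have b2 : 0 < b / 2 by rewrite divr_gt0.
apply: filterS2 (cont_small (@g_cont _ _ gg s) b2) (cont_small (@g_cont _ _ gg t) b2).
move=> r C0 C1 d e x d0 dr se xr.
have -> : precorner g s t d e x - c =
    (g (s + e * phi d x) - g s) + (g (t + e * phi d (- x)) - g t).
  by rewrite /precorner (double_pair_eq dp) -!addrA; congr (_ + _); rewrite addrCA addrA.
rewrite [ltRHS]splitr; apply: (le_lt_trans (ler_normD _ _)).
apply: ltrD; [apply: C0|apply: C1]; rewrite addrC addKr sign_norm // phi_norm ?normrN //.
Qed.

(** With [w = u + v], the velocities [u] and [- v] at the two ends of the corner (up
    to the sign [e]) have determinants of the same sign, and [dphi_pair] makes the velocity of the corner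
    a convex combination of nearly these two. *)
Lemma precorner_det : \forall r \near 0^'+, forall d e x y : R,
  0 < d -> d < r -> sign e -> `|x| < r -> `|y| < r ->
  0 < det3 (precorner g s t d e x) (dprecorner g s t d e y) (u + v) * (e * D).
Proof.
have D0 := double_det3 gg dp.
have Du : det3 c u (u + v) != 0 by rewrite det3_addl.
have Dv : det3 c v (u + v) != 0 by rewrite det3_addr oppr_eq0.
have [b b0 [Hu Hv]] := small_ex (filterI (det3_small Du) (det3_small Dv)).
apply: filterS3 (precorner_close b0) (cont_small (@dg_cont _ _ gg s) b0)
  (cont_small (@dg_cont _ _ gg t) b0) => r P C0 C1 d e x y d0 dr se xr yr.
have px := P d e x d0 dr se xr.
have ay : `|dg (s + e * phi d y) - u| < b.
  by apply: C0; rewrite addrC addKr sign_norm // phi_norm.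
have bY : `|dg (t + e * phi d (- y)) - v| < b.
  by apply: C1; rewrite addrC addKr sign_norm // phi_norm ?normrN.
have ww : `|(u + v) - (u + v)| < b by rewrite subrr normr0.
have hu := Hu _ _ _ px ay ww; have hv := Hv _ _ _ px bY ww.
rewrite (det3_addl c u v) in hu; rewrite (det3_addr c u v) in hv.
rewrite /dprecorner det3_lin.
move: (det3 _ (dg (s + _)) _) (det3 _ (dg (t + _)) _) hu hv => X Y hu hv.
have -> : (e * dphi d y * X - e * dphi d (- y) * Y) * (e * D) =
    dphi d y * (X * D) + dphi d (- y) * (Y * - D).
  transitivity (e * e * (dphi d y * (X * D) + dphi d (- y) * (Y * - D))); first by ring.
  by rewrite sign_sqr // mul1r.
have g1 := dphi_ge0 d0 y; have g2 := dphi_ge0 d0 (- y); have gs := dphi_pair d0 y.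
have [z|nz] := eqVneq (dphi d y) 0.
  by rewrite z mul0r add0r; rewrite z add0r in gs; rewrite gs mul1r.
apply: ltr_pwDl; last by rewrite mulr_ge0 // ltW.
by rewrite mulr_gt0 // lt_neqAle eq_sym nz.
Qed.

Lemma precorner_neq0 : \forall r \near 0^'+, forall d e x : R,
  0 < d -> d < r -> sign e -> `|x| < r -> precorner g s t d e x != 0.
Proof.
have n0 : 0 < `|c| by rewrite normr_gt0 (g_neq0 gg).
apply: filterS (precorner_close n0) => r P d e x d0 dr se xr.
by apply/eqP => E; have := P d e x d0 dr se xr; rewrite E sub0r normrN ltxx.
Qed.

(** By the mean value theorem, [precorner_det] excludes that two points of the corner
    lie on one ray. *)
Lemma corner_inj : \forall r \near 0^'+, forall d e x y : R,
  0 < d -> d < r -> sign e -> `|x| < r -> `|y| < r ->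
  corner g s t d e x = corner g s t d e y -> x = y.
Proof.
apply: filterS2 precorner_det precorner_neq0 => r H n0 d e.
suff main x y : 0 < d -> d < r -> sign e -> `|x| < r -> `|y| < r -> y < x ->
    corner g s t d e x <> corner g s t d e y.
  move=> x y d0 dr se xr yr E; case: (ltgtP x y) => // h.
    by case: (main y x d0 dr se yr xr h).
  by case: (main x y d0 dr se xr yr h).
move=> d0 dr se xr yr yx E.
have [l l0 El] := normalize_eq_scale (n0 d e x d0 dr se xr) (n0 d e y d0 dr se yr) E.
have [z [/andP[yz zx] Ez]] :=
  det3_MVT (fun z => precorner_derive s t gg e z d0) (precorner g s t d e x) (u + v) yx.
have zr : `|z| < r by move: xr yr; rewrite !ltr_norml => /andP[? ?] /andP[? ?]; lra.
have := H d e x z d0 dr se xr zr.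
move: Ez; rewrite {1 2}El det3_self => /esym/eqP; rewrite mulf_eq0 subr_eq0 gt_eqF //=.
by move=> /eqP ->; rewrite mul0r ltxx.
Qed.

(** The determinant with [c] and [u - v] measures the sum of the two displacements,
    which is positive on one corner and negative on the other. *)
Lemma corners_disjoint : \forall r \near 0^'+, forall d x y : R,
  0 < d -> d < r -> `|x| < r -> `|y| < r ->
  corner g s t d 1 x <> corner g s t d (-1) y.
Proof.
have D0 := double_det3 gg dp.
have Du : det3 c u (u - v) != 0 by rewrite det3_subl oppr_eq0.
have Dv : det3 c v (u - v) != 0 by rewrite det3_subr oppr_eq0.
apply: filterS3 precorner_neq0 (chord_det (g_der gg) (dg_cont gg) Du)
  (chord_det (g_der gg) (dg_cont gg) Dv) => r n0 Hs Ht d x y d0 dr xr yr E.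
have r0 : 0 < r by exact: lt_trans dr.
have z0 (a : R) : `|a - a| < r by rewrite subrr normr0.
have w0 : `|(u - v) - (u - v)| < r by rewrite subrr normr0.
have c0 : `|c - c| < r by rewrite subrr normr0.
pose X a := det3 c (g (s + a) - g s) (u - v) * - D.
pose Y a := det3 c (g (t + a) - g t) (u - v) * - D.
have swap (p q : V) : det3 c (p - q) (u - v) = - det3 c (q - p) (u - v).
  exact: det3_mid_swap.
have Xp a : 0 < a -> `|a| < r -> 0 < X a.
  move=> a0 ar; have ar' : `|s + a - s| < r by rewrite addrC addKr.
  have lt : s < s + a by rewrite ltrDl.
  by have := Hs c (u - v) (s + a) s c0 w0 ar' (z0 s) lt; rewrite det3_subl.
have Yp a : 0 < a -> `|a| < r -> 0 < Y a.
  move=> a0 ar; have ar' : `|t + a - t| < r by rewrite addrC addKr.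
  have lt : t < t + a by rewrite ltrDl.
  by have := Ht c (u - v) (t + a) t c0 w0 ar' (z0 t) lt; rewrite det3_subr.
have Xn a : 0 < a -> `|a| < r -> X (- a) < 0.
  move=> a0 ar; have ar' : `|s - a - s| < r by rewrite addrC addKr normrN.
  have lt : s - a < s by rewrite gtrDl oppr_lt0.
  have := Hs c (u - v) s (s - a) c0 w0 (z0 s) ar' lt; rewrite det3_subl.
  by rewrite swap mulNr oppr_gt0.
have Yn a : 0 < a -> `|a| < r -> Y (- a) < 0.
  move=> a0 ar; have ar' : `|t - a - t| < r by rewrite addrC addKr normrN.
  have lt : t - a < t by rewrite gtrDl oppr_lt0.
  have := Ht c (u - v) t (t - a) c0 w0 (z0 t) ar' lt; rewrite det3_subr.
  by rewrite swap mulNr oppr_gt0.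
have X0 : X 0 = 0 by rewrite /X addr0 subrr det3_mid0 mul0r.
have Y0 : Y 0 = 0 by rewrite /Y addr0 subrr det3_mid0 mul0r.
have split_det e z : det3 c (precorner g s t d e z) (u - v) * - D =
    X (e * phi d z) + Y (e * phi d (- z)).
  by rewrite /precorner det3_three mulrDl /X /Y (double_pair_eq dp).
have plus z : `|z| < r -> 0 < det3 c (precorner g s t d 1 z) (u - v) * - D.
  move=> zr; rewrite split_det !mul1r.
  have z1 := phi_norm d0 dr zr; have z2 : `|phi d (- z)| < r by rewrite phi_norm ?normrN.
  have := phi_pair d0 z; have := phi_ge0 d0 z; have := phi_ge0 d0 (- z).
  rewrite !le_eqVlt => /orP[/eqP h2|h2] /orP[/eqP h1|h1] h.
  - by rewrite -h1 -h2 addr0 ltxx in h.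
  - by rewrite -h2 Y0 addr0; exact: Xp.
  - by rewrite -h1 X0 add0r; exact: Yp.
  - by apply: addr_gt0; [exact: Xp|exact: Yp].
have minus z : `|z| < r -> det3 c (precorner g s t d (-1) z) (u - v) * - D < 0.
  move=> zr; rewrite split_det !mulN1r.
  have z1 := phi_norm d0 dr zr; have z2 : `|phi d (- z)| < r by rewrite phi_norm ?normrN.
  have := phi_pair d0 z; have := phi_ge0 d0 z; have := phi_ge0 d0 (- z).
  rewrite !le_eqVlt => /orP[/eqP h2|h2] /orP[/eqP h1|h1] h.
  - by rewrite -h1 -h2 addr0 ltxx in h.
  - by rewrite -h2 oppr0 Y0 addr0; exact: Xn.
  - by rewrite -h1 oppr0 X0 add0r; exact: Yn.
  - by rewrite -oppr_gt0 opprD addr_gt0 // oppr_gt0; [exact: Xn|exact: Yn].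
have s1 : sign 1 by left. have s2 : sign (-1) by right.
have [l l0 El] := normalize_eq_scale (n0 d 1 x d0 dr s1 xr) (n0 d (-1) y d0 dr s2 yr) E.
have := plus x xr; rewrite El det3_midscal -mulrA pmulr_rgt0 // => h.
by have := lt_trans h (minus y yr); rewrite ltxx.
Qed.

End CornersSmall.

(** * Caps around a double point *)
Section Caps.
Variables (R : realType) (g : R -> 'rV[R]_3).
Hypothesis gg : generic_immersion g.
Local Notation V := 'rV[R]_3.
Local Notation dg := (derive1 g).

Lemma dot_MVT (a : V) (x y : R) : x < y -> exists z, [/\ x < z < y &
  dot a (g y) - dot a (g x) = (y - x) * dot a (dg z)].
Proof.
move=> xy.
have h (z : R) : is_derive z 1 (fun x => dot a (g x)) (dot a (dg z)).
  have := is_derive_dot (is_derive_cst a z 1) (g_der gg z).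
  by move=> h; apply: (is_derive_ext h); rewrite !coordE; ring.
have ct : {within `[x, y], continuous (fun x => dot a (g x))}.
  by apply: derivable_within_continuous => z _; case: (h z).
have [z /[!in_itv]/= zyx E] := MVT xy (fun z _ => h z) ct.
by exists z; split=> //; rewrite E mulrC.
Qed.

(** The derivative of the height is the product of the velocity with [g t0 - g x],
    which is nearly a multiple of the velocity with the sign of [t0 - x]. *)
Lemma height_monotone t0 : \forall r \near 0^'+, forall x y : R, 0 <= x -> x < y -> y < r ->
  dot (g t0) (g (t0 + y)) < dot (g t0) (g (t0 + x)) /\
  dot (g t0) (g (t0 - y)) < dot (g t0) (g (t0 - x)).
Proof.
have dd : 0 < dot (dg t0) (dg t0) by rewrite dot_gt0 // (dg_neq0 gg).
have C : \forall z \near (dg t0, dg t0), 0 < dot z.1 z.2.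
  have Cv : dot z.1 z.2 @[z --> (dg t0, dg t0)] --> dot (dg t0) (dg t0).
    by apply: cvg_dot; [exact: cvg_fst|exact: cvg_snd].
  by apply: (cvgr_gt _ Cv).
have [b b0 Hb] := small_ex (near_small C).
have Hd p q : `|p - dg t0| < b -> `|q - dg t0| < b -> 0 < dot p q.
  by move=> hp hq; apply: (Hb (p, q)); rewrite prod_normE /= gt_max hp.
apply: filterS2 (cont_small (@dg_cont _ _ gg t0) b0) (is_derive_quot (g_der gg t0) b0).
move=> r C0 Q x y x0 xy yr.
have slope z : z != 0 -> `|z| < r -> dot (g t0) (dg (t0 + z)) * z < 0.
  move=> z0 zr; have -> : dot (g t0) (dg (t0 + z)) * z =
      - (z ^+ 2 * dot (z^-1 *: (g (t0 + z) - g t0)) (dg (t0 + z))).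
    rewrite dotZl dotBl (dot_g_dg gg) sub0r; field; exact: z0.
  rewrite oppr_lt0; apply: mulr_gt0; first by rewrite exprn_even_gt0.
  by apply: Hd; [exact: Q|apply: C0; rewrite addrC addKr].
have slope_p z : 0 < z -> z < r -> dot (g t0) (dg (t0 + z)) < 0.
  move=> z0 zr; rewrite -(pmulr_llt0 _ z0); apply: slope; first by rewrite gt_eqF.
  by rewrite gtr0_norm.
have slope_n z : 0 < z -> z < r -> 0 < dot (g t0) (dg (t0 - z)).
  move=> z0 zr; have nz : - z < 0 by rewrite oppr_lt0.
  rewrite -(nmulr_llt0 _ nz); apply: slope; first by rewrite lt_eqF.
  by rewrite normrN gtr0_norm.
split.
  have lt : t0 + x < t0 + y by rewrite ltrD2l.
  have [z [/andP[xz zy] E]] := dot_MVT (g t0) lt.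
  have yx : 0 < t0 + y - (t0 + x) by rewrite subr_gt0.
  rewrite -subr_lt0 E (pmulr_rlt0 _ yx) -[z](subrK t0) addrC; apply: slope_p.
    by rewrite subr_gt0 (le_lt_trans _ xz) // lerDl.
  by rewrite ltrBlDl (lt_trans zy) // ltrD2l.
have lt : t0 - y < t0 - x by rewrite ltrD2l ltrN2.
have [z [/andP[yz zx] E]] := dot_MVT (g t0) lt.
have yx : 0 < t0 - x - (t0 - y) by rewrite subr_gt0.
rewrite -subr_gt0 E (pmulr_rgt0 _ yx).
have -> : z = t0 - (t0 - z) by rewrite opprB addrC subrK.
apply: slope_n; first by rewrite subr_gt0 (lt_le_trans zx) // gerDl oppr_le0.
by rewrite ltrBlDl -ltrBlDr (lt_trans _ yz) // ltrD2l ltrN2.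
Qed.

Lemma cap_small (c p : V) (d : R) : 0 < d -> sphere c -> sphere p ->
  1 - dot c p < d ^+ 2 / 2 -> `|p - c| < d.
Proof.
move=> d0 c1 p1 h; rewrite [ltLHS]/Num.Def.normr /= mx_normrE.
apply/bigmax_ltP; split=> // -[i j] _ /=; rewrite ord1 {i}.
have E : dot (p - c) (p - c) = 2 - 2 * dot c p.
  by rewrite dotBl !dotBr (p1 : dot _ _ = 1) (c1 : dot _ _ = 1) (dotC p c); ring.
have le : (p - c) 0 j ^+ 2 <= dot (p - c) (p - c).
  rewrite dotE -!expr2; move: ((p - c) 0) => f; move: j; apply: I3P.
  - by rewrite -addrA lerDl addr_ge0 ?sqr_ge0.
  - by rewrite addrAC lerDr addr_ge0 ?sqr_ge0.
  - by rewrite lerDr addr_ge0 ?sqr_ge0.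
rewrite -ltr_sqr ?nnegrE ?(ltW d0) // real_normK ?num_real //.
by apply: (le_lt_trans le); rewrite E; lra.
Qed.

Lemma cap_cut t0 (r h : R) : 0 < r -> (forall x y : R, 0 <= x -> x < y -> y <= r ->
    dot (g t0) (g (t0 + y)) < dot (g t0) (g (t0 + x)) /\
    dot (g t0) (g (t0 - y)) < dot (g t0) (g (t0 - x))) ->
  h < 1 -> dot (g t0) (g (t0 + r)) < h -> dot (g t0) (g (t0 - r)) < h ->
  exists a b, [/\ 0 < a < r, 0 < b < r & forall x, `|x| <= r ->
    (h <= dot (g t0) (g (t0 + x)) <-> - a <= x <= b)].
Proof.
move=> r0 mono h1 hp hm.
have hc e : {within `[0, r], continuous (fun x => dot (g t0) (g (t0 + e * x)))}.
  apply: continuous_subspaceT => x; apply: cvg_dot; first exact: cvg_cst.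
  apply: (@continuous_comp _ _ _ (fun x : R => t0 + e * x) g); last exact: (@g_cont _ _ gg).
  exact: (cvgD (cvg_cst _) (cvgM (cvg_cst _) cvg_id)).
have v0 e : dot (g t0) (g (t0 + e * 0)) = 1 by rewrite mulr0 addr0; exact: (g_sphere gg).
have [|b b0r Eb] := @IVT R _ 0 r h (ltW r0) (hc 1).
  by rewrite v0 mul1r ge_min le_max (ltW hp) (ltW h1) orbT.
have [|a a0r Ea] := @IVT R _ 0 r h (ltW r0) (hc (-1)).
  by rewrite v0 mulN1r ge_min le_max (ltW hm) (ltW h1) orbT.
rewrite mul1r in Eb; rewrite mulN1r in Ea.
move: b0r a0r; rewrite !in_itv /= => /andP[b0 br] /andP[a0 ar].
have b_0 : 0 < b.
  rewrite lt_neqAle b0 andbT; apply/eqP => z; move: Eb.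
  by rewrite -z addr0 (g_sphere gg t0 : dot _ _ = 1); lra.
have a_0 : 0 < a.
  rewrite lt_neqAle a0 andbT; apply/eqP => z; move: Ea.
  by rewrite -z subr0 (g_sphere gg t0 : dot _ _ = 1); lra.
have b_r : b < r.
  rewrite lt_neqAle br andbT; apply/eqP => z; move: Eb; rewrite z; lra.
have a_r : a < r.
  rewrite lt_neqAle ar andbT; apply/eqP => z; move: Ea; rewrite z; lra.
exists a, b; split; rewrite ?a_0 ?b_0 // => x xr.
have [x0|x0] := leP 0 x.
  rewrite ger0_norm // in xr; split=> [hx|/andP[_ xb]].
    apply/andP; split; first lra.
    rewrite leNgt; apply/negP => bx.
    by have [+ _] := mono b x b0 bx xr; rewrite Eb; lra.
  move: xb; rewrite le_eqVlt => /orP[/eqP -> |xb]; first by rewrite Eb.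
  by have [+ _] := mono x b x0 xb br; rewrite Eb => /ltW.
rewrite ltr0_norm // in xr; have x0' : 0 <= - x by lra.
split=> [hx|/andP[ax _]].
  apply/andP; split; last lra.
  rewrite leNgt; apply/negP => xa; have xa' : a < - x by lra.
  by have [_ +] := mono a (- x) a0 xa' xr; rewrite Ea opprK; lra.
have xa' : - x <= a by lra.
move: xa'; rewrite le_eqVlt => /orP[/eqP xa |xa].
  by rewrite -[x]opprK xa Ea.
by have [_ +] := mono (- x) a x0' xa ar; rewrite Ea opprK => /ltW.
Qed.

(** At small scale the height decreases along both branches away from the double
    point, and by compactness no other part of the curve comes close. *)
Lemma cap_exists s t : double_pair g s t -> \forall r \near 0^'+,
  exists h a1 a2 b1 b2, [/\ 0 < h < 1,
    [/\ 0 < a1 < r, 0 < a2 < r, 0 < b1 < r & 0 < b2 < r],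
    forall x, `|x| <= r -> (h <= dot (g s) (g (s + x)) <-> - a1 <= x <= a2) /\
                           (h <= dot (g s) (g (t + x)) <-> - b1 <= x <= b2),
    forall z, h <= dot (g s) (g z) -> exists k : int, `|z + k%:~R - s| < r \/ `|z + k%:~R - t| < r &
    forall z, h <= dot (g s) (g z) -> crossing g z -> g z = g s].
Proof.
move=> dp; have dp' := double_pair_sym dp; have E : g s = g t by case: dp.
have [r0 r00 [[ms mt] [is_ it]]] := small_ex (filterI
  (filterI (height_monotone s) (height_monotone t))
  (filterI (crossing_isolated gg dp) (crossing_isolated gg dp'))).
apply: (small_intro r00) => r rp rr0.
have [d d0 Hd] := small_ex (close_parameter gg rp (fun x => @double_unique _ _ gg s t x dp)).
pose M := Num.max (Num.max (Num.max (dot (g s) (g (s + r))) (dot (g s) (g (s - r))))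
  (Num.max (dot (g t) (g (t + r))) (dot (g t) (g (t - r))))) (Num.max 0 (1 - d ^+ 2 / 2)).
have one x : dot (g x) (g x) = 1 := g_sphere gg x.
have M1 : M < 1.
  rewrite /M !gt_max ltr01 /=.
  have [+ +] := ms 0 r (lexx 0) rp rr0; rewrite addr0 subr0 one => -> ->.
  have [+ +] := mt 0 r (lexx 0) rp rr0; rewrite addr0 subr0 one => -> -> /=.
  by rewrite gtrDl oppr_lt0 divr_gt0 // exprn_gt0.
pose h := (1 + M) / 2.
have Mh : M < h by rewrite /h; lra.
have h1 : h < 1 by rewrite /h; lra.
move: (Mh); rewrite {1}/M !gt_max => /andP[/andP[/andP[s1 s2] /andP[t1 t2]] /andP[h0 hd]].
have [|a1 [a2 [ha1 ha2 Ha]]] := cap_cut rp _ h1 s1 s2.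
  by move=> x y x0 xy yr; apply: ms => //; exact: le_lt_trans rr0.
have [|b1 [b2 [hb1 hb2 Hb]]] := cap_cut rp _ h1 t1 t2.
  by move=> x y x0 xy yr; apply: mt => //; exact: le_lt_trans rr0.
have near z : h <= dot (g s) (g z) ->
    exists k : int, `|z + k%:~R - s| < r \/ `|z + k%:~R - t| < r.
  move=> hz; apply: Hd; apply: cap_small => //; try exact: (g_sphere gg); lra.
exists h, a1, a2, b1, b2; split=> //.
- by rewrite h0.
- move=> x xr; split; first exact: Ha.
  by rewrite E; exact: Hb.
- move=> z hz [y dpy]; have [k hk] := near z hz.
  have cz : crossing g (z + k%:~R).
    exists y; case: dpy => ns Ezy; split; last by rewrite (g_per gg).
    apply: contra ns => /same_sourceP[k' Ek]; apply/same_sourceP; exists (k' - k).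
    by rewrite intrB; lra.
  rewrite -(g_per gg z k); case: hk => hk.
    by rewrite (is_ _ (lt_trans hk rr0) cz).
  by rewrite (it _ (lt_trans hk rr0) cz) E.
Qed.

End Caps.

(** * The non-Seifert splice *)
Section Splice.
Variables (R : realType) (g : R -> 'rV[R]_3) (s t : R).
Hypothesis gg : generic_immersion g.
Hypotheses (st : s < t) (ts : t < s + 1) (Est : g s = g t).
Local Notation V := 'rV[R]_3.
Local Notation dg := (derive1 g).
Local Notation c := (g s).
Local Notation D := (det3 c (dg s) (dg t)).

Variables r h a1 a2 b1 b2 d : R.

(** The cap has height [h] and cuts the two branches at the parameters [s - a1],
    [s + a2], [t - b1], [t + b2]; local facts hold at distance at most [r], and the
    corners are rounded at the smaller scale [d]. *)
Hypothesis room : [/\ 4 * r < t - s, 4 * r < s + 1 - t, 0 < d & 0 < h < 1].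
Hypothesis scales : [/\ d < a1 < r, d < a2 < r, d < b1 < r & d < b2 < r].
Hypothesis cut : forall x, `|x| <= r ->
  (h <= dot c (g (s + x)) <-> - a1 <= x <= a2) /\
  (h <= dot c (g (t + x)) <-> - b1 <= x <= b2).
Hypothesis far : forall z, h <= dot c (g z) ->
  exists k : int, `|z + k%:~R - s| < r \/ `|z + k%:~R - t| < r.
Hypothesis lone : forall z, h <= dot c (g z) -> crossing g z -> g z = c.

Local Notation crn := (corner g s t d).
Local Notation pre := (precorner g s t d).
Local Notation dpre := (dprecorner g s t d).

Hypothesis crn_in : forall e x, sign e -> `|x| <= d -> h <= dot c (crn e x).
Hypothesis pre_det : forall e x, sign e -> `|x| < r ->
  det3 (pre e x) (dpre e x) (dg s + dg t) != 0.
Hypothesis pre_ne0 : forall e x, sign e -> `|x| < r -> pre e x != 0.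
Hypothesis crn_inj : forall e x y, sign e -> `|x| < r -> `|y| < r ->
  crn e x = crn e y -> x = y.
Hypothesis crn_disj : forall x y, `|x| < r -> `|y| < r -> crn 1 x <> crn (-1) y.

Lemma dpst : double_pair g s t.
Proof. by split=> //; exact: not_same_source. Qed.

Lemma sign1 : @sign R 1. Proof. by left. Qed.
Lemma signN1 : @sign R (-1). Proof. by right. Qed.

Lemma d_lt_r : d < r.
Proof. by have [/andP[h1 h2] _ _ _] := scales; exact: lt_trans h2. Qed.

Lemma crnR e x : d <= x -> crn e x = g (s + e * x).
Proof.
move=> dx; have [_ _ d0 _] := room.
by apply: corner_right; [exact: gg|exact: dpst|exact: d0|exact: dx].
Qed.

Lemma crnL e x : x <= - d -> crn e x = g (t - e * x).
Proof.
move=> dx; have [_ _ d0 _] := room.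
by apply: corner_left; [exact: gg|exact: d0|exact: dx].
Qed.

Lemma pre_neq0 e x : sign e -> pre e x != 0.
Proof.
move=> se; have [_ _ d0 _] := room; have [xr|xr] := ltP `|x| r; first exact: pre_ne0.
have dx : d <= `|x| by apply: ltW; apply: lt_le_trans xr; exact: d_lt_r.
have [x0|x0] := leP 0 x.
  rewrite ger0_norm // in dx.
  by rewrite (precorner_right dpst) //; exact: g_neq0.
rewrite ltr0_norm // in dx; rewrite precorner_left //; first exact: g_neq0.
by rewrite lerNr.
Qed.

Definition dcrn e x := dnormalize (pre e x) (dpre e x).

Lemma crn_derive (e x : R) : sign e -> is_derive x 1 (crn e) (dcrn e x).
Proof.
move=> se; have [_ _ d0 _] := room.
by apply: is_derive_normalize; [exact: pre_neq0|exact: precorner_derive].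
Qed.

Lemma crn_cont e : sign e -> continuous (crn e).
Proof. by move=> se x; exact: (is_derive_cvg (crn_derive x se)). Qed.

Lemma dcrn_cont e : sign e -> continuous (dcrn e).
Proof.
move=> se x; have [_ _ d0 _] := room; apply: cvg_dnormalize; first exact: pre_neq0.
  exact: precorner_cont.
exact: dprecorner_cont.
Qed.

Lemma dnormalize_eq0 (p q w : V) : p != 0 -> dnormalize p q = 0 -> det3 p q w = 0.
Proof.
move=> p0 /eqP; rewrite subr_eq0 => /eqP E.
have s0 : Num.sqrt (dot p p) != 0 by rewrite gt_eqF // sqrt_dot_gt0.
have i0 : (Num.sqrt (dot p p))^-1 != 0 by rewrite invr_eq0.
apply: (mulfI i0); rewrite mulr0 -det3_midscal E.
by rewrite det3_midscal det3E; ring.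
Qed.

Lemma derive_unique (f : R -> V) (x : R) p q : is_derive x 1 f p -> is_derive x 1 f q -> p = q.
Proof. by case=> _ <- [_ <-]. Qed.

Lemma g_affine_derive (x k l : R) : is_derive x 1 (fun y => g (k * y + l)) (k *: dg (k * x + l)).
Proof. by apply: is_derive_comp_rv; [exact: is_derive_affine|exact: g_der]. Qed.

Lemma dcrn_right e (x : R) : sign e -> d < x -> dcrn e x = e *: dg (s + e * x).
Proof.
move=> se dx; have [_ _ d0 _] := room; apply: (derive_unique (crn_derive x se)).
have e1 : \forall y \near x, g (e * y + s) = crn e y.
  near=> y; rewrite crnR 1?addrC //.
  by apply/ltW; near: y; exact: lt_nbhsr.
by rewrite addrC; exact: (is_derive_near e1 (g_affine_derive x e s)).
Unshelve. all: by end_near. Qed.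

Lemma dcrn_left e (x : R) : sign e -> x < - d -> dcrn e x = - e *: dg (t - e * x).
Proof.
move=> se dx; have [_ _ d0 _] := room; apply: (derive_unique (crn_derive x se)).
have e1 : \forall y \near x, g (- e * y + t) = crn e y.
  near=> y; rewrite crnL; first by rewrite mulNr addrC.
  by apply/ltW; near: y; exact: lt_nbhsl.
by rewrite addrC -mulNr; exact: (is_derive_near e1 (g_affine_derive x (- e) t)).
Unshelve. all: by end_near. Qed.

Lemma sign_neq0 e : @sign R e -> e != 0.
Proof. by case=> ->; rewrite ?oppr_eq0 oner_eq0. Qed.

Lemma dcrn_neq0 e x : sign e -> dcrn e x != 0.
Proof.
move=> se; have e0 := sign_neq0 se; have [xr|xr] := ltP `|x| r.
  apply: contra_neq (pre_det se xr) => E; exact: (dnormalize_eq0 _ (pre_neq0 x se) E).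
have dx : d < `|x| by apply: lt_le_trans xr; exact: d_lt_r.
have [x0|x0] := leP 0 x.
  rewrite ger0_norm // in dx; rewrite dcrn_right // scaler_eq0 negb_or e0.
  exact: (dg_neq0 gg).
rewrite ltr0_norm // in dx; rewrite dcrn_left //; last by rewrite ltrNr.
by rewrite scaler_eq0 negb_or oppr_eq0 e0; exact: (dg_neq0 gg).
Qed.

Lemma crn_sphere e x : sign e -> sphere (crn e x).
Proof. by move=> se; exact/normalize_sphere/pre_neq0. Qed.

(** The spliced curve runs forward along the arc from [s] to [t], turns the corner,
    and runs backward along the arc from [s + 1] to [t].  The middles of the two
    arcs are convenient places to switch between the corners, because there both
    formulas give the original curve. *)
Definition spliced0 (x : R) : V :=
  if x <= (t + s + 1) / 2 then crn (-1) (x - t) else crn 1 (x - 1 - s).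
Definition spliced : R -> V := per ((s + t) / 2) spliced0.
Local Notation G := spliced.

Lemma spliced_per x (k : int) : G (x + k%:~R) = G x.
Proof. exact: per_shift. Qed.

Lemma g_per1 x : g (x + 1) = g x.
Proof. exact: (g_per gg x 1). Qed.

Lemma spliced_per1 x : G (x + 1) = G x.
Proof. exact: (spliced_per x 1). Qed.

Lemma spliced_near_t x : s + d <= x -> x <= s + 1 - d -> G x = crn (-1) (x - t).
Proof.
move=> x1 x2; have [room1 room2 d0 _] := room; have d_lt_r := d_lt_r.
have [x3|x3] := leP ((s + t) / 2) x.
  rewrite /G per_in /spliced0; [|by []|by lra].
  case: leP => // x4.
  have e1 : x - 1 - s <= - d by lra.
  have e2 : d <= x - t by lra.
  rewrite (crnL _ e1) (crnR _ e2).
  by rewrite -[RHS]g_per1; congr g; ring.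
rewrite -(spliced_per1 x) /G per_in /spliced0; [|by lra|by rewrite ltrD2r].
have e2 : x - t <= - d by lra.
rewrite (crnL _ e2).
case: leP => x4; first by exfalso; lra.
have e1 : d <= x + 1 - 1 - s by lra.
by rewrite (crnR _ e1); congr g; ring.
Qed.

Lemma spliced_near_s x : t - 1 + d <= x -> x <= t - d -> G x = crn 1 (x - s).
Proof.
move=> x1 x2; have [room1 room2 d0 _] := room; have d_lt_r := d_lt_r.
have [x3|x3] := leP ((s + t) / 2) x.
  rewrite /G per_in /spliced0; [|by []|by lra].
  case: leP => x4; last by exfalso; lra.
  have e1 : x - t <= - d by lra.
  have e2 : d <= x - s by lra.
  rewrite (crnL _ e1) (crnR _ e2).
  by congr g; ring.
rewrite -(spliced_per1 x) /G per_in /spliced0; [|by lra|by rewrite ltrD2r].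
case: leP => // x4; last by congr corner; ring.
have e1 : d <= x + 1 - t by lra.
have e2 : x - s <= - d by lra.
rewrite (crnR _ e1) (crnL _ e2).
by rewrite -[LHS]g_per1; congr g; ring.
Qed.

Lemma spliced_chart (x : R) : exists e a : R, sign e /\ \forall y \near x, G y = crn e (y - a).
Proof.
have [room1 room2 d0 _] := room; have d_lt_r := d_lt_r.
have near_in (k : int) (l u : R) : l < x + k%:~R -> x + k%:~R < u ->
    \forall y \near x, l <= y + k%:~R /\ y + k%:~R <= u.
  move=> h1 h2; near=> y; split; [rewrite -lerBlDr|rewrite -lerBrDr]; apply/ltW; near: y.
    by apply: lt_nbhsr; rewrite ltrBlDr.
  by apply: lt_nbhsl; rewrite ltrBrDr.
have [k /andP[k0 k1]] := shift_into s x.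
have [h1|h1] := leP (x + k%:~R) (s + d).
  exists 1, (s - k%:~R); split; first exact: sign1.
  have l1 : t - 1 + d < x + k%:~R by lra.
  have l2 : x + k%:~R < t - d by lra.
  apply: filterS (near_in _ _ _ l1 l2) => y [y1 y2].
  by rewrite -(spliced_per y k) spliced_near_s //; congr corner; ring.
have [h2|h2] := ltP (x + k%:~R) (s + 1 - d).
  exists (-1), (t - k%:~R); split; first exact: signN1.
  apply: filterS (near_in _ _ _ h1 h2) => y [y1 y2].
  by rewrite -(spliced_per y k) spliced_near_t //; congr corner; ring.
exists 1, (s - (k - 1)%:~R); split; first exact: sign1.
have l1 : t - 1 + d < x + (k - 1)%:~R by rewrite intrB; lra.
have l2 : x + (k - 1)%:~R < t - d by rewrite intrB; lra.
apply: filterS (near_in _ _ _ l1 l2) => y [y1 y2].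
by rewrite -(spliced_per y (k - 1)) spliced_near_s //; congr corner; ring.
Unshelve. all: by end_near. Qed.

Lemma crn_shift_derive (e a x : R) : sign e -> is_derive x 1 (fun y => crn e (y - a)) (dcrn e (x - a)).
Proof.
move=> se; have h1 : is_derive x 1 (fun y => crn e (1 * y - a)) (1 *: dcrn e (1 * x - a)).
  by apply: is_derive_comp_rv; [exact: is_derive_affine|exact: crn_derive].
rewrite mul1r scale1r in h1.
by rewrite (_ : (fun y => _) = fun y => crn e (1 * y - a)) //; apply/funext => y; rewrite mul1r.
Qed.

Lemma spliced_derive_near (x e a : R) : sign e -> (\forall y \near x, G y = crn e (y - a)) ->
  \forall y \near x, is_derive (y : R) 1 G (dcrn e (y - a)).
Proof.
move=> se /nbhs_interior; apply: filterS => y Hy.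
apply: (is_derive_near _ (crn_shift_derive a y se)).
by apply: filterS Hy => z ->.
Qed.

Lemma spliced_immersion : immersion G.
Proof.
have der (x : R) : exists2 p, p != 0 & is_derive x 1 G p.
  have [e [a [se Ha]]] := spliced_chart x.
  exists (dcrn e (x - a)); first exact: dcrn_neq0.
  exact: (nbhs_singleton (spliced_derive_near se Ha)).
split; first split.
- by move=> x; have [p _ Dp] := der x; exact: is_derive_cvg Dp.
- by move=> x; exact: (spliced_per x 1).
- move=> x; have [e [a [se Ha]]] := spliced_chart x.
  by rewrite (nbhs_singleton Ha); exact: crn_sphere.
- by move=> x; have [p _ [Dp _]] := der x.
- move=> x; have [e [a [se Ha]]] := spliced_chart x; have Hd := spliced_derive_near se Ha.
  have e1 : \forall y \near x, dcrn e (y - a) = derive1 G y.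
    by apply: filterS Hd => y [_ <-]; rewrite derive1E.
  rewrite /continuous_at -(nbhs_singleton e1); apply: cvg_trans (near_eq_cvg e1) _.
  apply: (@continuous_comp _ _ _ (fun y : R => y - a) (dcrn e)); last exact: (dcrn_cont se).
  by apply: cvgB; [exact: cvg_id|exact: cvg_cst].
- by move=> x; have [p p0 [_ E]] := der x; rewrite derive1E E.
Qed.

(** By [far] a parameter in the cap is close to [s] or [t] up to an integer, and that
    integer is zero because both cut arcs lie in the chosen period. *)
Lemma cap_parameters u : s - a1 <= u -> u < s - a1 + 1 ->
  h <= dot c (g u) <-> (s - a1 <= u <= s + a2) \/ (t - b1 <= u <= t + b2).
Proof.
move=> u0 u1; have [room1 room2 d0 _] := room.
have [/andP[da1 a1r] /andP[da2 a2r] /andP[db1 b1r] /andP[db2 b2r]] := scales.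
have cs x : - r <= x -> x <= r -> h <= dot c (g (s + x)) <-> - a1 <= x <= a2.
  by move=> x0 x1; have [|] := @cut x; rewrite ?ler_norml ?x0.
have ct x : - r <= x -> x <= r -> h <= dot c (g (t + x)) <-> - b1 <= x <= b2.
  by move=> x0 x1; have [|] := @cut x; rewrite ?ler_norml ?x0.
split=> [hu|].
  have [k [] /[!ltr_distl] /andP[k0 k1]] := far hu.
    have [] := cs (u + k%:~R - s); [lra|lra|].
    rewrite (addrC s) subrK (g_per gg) => /(_ hu) /andP[h1 h2] _.
    have k00 : k = 0.
      by apply: (@int_small R); lra.
    by left; apply/andP; rewrite k00 in h1 h2; split; lra.
  have [] := ct (u + k%:~R - t); [lra|lra|].
  rewrite (addrC t) subrK (g_per gg) => /(_ hu) /andP[h1 h2] _.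
  have k00 : k = 0.
    by apply: (@int_small R); lra.
  by right; apply/andP; rewrite k00 in h1 h2; split; lra.
case=> /andP[h1 h2].
  have [] := cs (u - s); [lra|lra|].
  by rewrite (addrC s) subrK => _; apply; apply/andP; split; lra.
have [] := ct (u - t); [lra|lra|].
by rewrite (addrC t) subrK => _; apply; apply/andP; split; lra.
Qed.

Lemma crn_cap1 x : - b2 <= x -> x <= a2 -> h <= dot c (crn 1 x).
Proof.
move=> x0 x1; have [room1 room2 d0 _] := room.
have [/andP[da1 a1r] /andP[da2 a2r] /andP[db1 b1r] /andP[db2 b2r]] := scales.
have [xd|xd] := leP `|x| d; first by apply: crn_in => //; exact: sign1.
have [xp|xn] := leP 0 x.
  rewrite ger0_norm // in xd; rewrite (crnR _ (ltW xd)) mul1r.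
  apply/cap_parameters; [lra|lra|left; apply/andP; split; lra].
rewrite ltr0_norm // in xd; have xd' : x <= - d by lra.
rewrite (crnL _ xd') mul1r.
apply/cap_parameters; [lra|lra|right; apply/andP; split; lra].
Qed.

Lemma crn_cap2 x : - b1 <= x -> x <= a1 -> h <= dot c (crn (-1) x).
Proof.
move=> x0 x1; have [room1 room2 d0 _] := room.
have [/andP[da1 a1r] /andP[da2 a2r] /andP[db1 b1r] /andP[db2 b2r]] := scales.
have [xd|xd] := leP `|x| d; first by apply: crn_in => //; exact: signN1.
have [xp|xn] := leP 0 x.
  rewrite ger0_norm // in xd; rewrite (crnR _ (ltW xd)) mulN1r.
  apply/cap_parameters; [lra|lra|left; apply/andP; split; lra].
rewrite ltr0_norm // in xd; have xd' : x <= - d by lra.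
rewrite (crnL _ xd') mulN1r opprK.
apply/cap_parameters; [lra|lra|right; apply/andP; split; lra].
Qed.

(** The parameter of the original curve under a parameter of the spliced one; an
    involution, as the arc between [t] and [s + 1] is reversed. *)
Definition old (x : R) := if x < t then x else s + t + 1 - x.
Definition old_sign (x : R) : R := if x < t then 1 else -1.

Lemma spliced_old x : s + d <= x <= t - d \/ t + d <= x <= s + 1 - d -> G x = g (old x).
Proof.
have [room1 room2 d0 _] := room; have drr := d_lt_r; rewrite /old.
case=> /andP[x0 x1].
  have e1 : x - t <= - d by lra.
  have xt : x < t by lra.
  rewrite xt spliced_near_t; [|lra|lra].
  by rewrite (crnL _ e1); congr g; ring.
have e1 : d <= x - t by lra.
have xt : (x < t) = false by apply/negbTE; rewrite -leNgt; lra.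
rewrite xt spliced_near_t; [|lra|lra].
by rewrite (crnR _ e1) -g_per1; congr g; ring.
Qed.

Lemma spliced_old_derive x : s + d < x < t - d \/ t + d < x < s + 1 - d ->
  derive1 G x = old_sign x *: dg (old x).
Proof.
move=> hx; have [room1 room2 d0 _] := room; have drr := d_lt_r.
suff Dx : is_derive x 1 G (old_sign x *: dg (old x)) by rewrite derive1E; case: Dx.
case: hx => /andP[x0 x1].
  have e1 : \forall y \near x, g (1 * y + 0) = G y.
    near=> y; rewrite mul1r addr0 spliced_old.
      rewrite /old ifT //; have : y < t - d by near: y; exact: lt_nbhsl.
      by lra.
    left; apply/andP; split; apply/ltW; near: y; [exact: lt_nbhsr|exact: lt_nbhsl].
  have xt : x < t by lra.
  rewrite /old_sign /old xt; have := is_derive_near e1 (g_affine_derive x 1 0).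
  by rewrite mul1r addr0.
have e1 : \forall y \near x, g (-1 * y + (s + t + 1)) = G y.
  near=> y; rewrite spliced_old.
    have ty : t + d < y by near: y; exact: lt_nbhsr.
    by rewrite /old ifF; [congr g; ring|apply/negbTE; rewrite -leNgt; lra].
  right; apply/andP; split; apply/ltW; near: y; [exact: lt_nbhsr|exact: lt_nbhsl].
have xt : (x < t) = false by apply/negbTE; rewrite -leNgt; lra.
rewrite /old_sign /old xt; have := is_derive_near e1 (g_affine_derive x (-1) (s + t + 1)).
by rewrite mulN1r (addrC (- x)).
Unshelve. all: by end_near. Qed.

(** The parameters of the two kept arcs, outside the cap. *)
Definition outer x := s + a2 < x < t - b1 \/ t + a1 < x < s + 1 - b2.

Lemma outer_old x : outer x -> G x = g (old x) /\ derive1 G x = old_sign x *: dg (old x).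
Proof.
have [room1 room2 d0 _] := room.
have [/andP[da1 a1r] /andP[da2 a2r] /andP[db1 b1r] /andP[db2 b2r]] := scales.
by case=> /andP[x0 x1]; (split; [apply: spliced_old|apply: spliced_old_derive]);
  [left|left|right|right]; apply/andP; split; lra.
Qed.

(** Inside the cap run the two rounded corners, and outside it the kept arcs, which
    are the parts of the original curve that the cap does not cut out. *)
Lemma spliced_cases x : s - b2 <= x -> x < s - b2 + 1 ->
  [\/ x <= s + a2 /\ h <= dot c (G x), t - b1 <= x <= t + a1 /\ h <= dot c (G x) |
      outer x /\ ~ h <= dot c (G x)].
Proof.
move=> x0 x1; have [room1 room2 d0 _] := room.
have [/andP[da1 a1r] /andP[da2 a2r] /andP[db1 b1r] /andP[db2 b2r]] := scales.
have [h1|h1] := leP x (s + a2).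
  constructor 1; split=> //; rewrite spliced_near_s; [|lra|lra].
  by apply: crn_cap1; lra.
have [h2|h2] := ltP x (t - b1).
  have ox : outer x by left; rewrite h1.
  constructor 3; split=> //; have [-> _] := outer_old ox.
  have xt : x < t by lra.
  rewrite /old xt => /cap_parameters[]; [lra|lra| |] => /andP[]; lra.
have [h3|h3] := leP x (t + a1).
  constructor 2; split; first by apply/andP.
  rewrite spliced_near_t; [|lra|lra].
  by apply: crn_cap2; lra.
have ox : outer x by right; rewrite h3 /=; lra.
constructor 3; split=> //; have [-> _] := outer_old ox.
have xt : (x < t) = false by apply/negbTE; rewrite -leNgt; lra.
rewrite /old xt => /cap_parameters[]; [lra|lra| |] => /andP[]; lra.
Qed.

Lemma old_range x : outer x -> [/\ s < old x, old x < s + 1 & old x < t <-> x < t].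
Proof.
have [room1 room2 d0 _] := room.
have [/andP[da1 a1r] /andP[da2 a2r] /andP[db1 b1r] /andP[db2 b2r]] := scales.
rewrite /old; case=> /andP[x0 x1].
  have xt : x < t by lra.
  by rewrite xt; split; [lra|lra|].
have xt : (x < t) = false by apply/negbTE; rewrite -leNgt; lra.
by rewrite xt; split; [lra|lra|split=> //; lra].
Qed.

Lemma old_inj x y : outer x -> outer y -> old x = old y -> x = y.
Proof.
move=> /old_range[_ _ hx] /old_range[_ _ hy] E; move: hx hy.
rewrite E; move: E; rewrite /old; case: ltP => xt; case: ltP => yt // E hx hy.
- by have := hy.1 (hx.2 isT).
- by have := hx.1 (hy.2 isT).
- by lra.
Qed.

(** Within the cap the two new arcs are simple and disjoint, so no double point
    arises there. *)
Lemma spliced_double x y : s - b2 <= x -> x < s - b2 + 1 -> s - b2 <= y -> y < s - b2 + 1 ->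
  x <> y -> G x = G y -> [/\ outer x, outer y & double_pair g (old x) (old y)].
Proof.
move=> x0 x1 y0 y1 xy E; have [room1 room2 d0 _] := room; have drr := d_lt_r.
have [/andP[da1 a1r] /andP[da2 a2r] /andP[db1 b1r] /andP[db2 b2r]] := scales.
have K1 z : s - b2 <= z -> z <= s + a2 -> G z = crn 1 (z - s) /\ `|z - s| < r.
  move=> z0 z1; split; first by apply: spliced_near_s; lra.
  by rewrite ltr_norml; apply/andP; split; lra.
have K2 z : t - b1 <= z <= t + a1 -> G z = crn (-1) (z - t) /\ `|z - t| < r.
  move=> /andP[z0 z1]; split; first by apply: spliced_near_t; lra.
  by rewrite ltr_norml; apply/andP; split; lra.
case: (spliced_cases x0 x1) => [[kx hx]|[kx hx]|[ox nx]];
case: (spliced_cases y0 y1) => [[ky hy]|[ky hy]|[oy ny]];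
  try by [case: ny; rewrite -E|case: nx; rewrite E].
- have [Ex rx] := K1 x x0 kx; have [Ey ry] := K1 y y0 ky.
  by case: xy; apply: (addIr (- s)); apply: (crn_inj sign1 rx ry); rewrite -Ex -Ey.
- have [Ex rx] := K1 x x0 kx; have [Ey ry] := K2 y ky.
  by case: (crn_disj rx ry); rewrite -Ex -Ey.
- have [Ex rx] := K2 x kx; have [Ey ry] := K1 y y0 ky.
  by case: (crn_disj ry rx); rewrite -Ex -Ey.
- have [Ex rx] := K2 x kx; have [Ey ry] := K2 y ky.
  by case: xy; apply: (addIr (- t)); apply: (crn_inj signN1 rx ry); rewrite -Ex -Ey.
have [Gx _] := outer_old ox; have [Gy _] := outer_old oy.
have [sx xs _] := old_range ox; have [sy ys _] := old_range oy.
split=> //; split; last by rewrite -Gx -Gy.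
have ne : old x <> old y by move=> /(old_inj ox oy).
case: (ltgtP (old x) (old y)) => // lt.
  by apply: not_same_source => //; lra.
by rewrite same_source_sym; apply: not_same_source => //; lra.
Qed.

Lemma spliced_same x y : same_source x y -> G x = G y.
Proof. by move=> /same_sourceP[k ->]; rewrite spliced_per. Qed.

Lemma period x : exists x', [/\ s - b2 <= x', x' < s - b2 + 1 & same_source x x'].
Proof.
have [k /andP[k0 k1]] := shift_into (s - b2) x; exists (x + k%:~R); split=> //.
by rewrite same_source_sym; apply/same_sourceP; exists k.
Qed.

Lemma same_in_period (m x y : R) : m <= x -> x < m + 1 -> m <= y -> y < m + 1 ->
  same_source x y -> x = y.
Proof.
move=> x0 x1 y0 y1 /same_sourceP[k E].
have k0 : k = 0 by apply: (@int_small R); lra.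
by rewrite E k0 addr0.
Qed.

Lemma outer_in x : outer x -> s < x < s + 1.
Proof.
have [room1 room2 d0 _] := room.
have [/andP[da1 a1r] /andP[da2 a2r] /andP[db1 b1r] /andP[db2 b2r]] := scales.
by case=> /andP[? ?]; apply/andP; split; lra.
Qed.

Lemma same_outer x y : outer x -> outer y -> same_source x y -> x = y.
Proof.
move=> /outer_in/andP[x0 x1] /outer_in/andP[y0 y1].
by apply: (@same_in_period s); rewrite ?(ltW x0) ?(ltW y0).
Qed.

Lemma spliced_double_period x y : double_pair G x y -> exists x' y',
  [/\ same_source x x', same_source y y', outer x', outer y' &
      double_pair g (old x') (old y')].
Proof.
move=> [ns E]; have [x' [x0 x1 xx]] := period x; have [y' [y0 y1 yy]] := period y.
exists x', y'; have Ex := spliced_same xx; have Ey := spliced_same yy.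
have ne : x' <> y'.
  move=> E2; case/negP: ns; apply: same_source_trans xx _.
  by rewrite E2 same_source_sym.
by have [] := spliced_double x0 x1 y0 y1 ne (etrans (esym Ex) (etrans E Ey)).
Qed.

Lemma outer_same x y : outer x -> outer y -> same_source (old x) (old y) -> x = y.
Proof.
move=> ox oy ss; apply: old_inj => //.
have [sx xs _] := old_range ox; have [sy ys _] := old_range oy.
exact: (same_in_period (ltW sx) xs (ltW sy) ys ss).
Qed.

Lemma spliced_derive_same x y : same_source x y -> derive1 G x = derive1 G y.
Proof.
move=> /same_sourceP[k ->]; have [_ gd _ _] := spliced_immersion.
have h1 : is_derive y 1 G (derive1 G (y + k%:~R)).
  have e1 : \forall z \near y, G (1 * z + k%:~R) = G z.
    by near=> z; rewrite mul1r spliced_per.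
  apply: (is_derive_near e1).
  rewrite -[derive1 _ _]scale1r; apply: is_derive_comp_rv; first exact: is_derive_affine.
  by rewrite mul1r derive1E; exact/derivableP/gd.
have h2 : is_derive y 1 G (derive1 G y) by rewrite derive1E; exact/derivableP/gd.
exact: derive_unique h1 h2.
Unshelve. all: by end_near. Qed.

Lemma old_sign_neq0 x : old_sign x != 0.
Proof. by rewrite /old_sign; case: ifP => _; rewrite ?oppr_eq0 oner_eq0. Qed.

Lemma det3_signs (k l : R) (a p q : V) : det3 a (k *: p) (l *: q) = k * l * det3 a p q.
Proof. by rewrite !det3E !mxE; ring. Qed.

Lemma spliced_generic : generic_immersion G.
Proof.
split; first exact: spliced_immersion.
- move=> x y /spliced_double_period[x' [y' [xx yy ox oy dpo]]].
  rewrite (spliced_derive_same xx) (spliced_derive_same yy).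
  have [_ ->] := outer_old ox; have [_ ->] := outer_old oy.
  have c1 : dot (g (old x')) (old_sign x' *: dg (old x')) = 0.
    by rewrite dotZr (dot_g_dg gg) mulr0.
  have c2 : dot (g (old x')) (old_sign y' *: dg (old y')) = 0.
    by case: dpo => _ ->; rewrite dotZr (dot_g_dg gg) mulr0.
  rewrite (transverse_det3 (g_sphere gg _) c1 c2) det3_signs.
  apply: mulf_neq0; last exact: (double_det3 gg dpo).
  by apply: mulf_neq0; exact: old_sign_neq0.
move=> x y z /spliced_double_period[x' [y' [xx yy ox oy dpo]]].
move=> /spliced_double_period[x2 [z' [xx2 zz ox2 oz dpo2]]].
have Ex : x2 = x'.
  by apply: same_outer => //; apply: same_source_trans xx; rewrite same_source_sym.
rewrite Ex in dpo2; have [_ _ un] := gg.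
have E : y' = z' by apply: outer_same => //; exact: un dpo dpo2.
by apply: same_source_trans yy _; rewrite E same_source_sym.
Qed.

Lemma spliced_double_old x y : s <= x -> x < s + 1 -> s <= y -> y < s + 1 ->
  double_pair G x y -> [/\ outer x, outer y & g (old x) = g (old y)].
Proof.
move=> x0 x1 y0 y1 /spliced_double_period[x' [y' [xx yy ox oy [_ dpo]]]].
have /andP[x2 x3] := outer_in ox; have /andP[y2 y3] := outer_in oy.
by rewrite (same_in_period x0 x1 (ltW x2) x3 xx) (same_in_period y0 y1 (ltW y2) y3 yy).
Qed.

(** A double point other than the spliced one is outside the cap, where the image of
    the curve does not change. *)
Lemma spliced_kept z : s < z -> z < s + 1 -> z <> t -> crossing g z ->
  outer (old z) /\ G (old z) = g z.
Proof.
move=> z0 z1 zt cz; have [room1 room2 d0 _] := room.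
have [/andP[da1 a1r] /andP[da2 a2r] /andP[db1 b1r] /andP[db2 b2r]] := scales.
have zc : g z <> c.
  move=> /(double_unique gg dpst)[/(same_in_period (ltW z0) z1 (lexx s)) h1|].
    by move: z0; rewrite h1 ?ltxx // ltrDl.
  by move/(same_in_period (ltW z0) z1 (ltW st) ts).
have out : ~ h <= dot c (g z) by move=> /lone/(_ cz).
have zs : z < s - a1 + 1.
  rewrite ltNge; apply/negP => hz; apply: out.
  rewrite -[z](subrK 1) g_per1; apply/cap_parameters; [lra|lra|left; apply/andP; split; lra].
have zs0 : s - a1 <= z by lra.
have [_ cutz] := cap_parameters zs0 zs.
rewrite /old; have [h1|h1] := ltP z t.
  have o : outer z.
    left; apply/andP; split; rewrite ltNge; apply/negP => h2; apply: out; apply: cutz.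
      by left; apply/andP; split; lra.
    by right; apply/andP; split; lra.
  by split=> //; have [-> _] := outer_old o; rewrite /old h1.
have zt' : t < z by rewrite lt_neqAle h1 andbT eq_sym; apply/eqP.
have o : outer (s + t + 1 - z).
  right; apply/andP; split; first by lra.
  rewrite ltNge; apply/negP => h2; apply: out; apply: cutz.
  by right; apply/andP; split; lra.
split=> //; have [-> _] := outer_old o.
have /andP[] := outer_in o => q1 q2.
by rewrite /old ifF; [congr g; ring|apply/negbTE; rewrite -leNgt; lra].
Qed.

(** The new arcs, with the orientation that the splice prescribes: from the branch
    of [s] to the branch of [t], against the direction of [corner]. *)
Definition arc1 (w : R) := crn (-1) (a1 - w * (a1 + b1)).
Definition arc2 (w : R) := crn 1 (a2 - w * (a2 + b2)).

Lemma arc_param (a b w : R) : 0 < a -> 0 < b -> 0 <= w <= 1 ->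
  - b <= a - w * (a + b) /\ a - w * (a + b) <= a.
Proof.
move=> a0 b0 /andP[w0 w1]; have ab : 0 < a + b by rewrite addr_gt0.
have h1 : 0 <= w * (a + b) by rewrite mulr_ge0 // ltW.
have h2 : w * (a + b) <= a + b by rewrite ger_pMl.
by split; lra.
Qed.

Lemma arc_param_inj (a b w z : R) : 0 < a -> 0 < b ->
  a - w * (a + b) = a - z * (a + b) -> w = z.
Proof.
move=> a0 b0 /addrI/oppr_inj; apply: mulIf.
by rewrite gt_eqF // addr_gt0.
Qed.

Lemma arc_param_surj (a b x : R) : 0 < a -> 0 < b -> - b <= x -> x <= a ->
  exists w, 0 <= w <= 1 /\ a - w * (a + b) = x.
Proof.
move=> a0 b0 x0 x1; have ab : 0 < a + b by rewrite addr_gt0.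
exists ((a - x) / (a + b)); split; last by rewrite divfK ?gt_eqF //; ring.
apply/andP; split; first by apply: divr_ge0; [lra|exact: ltW].
by rewrite ler_pdivrMr // mul1r; lra.
Qed.

Lemma splice_at : nonSeifert_splice_at g c G.
Proof.
have [room1 room2 d0 /andP[h0 h1]] := room.
have [/andP[da1 a1r] /andP[da2 a2r] /andP[db1 b1r] /andP[db2 b2r]] := scales.
have [a10 a20 b10 b20] : [/\ 0 < a1, 0 < a2, 0 < b1 & 0 < b2] by split; lra.
have bound (x a b : R) : a < r -> b < r -> - b <= x -> x <= a -> `|x| < r.
  by move=> *; rewrite ltr_norml; apply/andP; split; lra.
have arcc e (a k : R) : sign e -> continuous (fun w : R => crn e (a - w * k)).
  move=> se x; apply: (@continuous_comp _ _ _ (fun w : R => a - w * k) (crn e)).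
    exact: (cvgB (cvg_cst a) (cvgM cvg_id (cvg_cst k))).
  exact: (crn_cont se).
exists h, (s - a1), s, (s + a2), (t - b1), t, (t + b2), arc1, arc2.
split; [split| | split| split|].
- by apply/andP; split; lra.
- by lra.
- by apply/andP; split; lra.
- by lra.
- by [].
- move=> w; rewrite !mem_setE !in_itv /= => /andP[w0 w1]; have H := cap_parameters w0 w1.
  split=> [[_ /H[->//|->]]|]; first by rewrite orbT.
  by move=> /orP hw; split; [exact: (g_sphere gg)|apply/H; case: hw; [left|right]].
- move=> p [x [y [dpxy <-]]] [_ hp]; apply: lone => //; by exists y.
- split.
  + by apply: continuous_subspaceT; exact: (arcc _ _ _ signN1).
  + move=> w z; rewrite ?mem_setE !in_itv /= => wi zi E.
    have [w0 w1] := arc_param a10 b10 wi; have [z0 z1] := arc_param a10 b10 zi.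
    apply: (arc_param_inj a10 b10); apply: (crn_inj signN1 _ _ E); exact: (bound _ a1 b1).
  + move=> w; rewrite ?mem_setE in_itv /= => wi; have [w0 w1] := arc_param a10 b10 wi.
    by split; [exact: (crn_sphere _ signN1)|exact: crn_cap2].
  + rewrite /arc1 mul0r subr0 mul1r; split.
      by rewrite crnR ?ltW // mulN1r.
    have -> : a1 - (a1 + b1) = - b1 by ring.
    by rewrite crnL ?lerN2 ?ltW // mulN1r opprK.
- split.
  + by apply: continuous_subspaceT; exact: (arcc _ _ _ sign1).
  + move=> w z; rewrite ?mem_setE !in_itv /= => wi zi E.
    have [w0 w1] := arc_param a20 b20 wi; have [z0 z1] := arc_param a20 b20 zi.
    apply: (arc_param_inj a20 b20); apply: (crn_inj sign1 _ _ E); exact: (bound _ a2 b2).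
  + move=> w; rewrite ?mem_setE in_itv /= => wi; have [w0 w1] := arc_param a20 b20 wi.
    by split; [exact: (crn_sphere _ sign1)|exact: crn_cap1].
  + rewrite /arc2 mul0r subr0 mul1r; split.
      by rewrite crnR ?ltW // mul1r.
    have -> : a2 - (a2 + b2) = - b2 by ring.
    by rewrite crnL ?lerN2 ?ltW // mul1r opprK.
- apply/seteqP; split=> p // [[w wi <-] [z zi E]].
  rewrite /= in_itv /= in wi; rewrite /= in_itv /= in zi.
  have [w0 w1] := arc_param a10 b10 wi; have [z0 z1] := arc_param a20 b20 zi.
  by apply: (crn_disj _ _ E); [exact: (bound _ a2 b2)|exact: (bound _ a1 b1)].
apply/seteqP; split=> p.
  move=> [x0 _ <-]; have [x [x1 x2 /spliced_same ->]] := period x0.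
  case: (spliced_cases x1 x2) => [[kx _]|[/andP[k1 k2] _]|[ox nx]].
  - right; right; have [l1 l2] : - b2 <= x - s /\ x - s <= a2 by split; lra.
    have [w [wi Ew]] := arc_param_surj a20 b20 l1 l2.
    exists w; first by rewrite /= in_itv.
    by rewrite /arc2 Ew spliced_near_s //; lra.
  - right; left; have [l1 l2] : - b1 <= x - t /\ x - t <= a1 by split; lra.
    have [w [wi Ew]] := arc_param_surj a10 b10 l1 l2.
    exists w; first by rewrite /= in_itv.
    by rewrite /arc1 Ew spliced_near_t //; lra.
  - left; split; last by case.
    by have [-> _] := outer_old ox; exists (old x).
case=> [[[x0 _ <-] np]|[[w wi <-]|[w wi <-]]].
- have [k /andP[k0 k1]] := shift_into (s - a1) x0.
  rewrite -(g_per gg x0 k) in np *; move: (x0 + k%:~R) k0 k1 np => x k0 k1 np.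
  have nh : ~ h <= dot c (g x) by move=> hx; apply: np; split=> //; exact: (g_sphere gg).
  have [_ cutx] := cap_parameters k0 k1.
  have x1 : s + a2 < x.
    rewrite ltNge; apply/negP => hx; apply: nh; apply: cutx; left.
    by rewrite k0.
  have [hx|hx] := ltP x (t - b1).
    exists x => //; rewrite spliced_old; first by rewrite /old ifT //; lra.
    by left; apply/andP; split; lra.
  have x2 : t + b2 < x.
    rewrite ltNge; apply/negP => hx2; apply: nh; apply: cutx; right.
    by rewrite hx.
  exists (s + t + 1 - x) => //; rewrite spliced_old.
    by rewrite /old ifF; [congr g; ring|apply/negbTE; rewrite -leNgt; lra].
  by right; apply/andP; split; lra.
- rewrite /= in_itv /= in wi; have [w0 w1] := arc_param a10 b10 wi.
  exists (t + (a1 - w * (a1 + b1))) => //; rewrite spliced_near_t; [|lra|lra].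
  by rewrite /arc1; congr corner; ring.
- rewrite /= in_itv /= in wi; have [w0 w1] := arc_param a20 b20 wi.
  exists (s + (a2 - w * (a2 + b2))) => //; rewrite spliced_near_s; [|lra|lra].
  by rewrite /arc2; congr corner; ring.
Qed.

Lemma outer_neq x : outer x -> x <> t.
Proof.
have [room1 room2 d0 _] := room.
have [/andP[da1 a1r] /andP[da2 a2r] /andP[db1 b1r] /andP[db2 b2r]] := scales.
by case=> /andP[? ?] xt; lra.
Qed.

Lemma splice_properties : exists G, [/\ nonSeifert_splice_at g c G, generic_immersion G,
  forall x y, s <= x -> x < s + 1 -> s <= y -> y < s + 1 -> double_pair G x y ->
    [/\ s < x, x <> t, s < y, y <> t & g (old x) = g (old y)] &
  forall z, s < z -> z < s + 1 -> z <> t -> crossing g z -> G (old z) = g z].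
Proof.
exists G; split; [exact: splice_at|exact: spliced_generic| |].
  move=> x y x0 x1 y0 y1 dxy; have [ox oy E] := spliced_double_old x0 x1 y0 y1 dxy.
  have /andP[x2 _] := outer_in ox; have /andP[y2 _] := outer_in oy.
  by split=> //; exact: outer_neq.
by move=> z z0 z1 zt cz; case: (spliced_kept z0 z1 zt cz).
Qed.

End Splice.

(** * Choice of the scales *)
Section SpliceExists.
Variables (R : realType) (g : R -> 'rV[R]_3) (s t : R).
Hypothesis gg : generic_immersion g.
Hypotheses (st : s < t) (ts : t < s + 1) (Est : g s = g t).

(** All local requirements hold at small radius [r]; the cap is chosen for this [r],
    and the scale [d] of the corners last, small enough for them to fit in the cap. *)
Lemma splice_exists : exists G, [/\ nonSeifert_splice_at g (g s) G, generic_immersion G,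
  forall x y, s <= x -> x < s + 1 -> s <= y -> y < s + 1 -> double_pair G x y ->
    [/\ s < x, x <> t, s < y, y <> t & g (old s t x) = g (old s t y)] &
  forall z, s < z -> z < s + 1 -> z <> t -> crossing g z -> G (old s t z) = g z].
Proof.
have dp : double_pair g s t by split=> //; exact: not_same_source.
have m0 : 0 < (t - s) / 4 by rewrite divr_gt0 // subr_gt0.
have m1 : 0 < (s + 1 - t) / 4 by rewrite divr_gt0 // subr_gt0.
have [r r0 [[rm0 rm1] [[Hdet Hne] [[Hinj Hdisj] Hcap]]]] := small_ex (filterI
  (filterI (small_intro m0 (fun r _ h => h)) (small_intro m1 (fun r _ h => h)))
  (filterI (filterI (precorner_det gg dp) (precorner_neq0 gg dp))
    (filterI (filterI (corner_inj gg dp) (corners_disjoint gg dp)) (cap_exists gg dp)))).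
have [h [a1 [a2 [b1 [b2 [h01 [ha1 ha2 hb1 hb2] cut far lone]]]]]] := Hcap.
have /andP[h0 h1] := h01.
have Nc : \forall p \near g s, h < dot (g s) (normalize p).
  have NC : dot (g s) (normalize p) @[p --> g s] --> dot (g s) (normalize (g s)).
    apply: (@continuous_comp _ _ _ (@normalize R) (dot (g s)) (g s) _ (@dot_cont _ _ _)).
    by apply: (@cvg_normalize R _ (nbhs (g s)) _ id (g s)); [exact: (g_neq0 gg)|exact: cvg_id].
  apply: (cvgr_gt _ NC); rewrite (normalize_id (g_sphere gg s)).
  by rewrite (g_sphere gg s : dot _ _ = 1).
have [b b0 Hb] := small_ex (near_small Nc).
have [e e0 He] := small_ex (precorner_close gg dp b0).
move: ha1 ha2 hb1 hb2 => /andP[a10 a1r] /andP[a20 a2r] /andP[b10 b1r] /andP[b20 b2r].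
pose m := Num.min (Num.min a1 a2) (Num.min (Num.min b1 b2) e).
have mpos : 0 < m by rewrite !lt_min a10 a20 b10 b20 e0.
pose d := m / 2.
have d0 : 0 < d by rewrite divr_gt0.
have : d < m by rewrite /d ltr_pdivrMr // ltr_pMr // ltr1n.
rewrite !lt_min => /andP[/andP[da1 da2] /andP[/andP[db1 db2] de]].
have dr : d < r by exact: lt_trans a1r.
have D0 := double_det3 gg dp.
apply: (@splice_properties R g s t gg st ts Est r h a1 a2 b1 b2 d).
- by split=> //; lra.
- by split; apply/andP.
- exact: cut.
- exact: far.
- by move=> z hz cz; exact: lone.
- move=> e' x se xd; apply: ltW; apply: Hb; apply: He => //.
  exact: le_lt_trans de.
- move=> e' x se xr; have := Hdet d e' x x d0 dr se xr xr.
  by apply: contraTneq => ->; rewrite mul0r ltxx.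
- by move=> e' x se xr; exact: Hne.
- by move=> e' x y se xr yr; exact: (Hinj d e').
- by move=> x y xr yr; exact: (Hdisj d).
Qed.

End SpliceExists.

(** * The three chords *)
Section Pattern.
Variable R : realType.
Implicit Type g : R -> 'rV[R]_3.

(** The chord [(t1, t4)] crosses the disjoint chords [(t2, t6)] and [(t3, t5)]. *)
Definition pattern g := exists t1 t2 t3 t4 t5 t6 : R,
  [/\ t1 < t2 < t3, t3 < t4 < t5 & t5 < t6 < t1 + 1] /\
  [/\ g t1 = g t4, g t2 = g t6 & g t3 = g t5].

Lemma crossed_chord g s t : generic_immersion g -> ~ reducible g ->
  s < t -> t < s + 1 -> g s = g t ->
  exists p q, [/\ s < p, p < t, t < q, q < s + 1 & g p = g q].
Proof.
move=> gg nr st ts E; apply: contrapT => no; apply: nr; exists (g s).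
apply: (isolated_nugatory gg st ts E) => x y sx xt ty ys Exy.
by apply: no; exists x, y.
Qed.

(** Undoing the reversal of the arc from [t] to [s + 1], the chord [(x, y)] that
    crosses the image of [(p, q)] after the splice either joins the two arcs without
    crossing [(p, q)], and then [(s, t)] crosses both, or has both ends on one arc and
    crosses [(p, q)], which then crosses both [(x, y)] and [(s, t)]. *)
Lemma irreducible_pattern g : knot_projection g -> ~ reducible g -> ~ reducible_after 1 g ->
  pattern g.
Proof.
move=> [gg [c0 [s [t0 [[ns E0] _]]]]] nr nr1.
have [k /andP[k0 ts]] := shift_into s t0; move: (g_per gg t0 k) k0 ts ns.
move Et : (t0 + k%:~R) => t gt k0 ts ns.
have E : g s = g t by rewrite gt.
have st : s < t.
  rewrite lt_neqAle k0 andbT; apply/eqP => st; case/negP: ns.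
  by rewrite st -Et; apply/same_sourceP; exists k.
have [p [q [sp pt tq qs Epq]]] := crossed_chord gg nr st ts E.
have [G [spl Gg old_of kept]] := splice_exists gg st ts E.
have dpq : double_pair g p q by split=> //; apply: not_same_source; lra.
have cp : crossing g p by exists q.
have cq : crossing g q by exists p; exact: double_pair_sym.
have ps1 : p < s + 1 by lra.
have pnt : p <> t by lra.
have sq : s < q by lra.
have qnt : q <> t by lra.
have Gp : G p = g p by have := kept p sp ps1 pnt cp; rewrite /old pt.
have Gq : G (s + t + 1 - q) = g q.
  by have := kept q sq qs qnt cq; rewrite /old ifF //; apply/negbTE; rewrite -leNgt ltW.
have pq' : p < s + t + 1 - q by lra.
have qp' : s + t + 1 - q < p + 1 by lra.
have EG : G p = G (s + t + 1 - q) by rewrite Gp Gq.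
have kG : knot_projection G.
  split=> //; exists (G p), p, (s + t + 1 - q); split=> //; split=> //.
  exact: not_same_source.
have nrG : ~ reducible G.
  move=> rG; apply: nr1; exists G; split=> //; split=> //; exists (g s); split=> //.
  by exists s, t; split=> //; split=> //; exact: not_same_source.
have [x [y [px xq qy yp Exy]]] := crossed_chord Gg nrG pq' qp' EG.
have Gper z : G (z - 1) = G z by rewrite -[RHS](g_per Gg z (-1)).
have x0 : s <= x by lra.
have x1 : x < s + 1 by lra.
have nxy : ~~ same_source x y by apply: not_same_source; lra.
have [ys|sy] := ltP y (s + 1).
  have y0 : s <= y by lra.
  have [_ xt _ yt Eo] := old_of x y x0 x1 y0 ys (conj nxy Exy).
  have ty : t < y by lra.
  move: Eo; rewrite /old (ltNge y) (ltW ty) /=; case: ltP => xt' Eo.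
    exists s, p, x, t, (s + t + 1 - y), q; split; last by [].
    by split; apply/andP; split; lra.
  have tx : t < x by rewrite lt_neqAle xt' andbT eq_sym; apply/eqP.
  exists p, t, (s + t + 1 - y), q, (s + t + 1 - x), (s + 1); split.
    by split; apply/andP; split; lra.
  by split; [exact: Epq|rewrite (g_per gg s 1) -E|rewrite Eo].
have y0 : s <= y - 1 by lra.
have y1 : y - 1 < s + 1 by lra.
have dxy : double_pair G x (y - 1).
  split; last by rewrite Gper.
  by rewrite same_source_sym; apply: not_same_source; lra.
have [_ xt sy1 _ Eo] := old_of x (y - 1) x0 x1 y0 y1 dxy.
have yt : y - 1 < t by lra.
move: Eo; rewrite /old yt; case: ltP => xt' Eo.
  exists p, x, t, q, (s + 1), y; split; first by split; apply/andP; split; lra.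
  split; [exact: Epq| |by rewrite (g_per gg s 1) -E].
  by rewrite Eo -[RHS](g_per gg y (-1)).
have tx : t < x by rewrite lt_neqAle xt' andbT eq_sym; apply/eqP.
exists s, (y - 1), p, t, q, (s + t + 1 - x); split; last by [].
by split; apply/andP; split; lra.
Qed.

(** Reduction to [0, 1[ of a chord [(p, q)] with [0 <= p < q < p + 1] and [q < 2]. *)
Definition mkchord (p q : R) : R * R :=
  if q < 1 then (p, q) else if p < 1 then (q - 1, p) else (p - 1, q - 1).

Lemma mkchordP g (p q : R) : generic_immersion g -> 0 <= p -> p < q -> q < p + 1 -> q < 2 ->
  g p = g q -> chord_diagram g (mkchord p q).
Proof.
move=> gg p0 pq qp q2 E; have g1 x : g (x - 1) = g x by rewrite -[RHS](g_per gg x (-1)).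
rewrite /mkchord; case: ltP => q1; first by [].
by case: ltP => p1; split => /=; rewrite ?g1 //; lra.
Qed.

Lemma pattern_intersections (t1 t2 t3 t4 t5 t6 : R) :
  0 <= t1 -> t1 < 1 -> t1 < t2 -> t2 < t3 -> t3 < t4 -> t4 < t5 -> t5 < t6 -> t6 < t1 + 1 ->
  [/\ uniq [:: mkchord t2 t6; mkchord t3 t5; mkchord t1 t4],
      ~~ chords_intersect (mkchord t2 t6) (mkchord t3 t5),
      chords_intersect (mkchord t2 t6) (mkchord t1 t4) &
      chords_intersect (mkchord t3 t5) (mkchord t1 t4)].
Proof.
move=> h1 h2 h3 h4 h5 h6 h7 h8.
rewrite /mkchord h2 /= !inE !negb_or !andbT.
case: (ltP t6 1) => k6; case: (ltP t5 1) => k5; case: (ltP t4 1) => k4;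
  case: (ltP t3 1) => k3; case: (ltP t2 1) => k2; try (exfalso; lra).
all: rewrite /chords_intersect /=; split; try lra.
all: apply/andP; split; [apply/andP; split|]; apply/eqP => -[]; lra.
Qed.

Lemma pattern_chords g : generic_immersion g -> pattern g ->
  exists a b x : R * R,
     [/\ chord_diagram g a, chord_diagram g b & chord_diagram g x] /\
     [/\ uniq [:: a; b; x], ~~ chords_intersect a b,
         chords_intersect a x & chords_intersect b x].
Proof.
move=> gg [u1 [u2 [u3 [u4 [u5 [u6 [[l1 l2 l3] [e1 e2 e3]]]]]]]].
have [k /andP[k0 k1]] := shift_into 0 u1.
have sh x : g (x + k%:~R) = g x by exact: g_per.
pose v (x : R) := x + k%:~R.
have : [/\ 0 <= v u1 < 1, v u1 < v u2 < v u3, v u3 < v u4 < v u5 & v u5 < v u6 < v u1 + 1].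
  move: l1 l2 l3 => /andP[? ?] /andP[? ?] /andP[? ?].
  by split; apply/andP; rewrite /v; split; lra.
have : [/\ g (v u1) = g (v u4), g (v u2) = g (v u6) & g (v u3) = g (v u5)] by rewrite /v !sh.
move: (v u1) (v u2) (v u3) (v u4) (v u5) (v u6) => t1 t2 t3 t4 t5 t6 {k k0 k1 sh v l1 l2 l3 e1 e2 e3}.
move=> [e1 e2 e3] [/andP[t0 t11] /andP[t12 t23] /andP[t34 t45] /andP[t56 t61]].
have t01 : t1 < 1 by move: t11; rewrite ?add0r.
exists (mkchord t2 t6), (mkchord t3 t5), (mkchord t1 t4); split.
  by split; apply: mkchordP => //; lra.
exact: pattern_intersections.
Qed.

Lemma pattern_points g : generic_immersion g -> pattern g ->
  exists a b x : 'rV[R]_3,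
     [/\ double_point g a, double_point g b & double_point g x] /\
     [/\ a != b, a != x & b != x] /\
     exists t1 t2 t3 t4 t5 t6 : R,
       [/\ t1 < t2 < t3, t3 < t4 < t5 & t5 < t6 < t1 + 1] /\
       [/\ g t1 = x, g t2 = a & g t3 = b] /\
       [/\ g t4 = x, g t5 = b & g t6 = a].
Proof.
move=> gg [t1 [t2 [t3 [t4 [t5 [t6 [l [e1 e2 e3]]]]]]]].
have [/andP[l1 l2] /andP[l3 l4] /andP[l5 l6]] := l.
have dp x y : x < y -> y < x + 1 -> g x = g y -> double_pair g x y.
  by move=> xy yx E; split=> //; exact: not_same_source.
have [l14 l26 l35] : [/\ t1 < t4, t2 < t6 & t3 < t5] by split; lra.
have [l41 l62 l53] : [/\ t4 < t1 + 1, t6 < t2 + 1 & t5 < t3 + 1] by split; lra.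
have d14 := dp t1 t4 l14 l41 e1; have d26 := dp t2 t6 l26 l62 e2; have d35 := dp t3 t5 l35 l53 e3.
have ne x y z : double_pair g x y -> x < z -> z < y -> y < x + 1 -> g z != g x.
  move=> d xz zy yx; apply/eqP => /(double_unique gg d)[].
    by rewrite same_source_sym; apply/negP/not_same_source => //; lra.
  by apply/negP/not_same_source => //; lra.
exists (g t2), (g t3), (g t1); split; first by split; [exists t2, t6|exists t3, t5|exists t1, t4].
split.
  split; [rewrite eq_sym; apply: ne d26 _ _ _|apply: ne d14 _ _ _|apply: ne d14 _ _ _]; lra.
by exists t1, t2, t3, t4, t5, t6; split.
Qed.

End Pattern.

Theorem corollary1 (R : realType) (g : R -> 'rV[R]_3) :
  knot_projection g -> has_reductivity g 2 ->
  (exists a b x : R * R,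
     [/\ chord_diagram g a, chord_diagram g b & chord_diagram g x] /\
     [/\ uniq [:: a; b; x], ~~ chords_intersect a b,
         chords_intersect a x & chords_intersect b x]) /\
  (exists a b x : 'rV[R]_3,
     [/\ double_point g a, double_point g b & double_point g x] /\
     [/\ a != b, a != x & b != x] /\
     exists t1 t2 t3 t4 t5 t6 : R,
       [/\ t1 < t2 < t3, t3 < t4 < t5 & t5 < t6 < t1 + 1] /\
       [/\ g t1 = x, g t2 = a & g t3 = b] /\
       [/\ g t4 = x, g t5 = b & g t6 = a]).
Proof.
move=> kg [_ min]; have [gg _] := kg.
have pg : pattern g := irreducible_pattern kg (min 0%N isT) (min 1%N isT).
by split; [exact: pattern_chords|exact: pattern_points].
Qed.
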